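(* There exists an absolute constant $\eta\in(0,1)$ such that for every $q>1$ there exists a constant $c_q>0$, depending only on $q$, with the following property. For every weighted graph $(V,E,\mu)$ with vertex weight $\sigma$ and $\nu$-adapted edge-length function $\rho$ whose path metric $d_\rho$ is proper (all as in the context), and for every $o\in V$, $$\mathcal H_{q,\sigma}(o):=\int_0^\infty\sum_{x\in V}p_\sigma(t,o,x)^q\,\nu(x)\,dt\ \ge\ c_q\int_0^{\eta^2}\lambda^{q-2}\int_0^{\eta\lambda^{-1/2}} r\,\operatorname{Cap}_\lambda^\nu\bigl(B_\rho(o,r)\bigr)^{1-q}\,dr\,d\lambda$$ and moreover $$\int_0^{\eta^2}\lambda^{q-2}\int_0^{\eta\lambda^{-1/2}} r\,\operatorname{Cap}_\lambda^\nu\bigl(B_\rho(o,r)\bigr)^{1-q}\,dr\,d\lambda\ \ge\ c_q\int_1^\infty\frac{r}{M_o(2r)^{q-1}}\log\!\left(1+\frac{M_o(2r)}{r^2\,\mathcal C_{o,\rho}(r)}\right)dr ,$$ so that also $\mathcal H_{q,\sigma}(o)\ge c_q\int_1^\infty\frac{r}{M_o(2r)^{q-1}}\log\bigl(1+\frac{M_o(2r)}{r^2\mathcal C_{o,\rho}(r)}\bigr)dr$ (the value of $c_q$ may differ from one inequality to another). All quantities take values in $[0,\infty]$.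
   Context: Let $(V,E)$ be an infinite, connected, locally finite graph with at most one edge between two distinct vertices and no loops. Let $\mu:V\times V\to[0,\infty)$ be symmetric with $\mu_{xy}>0$ if $x\sim y$ and $\mu_{xy}=0$ otherwise; put $\mu(x)=\sum_{y\sim x}\mu_{xy}$. Fix $\sigma:V\to(0,\infty)$ and set $\nu(x)=\sigma(x)\mu(x)$, $\nu(A)=\sum_{x\in A}\nu(x)$. The operator is $$\Delta_\sigma f(x)=\frac1{\nu(x)}\sum_{y\sim x}\mu_{xy}(f(y)-f(x)).$$ A positive symmetric edge-length function $\rho:E\to(0,\infty)$ is $\nu$-adapted if $\sum_{y\sim x}\mu_{xy}\rho(x,y)^2\le\nu(x)$ for all $x\in V$. Its path metric is $d_\rho(x,y)=\inf\sum_{i=1}^n\rho(x_{i-1},x_i)$, the infimum over paths $x=x_0\sim x_1\sim\dots\sim x_n=y$. Properness of $d_\rho$ means that every ball $B_\rho(o,r)=\{x\in V:d_\rho(o,x)\le r\}$ is finite. Put $M_o(r)=\nu(B_\rho(o,r))$. For finite connected $D\subset V$, the Dirichlet operator $\Delta_{\sigma,D}$ is obtained by extending functions on $D$ by zero outside $D$ and applying $\Delta_\sigma$ on $D$; $p_{\sigma,D}(t,x,y)$ is its heat kernel with respect to $\nu$, i.e. $e^{t\Delta_{\sigma,D}}f(x)=\sum_{y\in D}p_{\sigma,D}(t,x,y)f(y)\nu(y)$. The minimal heat kernel $p_\sigma(t,x,y)$ is the monotone limit of $p_{\sigma,D_j}(t,x,y)$ along exhaustions of $V$ by finite connected sets $D_j$.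 $\ell_0(V)$ is the space of finitely supported real functions on $V$, and $\mathcal E_{\mathrm D}(f)=\frac12\sum_{x}\sum_{y\sim x}\mu_{xy}(f(x)-f(y))^2$. For $\lambda>0$ and nonempty finite $A\subset V$, $$\operatorname{Cap}_\lambda^\nu(A)=\inf\Bigl\{\mathcal E_{\mathrm D}(f)+\lambda\sum_{x\in V}f(x)^2\nu(x): f\in\ell_0(V),\ f\ge1\text{ on }A\Bigr\}.$$ For $0<r<R$, $$\mathcal C_{o,\rho}(r,R)=\inf\bigl\{\mathcal E_{\mathrm D}(f): f\in\ell_0(V),\ f=1\text{ on }B_\rho(o,r),\ f=0\text{ on }V\setminus B_\rho(o,R)\bigr\},$$ and $\mathcal C_{o,\rho}(r)=\mathcal C_{o,\rho}(r,2r)$. *)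

(* Defs.v *)
From HB Require Import structures.
From mathcomp Require Import all_boot all_order all_algebra.
From mathcomp Require Import finmap.
From mathcomp Require Import all_classical all_reals all_analysis.
Set Implicit Arguments.
Unset Strict Implicit.
Unset Printing Implicit Defensive.
Import Order.TTheory GRing.Theory Num.Theory.
Import numFieldNormedType.Exports.
Local Open Scope classical_set_scope.
Local Open Scope ring_scope.

Definition connected_in (V : choiceType) (adj : rel V) (D : set V) : Prop :=
  forall x y, D x -> D y -> exists s : seq V,
    [/\ path adj x s, last x s = y & forall z, z \in s -> D z].

Record weighted_graph (R : realType) (V : choiceType) := WeightedGraph {
  adj : rel V ;
  mu : V -> V -> R ;
  adj_sym : symmetric adj ;
  adj_irr : irreflexive adj ;
  vertices_infinite : infinite_set [set: V] ;
  locally_finite : forall x, finite_set [set y | adj x y] ;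
  graph_connected : connected_in adj [set: V] ;
  mu_sym : forall x y, mu x y = mu y x ;
  mu_adj_gt0 : forall x y, adj x y -> 0 < mu x y ;
  mu_nadj_eq0 : forall x y, ~~ adj x y -> mu x y = 0 }.

(* The library's [\sum_(x \in A) F x] is the sum over a set, with value 0 when
   A contains infinitely many x with F x != 0.  Below it is only used where
   only finitely many terms are nonzero: over neighbours, over finite balls, or
   with finitely supported functions.  Sums over V with possibly infinitely
   many nonzero terms are [\esum]. *)

Section WeightedGraph.
Context {R : realType} {V : choiceType} (G : weighted_graph R V).
Implicit Types (sigma f : V -> R) (rho : V -> V -> R) (x y o : V).
Implicit Types (D A : set V) (t lambda q r : R).

Definition muV x : R := \sum_(y \in [set y | adj G x y]) mu G x y.

Definition nu sigma x : R := sigma x * muV x.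

Definition laplacian sigma f x : R :=
  (nu sigma x)^-1 * \sum_(y \in [set y | adj G x y]) (mu G x y * (f y - f x)).

Definition edge_length rho : Prop :=
  (forall x y, adj G x y -> 0 < rho x y) /\
  (forall x y, adj G x y -> rho x y = rho y x).

Definition nu_adapted sigma rho : Prop :=
  forall x, \sum_(y \in [set y | adj G x y]) (mu G x y * rho x y ^+ 2)
            <= nu sigma x.

Definition path_length rho x (s : seq V) : R := \sum_(e <- pairmap rho x s) e.

Definition path_dist rho x y : R :=
  inf [set path_length rho x s | s in
        [set s : seq V | path (adj G) x s /\ last x s = y]].

Definition rho_ball rho o r : set V := [set x | path_dist rho o x <= r].

Definition proper_dist rho : Prop := forall o r, finite_set (rho_ball rho o r).

Definition vol sigma rho o r : R :=
  \sum_(x \in rho_ball rho o r) nu sigma x.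

Definition dirichlet_laplacian sigma D f : V -> R :=
  (laplacian sigma (f \_ D)) \_ D.

Definition dirichlet_semigroup sigma D t f x : R :=
  limn (series (fun n => exp_coeff t n *
                         iter n (dirichlet_laplacian sigma D) f x)).

(* The matrix entries of the semigroup with respect to nu, extended by zero
   outside D; see [dirichlet_semigroupE] below for the defining identity. *)
Definition dirichlet_kernel sigma D t x y : R :=
  if (x \in D) && (y \in D)
  then dirichlet_semigroup sigma D t \1_[set y] x / nu sigma y else 0.

Lemma laplacian_sum sigma (s : seq V) (c : V -> R) (g : V -> V -> R) x :
  laplacian sigma (fun z => \sum_(y <- s) c y * g y z) x =
  \sum_(y <- s) c y * laplacian sigma (g y) x.
Proof.
rewrite /laplacian !fsbig_finite//=; try exact: (locally_finite G x).
under eq_bigr do rewrite -sumrB mulr_sumr.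
rewrite exchange_big/= mulr_sumr; apply: eq_bigr => y _.
rewrite fsbig_finite/=; last exact: locally_finite.
rewrite mulrCA; congr (_ * _); rewrite mulr_sumr; apply: eq_bigr => z _.
by rewrite -mulrBr mulrCA.
Qed.

Let patchE0 (f : V -> R) D x : (f \_ D) x = if x \in D then f x else 0.
Proof. by []. Qed.

Lemma iter_dirichlet_laplacian_sum sigma D f n x : finite_set D -> x \in D ->
  iter n (dirichlet_laplacian sigma D) f x =
  \sum_(y <- fset_set D)
     f y * iter n (dirichlet_laplacian sigma D) \1_[set y] x.
Proof.
move=> finD; elim: n x => [|n IH] x xD.
  have xF : x \in fset_set D by rewrite in_fset_set.
  rewrite /= (big_rem x)//= big_seq big1 ?addr0 ?indicE ?in_set1 ?eqxx ?mulr1//.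
  move=> y; rewrite (mem_rem_uniq x (fset_uniq _)) inE => /andP[yx _].
  by rewrite indicE in_set1 eq_sym (negbTE yx) mulr0.
rewrite iterS {1}/dirichlet_laplacian patchE0 xD.
rewrite [X in laplacian _ X](_ : _ =
    fun z => \sum_(y <- fset_set D) f y *
               ((iter n (dirichlet_laplacian sigma D) \1_[set y]) \_ D) z).
  rewrite laplacian_sum; apply: eq_bigr => y _.
  by rewrite iterS {2}/dirichlet_laplacian patchE0 xD.
apply/funext => z; rewrite patchE0; case: ifPn => zD.
  by rewrite IH//; apply: eq_bigr => y _; rewrite patchE0 zD.
by rewrite big1// => y _; rewrite patchE0 (negbTE zD) mulr0.
Qed.

Lemma iter_dirichlet_laplacian_bound sigma D f : finite_set D ->
  exists B C : R, 0 <= B /\ 0 <= C /\ forall n x, x \in D ->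
    `|iter n (dirichlet_laplacian sigma D) f x| <= B * C ^+ n.
Proof.
move=> finD.
pose c x := `|(nu sigma x)^-1| *
  \sum_(z <- fset_set [set y | adj G x y]) (`|mu G x z| * 2).
have c0 x : 0 <= c x.
  by rewrite mulr_ge0//; apply: sumr_ge0 => z _; rewrite mulr_ge0.
have leS (h : V -> R) x : (forall y, 0 <= h y) -> x \in D ->
    h x <= \sum_(y <- fset_set D) h y.
  move=> h0 xD; have xF : x \in fset_set D by rewrite in_fset_set.
  by rewrite (big_rem x)//= lerDl sumr_ge0.
exists (\sum_(y <- fset_set D) `|f y|), (\sum_(y <- fset_set D) c y).
split; first exact: sumr_ge0.
split; first exact: sumr_ge0.
set B := (\sum_(y <- _) `|_|); set C := (\sum_(y <- _) c y).
have B0 : 0 <= B by exact: sumr_ge0.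
have C0 : 0 <= C by exact: sumr_ge0.
elim=> [|n IH] x xD; first by rewrite expr0 mulr1; exact: (leS (fun y => `|f y|)).
rewrite iterS {1}/dirichlet_laplacian patchE0 xD /laplacian.
have le_in z : `|((iter n (dirichlet_laplacian sigma D) f) \_ D) z| <= B * C ^+ n.
  rewrite patchE0; case: ifPn => zD; first exact: IH.
  by rewrite normr0 mulr_ge0// exprn_ge0.
rewrite normrM fsbig_finite/=; last exact: locally_finite.
apply: (@le_trans _ _ (c x * (B * C ^+ n))); last first.
  rewrite exprS mulrCA ler_wpM2l// ler_wpM2r ?exprn_ge0//.
  exact: leS.
rewrite /c -mulrA ler_wpM2l//.
apply: (le_trans (ler_norm_sum _ _ _)).
rewrite mulr_suml; apply: ler_sum => z _.
rewrite normrM -mulrA ler_wpM2l//.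
apply: (le_trans (ler_normB _ _)).
by rewrite mulr_natl mulr2n lerD.
Qed.

Lemma is_cvg_dirichlet_semigroup sigma D t f x : finite_set D -> x \in D ->
  cvgn (series (fun n => exp_coeff t n *
                         iter n (dirichlet_laplacian sigma D) f x)).
Proof.
move=> finD xD.
have [B [C [B0 [C0 le_it]]]] := iter_dirichlet_laplacian_bound sigma f finD.
apply: normed_cvg.
apply: (@series_le_cvg _ _ (B *: exp_coeff (`|t| * C))) => [n|n|n|].
- by rewrite /= normr_ge0.
- by rewrite mulr_ge0// exp_coeff_ge0// mulr_ge0.
- rewrite [X in _ <= X](_ : _ = `|t| ^+ n / n`!%:R * (B * C ^+ n)); last first.
    transitivity (B * ((`|t| * C) ^+ n / n`!%:R)) => //.
    by rewrite exprMn [RHS]mulrCA -!mulrA (mulrC (C ^+ n)).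
  rewrite /= normrM.
  rewrite [X in X * _ <= _](_ : _ = `|t| ^+ n / n`!%:R); last first.
    by rewrite normrM normrX normfV normr_nat.
  by rewrite ler_wpM2l ?le_it// mulr_ge0.
- exact/is_cvg_seriesZ/is_cvg_series_exp_coeff.
Qed.

Lemma dirichlet_semigroupE sigma D t f x :
  (forall y, nu sigma y != 0) -> finite_set D -> D x ->
  dirichlet_semigroup sigma D t f x =
  \sum_(y \in D) (dirichlet_kernel sigma D t x y * f y * nu sigma y).
Proof.
move=> nu0 finD /mem_set xD; rewrite fsbig_finite//=.
rewrite /dirichlet_semigroup.
under [in LHS]eq_fun do
  rewrite iter_dirichlet_laplacian_sum// mulr_sumr.
transitivity (limn (fun n => \sum_(y <- fset_set D) f y *
   series (fun n => exp_coeff t n *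
     iter n (dirichlet_laplacian sigma D) \1_[set y] x) n)).
  congr (lim (_ @ \oo)); apply/funext => n.
  rewrite /series/= exchange_big/=; apply: eq_bigr => y _.
  by rewrite mulr_sumr; apply: eq_bigr => k _; rewrite mulrCA.
apply/cvg_lim => //.
rewrite [X in _ --> X](_ : _ = \sum_(y <- fset_set D)
  f y * dirichlet_semigroup sigma D t \1_[set y] x); last first.
  rewrite big_seq [RHS]big_seq; apply: eq_bigr => y; rewrite in_fset_set// => yD.
  by rewrite /dirichlet_kernel xD yD/= mulrAC divfK// mulrC.
apply: cvg_big => [|y _]; first exact: add_continuous.
apply: cvgMl_tmp; exact: is_cvg_dirichlet_semigroup.
Qed.

Definition exhaustion (D : nat -> set V) : Prop :=
  [/\ forall j, finite_set (D j) /\ connected_in (adj G) (D j),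
      forall j, D j `<=` D j.+1
    & \bigcup_j D j = [set: V]].

Lemma exists_exhaustion : exists D : nat -> set V, exhaustion D.
Proof.
have [a _] := infinite_setN0 (vertices_infinite G).
pose D n := [set y | exists s, [/\ path (adj G) a s, last a s = y & (size s <= n)%N]].
have Dpre n s z : path (adj G) a s -> (size s <= n)%N -> z \in a :: s -> D n z.
  move=> ps sn; rewrite inE => /predU1P[->|zs]; first by exists [::].
  case/splitPr: zs ps sn => s1 s2; rewrite -cat_rcons cat_path => /andP[ps _].
  rewrite size_cat => /(leq_trans (leq_addr _ _)) sn.
  by exists (rcons s1 z); split => //; rewrite last_rcons.
exists D; split=> [n|n y [s [ps ls sn]]|]; last 2 first.
- by exists s; split => //; exact: leqW.
- apply/seteqP; split => // y _.
  have [//|//|s [ps ls _]] := graph_connected G (x := a) (y := y).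
  by exists (size s) => //; exists s.
split.
  elim: n => [|n IH].
    apply: (@sub_finite_set _ _ [set a]); last exact: finite_set1.
    by move=> y [[|z s] []].
  apply: (@sub_finite_set _ _ (D n `|` \bigcup_(x in D n) [set y | adj G x y])).
    move=> y [s]; case/lastP: s => [|s z] [].
      by move=> _ <- _; left; exists [::].
    rewrite rcons_path last_rcons size_rcons => /andP[ps lz] <- sn.
    by right; exists (last a s) => //; exists s.
  rewrite finite_setU; split => //; apply: bigcup_finite => // x _.
  exact: locally_finite.
move=> x y [s [ps ls sn]] [s' [ps' ls' sn']].
exists (rev (belast a s) ++ s'); split.
- rewrite cat_path -{1}ls rev_path.
  rewrite (eq_path (e' := adj G)) ?ps/=; last by move=> u v; rewrite adj_sym.
  suff -> : last x (rev (belast a s)) = a by [].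
  by case: s ps ls sn => [_ <-|z s ps ls sn]//=; rewrite rev_cons last_rcons.
- suff -> : last x (rev (belast a s) ++ s') = last a s' by [].
  rewrite last_cat; congr (last _ s').
  by case: s ps ls sn => [_ <-|z s ps ls sn]//=; rewrite rev_cons last_rcons.
- move=> z; rewrite mem_cat mem_rev => /orP[/mem_belast|] zs.
    exact: Dpre zs.
  by apply: Dpre ps' sn' _; rewrite inE zs orbT.
Qed.

Definition heat_kernel sigma (D : nat -> set V) t x y : R :=
  limn (fun j => dirichlet_kernel sigma (D j) t x y).

Definition finitely_supported f : Prop := finite_set [set x | f x != 0].

Definition energy f : R :=
  2^-1 * \sum_(x \in [set: V]) \sum_(y \in [set y | adj G x y])
           (mu G x y * (f x - f y) ^+ 2).

Definition Cap sigma lambda A : R :=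
  inf [set energy f + lambda * \sum_(x \in [set: V]) (f x ^+ 2 * nu sigma x)
      | f in [set f | finitely_supported f /\ forall x, A x -> 1 <= f x]].

Definition annulus_cap rho o r r' : R :=
  inf [set energy f | f in [set f | [/\ finitely_supported f,
    forall x, rho_ball rho o r x -> f x = 1
    & forall x, ~ rho_ball rho o r' x -> f x = 0]]].

Definition heat_integral sigma (D : nat -> set V) q o : \bar R :=
  \int[lebesgue_measure]_(t in `]0, +oo[)
    \esum_(x in [set: V]) (heat_kernel sigma D t o x `^ q * nu sigma x)%:E.

Definition cap_integral sigma rho (eta : R) q o : \bar R :=
  \int[lebesgue_measure]_(lambda in `]0, (eta ^+ 2)%R[)
    ((lambda `^ (q - 2))%:E *
     \int[lebesgue_measure]_(r in `]0%R, (eta * lambda `^ (- 2^-1))%R[)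
       (r * Cap sigma lambda (rho_ball rho o r) `^ (1 - q))%:E)%E.

Definition volume_integral sigma rho q o : \bar R :=
  \int[lebesgue_measure]_(r in `]1, +oo[)
    (r / vol sigma rho o (2 * r) `^ (q - 1) *
     ln (1 + vol sigma rho o (2 * r) /
             (r ^+ 2 * annulus_cap rho o r (2 * r))))%:E.

End WeightedGraph.

(* Main.v *)
Require Import Defs.
From mathcomp Require Import all_boot all_order all_algebra.
From mathcomp Require Import finmap.
From mathcomp Require Import all_classical all_reals all_analysis.
From mathcomp Require Import measurable_realfun.
From mathcomp Require Import ring lra.
Import Order.TTheory GRing.Theory Num.Theory.
Import numFieldNormedType.Exports.
Local Open Scope classical_set_scope.
Local Open Scope ring_scope.

Set Implicit Arguments.
Unset Strict Implicit.

(** The heat kernel is compared with capacities through the Green functions g of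
    lam - Laplacian with pole o on the finite sets of the exhaustion: g is the
    Laplace transform in time of the Dirichlet heat kernel. On the
    nonnegative functions at hand the Laplace transform is bounded from L^q(dt) to
    L^q(lam^(q-2) dlam) ([laplace_Lq]), so the heat integral controls the integral
    of lam^(q-2) times the level mass, which is the sum of g^q nu.

    For one lam, the integral of r Cap(B_r)^(1-q) up to radius lam^(-1/2) / 2 is
    controlled by the level mass of a large finite domain ([level_integral]), and
    monotone convergence along the exhaustion finishes the first inequality with
    eta = 1/2. To see this, fix a scale r and let f be a nearly minimal competitor
    for Cap(B_r). The form of f against g is f(o) = 1, and truncating g at a small
    multiple k of 1 / Cap(B_r) loses at most a quarter of this flux. What remains
    is carried by the killing inside B_r or by the edges where g exceeds k
    ([capacity_alternative]). In the second case, testing the equation of g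
    against ln(g/k) (1 - phi)^2, with phi a cutoff inside B_r equal to 1 at o,
    bounds Cap(B_r)^(1-q) by the sum of g^q |grad phi|^2 ([scale_estimate]). Over
    dyadic radii the slopes of the cutoffs live on disjoint annuli and the metric
    is adapted, so that the sum of r^2 |grad phi_r|^2 is at most 4 nu and all these
    scales share one level mass. In the first case, convexity bounds Cap(B_r)^(1-q)
    by a multiple of lam times the level mass, and r^2 lam decays geometrically
    ([scale_cost], [level_sum]).

    For the volume inequality, let A be the capacity of the annulus between r and
    2r and M the volume of the ball of radius 2r. Competitors for A, truncated,
    give Cap(B_r) <= A + lam M. Hence for lam between A / (8M) and 1 / (4r^2) the
    capacity is at most 9 lam M, and the integrand of the capacity integral is at
    least r (9M)^(1-q) / lam. Integrating in lam first produces ln(2X) with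
    X = M / (r^2 A), and X >= 1 because the metric is adapted, whence
    ln(2X) >= ln(1 + X) ([volume_le_cap_integral]). *)

(** * Logarithmic inequalities on one edge *)

Lemma ln_sub_ge (R : realType) (a b : R) : 0 < b -> b <= a ->
  (a - b) / a <= ln a - ln b.
Proof.
move=> b0 ba; have a0 : 0 < a by exact: lt_le_trans ba.
have : ln (b / a) <= b / a - 1.
  have := @le_ln1Dx _ (b / a - 1); rewrite addrCA subrr addr0; apply.
  by rewrite ltrBrDl addrN divr_gt0.
rewrite ln_div ?posrE//; have -> : (a - b) / a = 1 - b / a by field; lra.
lra.
Qed.

Lemma sq_mul_ge (R : realType) (a d s B u : R) : 0 < a ->
  2 * (d * s * (B * u)) <= 2^-1 * (d ^+ 2 / a) * s ^+ 2 + 2 * a * B ^+ 2 * u ^+ 2.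
Proof.
move=> a0; have a0' : a != 0 by lra.
rewrite -subr_ge0 (_ : _ - _ = (2 * a)^-1 * (d * s - 2 * a * B * u) ^+ 2); last by field.
by rewrite mulr_ge0 ?sqr_ge0// invr_ge0; lra.
Qed.

(** The logarithm varies by at least (a - b) / a, which produces the energy term;
    the variation of the cutoff is absorbed by Young's inequality when t exceeds
    s, and has the favourable sign otherwise. *)
Lemma caccioppoli_edge_ord (R : realType) (k a b s t : R) :
  0 < k -> k <= b -> b <= a -> 0 <= s -> 0 <= t ->
  let L := ln (a / k) in
  2^-1 * ((a - b) ^+ 2 / a) * Num.min s t ^+ 2
    - (2 * a * L ^+ 2 + a * L) * (s - t) ^+ 2
  <= (a - b) * (L * s ^+ 2 - ln (b / k) * t ^+ 2).
Proof.
move=> k0 kb ba s0 t0 /=; set L := ln (a / k).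
have b0 : 0 < b by exact: lt_le_trans kb.
have a0 : 0 < a by exact: lt_le_trans ba.
set B := ln (b / k).
have B0 : 0 <= B by rewrite ln_ge0// ler_pdivlMr// mul1r.
have LBd : (a - b) / a <= L - B.
  rewrite /L /B !ln_div ?posrE//; have := @ln_sub_ge R a b b0 ba; lra.
have d0 : 0 <= a - b by lra.
have w0 : 0 <= (a - b) / a by rewrite divr_ge0// ltW.
have BL : B <= L by lra.
set d := a - b in LBd d0 w0 *.
have dd : d ^+ 2 / a <= d * (L - B).
  by rewrite expr2 -mulrA ler_wpM2l.
set w := d ^+ 2 / a in dd *.
have wp : 0 <= w by rewrite divr_ge0 ?sqr_ge0// ltW.
have rest : 0 <= (2 * a * L ^+ 2 + a * L) * (s - t) ^+ 2.
  rewrite mulr_ge0 ?sqr_ge0// addr_ge0// !mulr_ge0// ?sqr_ge0//; lra.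
have [ts|st] := leP t s.
  apply: (@le_trans _ _ (w * t ^+ 2)).
    have := mulr_ge0 wp (sqr_ge0 t); lra.
  apply: (@le_trans _ _ (d * (L - B) * t ^+ 2)).
    by rewrite ler_wpM2r ?sqr_ge0.
  rewrite -mulrA ler_wpM2l// mulrBl lerD2r ler_wpM2l//; first by lra.
  by rewrite ler_pXn2r ?nnegrE.
set u := t - s.
have u0 : 0 <= u by rewrite /u; lra.
have -> : d * (L * s ^+ 2 - B * t ^+ 2) =
    d * (L - B) * s ^+ 2 - 2 * (d * s * (B * u)) - d * B * u ^+ 2.
  by rewrite /u; ring.
have -> : (s - t) ^+ 2 = u ^+ 2 by rewrite /u; ring.
have H1 : w * s ^+ 2 <= d * (L - B) * s ^+ 2 by rewrite ler_wpM2r ?sqr_ge0.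
have H2 := @sq_mul_ge R a d s B u a0.
have H3 : d * B * u ^+ 2 <= a * L * u ^+ 2.
  rewrite ler_wpM2r ?sqr_ge0// ler_pM//; rewrite /d; lra.
have H4 : 2 * a * B ^+ 2 * u ^+ 2 <= 2 * a * L ^+ 2 * u ^+ 2.
  rewrite ler_wpM2r ?sqr_ge0// ler_wpM2l//; first by lra.
  rewrite ler_pXn2r ?nnegrE//; lra.
rewrite -/w in H2; lra.
Qed.

(** The contribution of one edge when the equation satisfied by a function is
    tested against its logarithm times the square of a cutoff: a and b stand for
    the values of the function, s and t for those of the cutoff. *)
Lemma caccioppoli_edge (R : realType) (k a b s t : R) :
  0 < k -> k <= a -> k <= b -> 0 <= s -> 0 <= t ->
  let m := Num.max a b in let L := ln (m / k) in
  2^-1 * ((a - b) ^+ 2 / m) * Num.min s t ^+ 2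
    - (2 * m * L ^+ 2 + m * L) * (s - t) ^+ 2
  <= (a - b) * (ln (a / k) * s ^+ 2 - ln (b / k) * t ^+ 2).
Proof.
move=> k0 ka kb s0 t0 /=.
have [ab|ba] := leP a b.
  have := @caccioppoli_edge_ord R k b a t s k0 ka ab t0 s0.
  rewrite /= minC -(opprB a b) sqrrN -(opprB s t) sqrrN mulNr -mulrN opprB//.
have := @caccioppoli_edge_ord R k a b s t k0 kb (ltW ba) s0 t0.
by rewrite /=.
Qed.

(** Serves on the edges across which the cutoff jumps by a fixed amount, where
    the previous estimate gives nothing. *)
Lemma jump_edge (R : realType) (k a b : R) : 0 < k -> k <= a -> k <= b ->
  let m := Num.max a b in (a - b) ^+ 2 / m <= m * ln (m / k).
Proof.
move=> k0; wlog ba : a b / b <= a.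
  move=> H ka kb /=; have [ba|/ltW ab] := leP b a; first by have := H a b ba ka kb; rewrite /= max_l.
  by have := H b a ab kb ka; rewrite /= max_l// -(opprB a b) sqrrN.
move=> ka kb; rewrite /= (max_l ba).
have b0 : 0 < b by exact: lt_le_trans kb.
have a0 : 0 < a by exact: lt_le_trans ba.
have := @ln_sub_ge R a b b0 ba; rewrite ler_pdivrMr// => H.
have H2 : ln k <= ln b by rewrite ler_ln ?posrE.
have H3 : a - b <= a * ln (a / k).
  rewrite ln_div ?posrE//; apply: (le_trans H); rewrite mulrC ler_wpM2l//; lra.
apply: le_trans H3; rewrite ler_pdivrMr// expr2 ler_wpM2l//; lra.
Qed.

Lemma ln_le_powR (R : realType) (e z : R) : 0 < e -> 1 <= z -> ln z <= e^-1 * z `^ e.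
Proof.
move=> e0 z1; have z0 : 0 < z by lra.
rewrite mulrC ler_pdivlMr// mulrC -ln_powR.
have p0 : 0 < z `^ e by rewrite powR_gt0.
have := @le_ln1Dx _ (z `^ e - 1); rewrite addrCA subrr addr0 => H.
by apply: (le_trans (H _)); rewrite ?ltrBrDl ?addrN// gerBl.
Qed.

Lemma powRD_gt0 (R : realType) (x a b : R) : 0 < x ->
  x `^ (a + b) = x `^ a * x `^ b.
Proof. by move=> x0; rewrite powRD// (gt_eqF x0) implybT. Qed.

Definition log_const (R : realType) (q : R) : R := 8 / (q - 1) ^+ 2 + (q - 1)^-1.

Lemma log_const_gt0 (R : realType) (q : R) : 1 < q -> 0 < log_const q.
Proof.
move=> q1; have q0 : 0 < q - 1 by rewrite subr_gt0.
by rewrite /log_const addr_gt0 ?invr_gt0// divr_gt0// exprn_gt0.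
Qed.

(** A logarithm costs an arbitrarily small power: the room is the excess q - 1,
    shared between the two factors of the squared logarithm. *)
Lemma log_weight_le (R : realType) (q k a : R) : 1 < q -> 0 < k -> k <= a ->
  let L := ln (a / k) in
  2 * a * L ^+ 2 + a * L <= log_const q * k `^ (1 - q) * a `^ q.
Proof.
move=> q1 k0 ka /=; set L := ln (a / k); have a0 : 0 < a by exact: lt_le_trans ka.
set z := a / k; have z1 : 1 <= z by rewrite /z ler_pdivlMr// mul1r.
have z0 : 0 < z by lra.
have az : a = k * z by rewrite /z mulrC divfK//; lra.
have pz : z `^ q = z * z `^ (q - 1).
  have -> : z `^ q = z `^ (1 + (q - 1)) by rewrite subrKC.
  by rewrite (@powRD_gt0 _ z 1)// powRr1// ltW.
have pk : k `^ (1 - q) * k `^ q = k.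
  by rewrite -powRD_gt0// subrK powRr1 ?ltW.
have -> : log_const q * k `^ (1 - q) * a `^ q = a * (log_const q * z `^ (q - 1)).
  have -> : a `^ q = k `^ q * z `^ q by rewrite -powRM ?az//; lra.
  by rewrite pz [X in _ = X * _]az -[X in _ = X * _ * _]pk; ring.
rewrite (_ : 2 * a * L ^+ 2 + a * L = a * (2 * L ^+ 2 + L)); last by ring.
rewrite ler_pM2l//.
set e := (q - 1) / 2; have e0 : 0 < e by rewrite /e; lra.
have L0 : 0 <= L by rewrite ln_ge0.
have H1 : L <= e^-1 * z `^ e by exact: ln_le_powR.
have H2 : L <= (q - 1)^-1 * z `^ (q - 1) by apply: ln_le_powR => //; lra.
have H3 : L ^+ 2 <= (e^-1 * z `^ e) ^+ 2.
  by rewrite ler_pXn2r ?nnegrE// mulr_ge0 ?powR_ge0// invr_ge0 ltW.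
have H4 : (e^-1 * z `^ e) ^+ 2 = 4 / (q - 1) ^+ 2 * z `^ (q - 1).
  rewrite exprMn [X in _ * X]expr2 -powRD_gt0//.
  have -> : e + e = q - 1 by rewrite /e; lra.
  congr (_ * _); rewrite /e; field; lra.
rewrite /log_const.
have -> : (8 / (q - 1) ^+ 2 + (q - 1)^-1) * z `^ (q - 1) =
  2 * (4 / (q - 1) ^+ 2 * z `^ (q - 1)) + (q - 1)^-1 * z `^ (q - 1) by field; lra.
rewrite -H4; lra.
Qed.

(** * Green functions and capacity at one scale *)

Section Network.
Context {R : realType} {V : choiceType}.
Variables (W : seq V) (mu : V -> V -> R).
Hypothesis mu_ge0 : forall x y, 0 <= mu x y.
Hypothesis mu_sym : forall x y, mu x y = mu y x.
Implicit Types (F : V -> V -> R) (f g h : V -> R).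

Definition edge_sum F : R := \sum_(x <- W) \sum_(y <- W) mu x y * F x y.

Lemma edge_sum_le F F' : (forall x y, F x y <= F' x y) ->
  edge_sum F <= edge_sum F'.
Proof.
by move=> FF'; apply: ler_sum => x _; apply: ler_sum => y _; rewrite ler_wpM2l.
Qed.

Lemma edge_sum_ge0 F : (forall x y, 0 <= F x y) -> 0 <= edge_sum F.
Proof.
by move=> F0; apply: sumr_ge0 => x _; apply: sumr_ge0 => y _; rewrite mulr_ge0.
Qed.

Lemma eq_edge_sum F F' : (forall x y, F x y = F' x y) -> edge_sum F = edge_sum F'.
Proof. by move=> e; apply: eq_bigr => x _; apply: eq_bigr => y _; rewrite e. Qed.

Lemma edge_sumD F F' :
  edge_sum (fun x y => F x y + F' x y) = edge_sum F + edge_sum F'.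
Proof.
rewrite /edge_sum -big_split/=; apply: eq_bigr => x _.
by rewrite -big_split/=; apply: eq_bigr => y _; rewrite mulrDr.
Qed.

Lemma edge_sumZ c F : edge_sum (fun x y => c * F x y) = c * edge_sum F.
Proof.
rewrite /edge_sum mulr_sumr; apply: eq_bigr => x _; rewrite mulr_sumr.
by apply: eq_bigr => y _; rewrite mulrCA.
Qed.

Lemma edge_sumC F : edge_sum (fun x y => F y x) = edge_sum F.
Proof.
rewrite /edge_sum exchange_big/=; apply: eq_bigr => x _.
by apply: eq_bigr => y _; rewrite mu_sym.
Qed.

Variables (nu : V -> R) (lam : R).
Hypothesis nu_ge0 : forall x, 0 <= nu x.
Hypothesis lam_ge0 : 0 <= lam.

Definition mass_sum h : R := \sum_(x <- W) h x * nu x.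

Lemma mass_sum_le h h' : (forall x, h x <= h' x) -> mass_sum h <= mass_sum h'.
Proof. by move=> hh'; apply: ler_sum => x _; rewrite ler_wpM2r. Qed.

Lemma mass_sum_ge0 h : (forall x, 0 <= h x) -> 0 <= mass_sum h.
Proof. by move=> h0; apply: sumr_ge0 => x _; rewrite mulr_ge0. Qed.

Lemma eq_mass_sum h h' : (forall x, h x = h' x) -> mass_sum h = mass_sum h'.
Proof. by move=> e; apply: eq_bigr => x _; rewrite e. Qed.

Lemma mass_sumD h h' : mass_sum (fun x => h x + h' x) = mass_sum h + mass_sum h'.
Proof. by rewrite /mass_sum -big_split/=; apply: eq_bigr => x _; rewrite mulrDl. Qed.

Lemma mass_sumZ c h : mass_sum (fun x => c * h x) = c * mass_sum h.
Proof. by rewrite /mass_sum mulr_sumr; apply: eq_bigr => x _; rewrite mulrA. Qed.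

(** The Dirichlet form of lam - Laplacian on a finite network. *)
Definition killed_form f h : R :=
  2^-1 * edge_sum (fun x y => (f x - f y) * (h x - h y)) +
  lam * mass_sum (fun x => f x * h x).

Lemma killed_formC f h : killed_form f h = killed_form h f.
Proof.
rewrite /killed_form; congr (_ * _ + _ * _).
  by apply: eq_edge_sum => x y; rewrite mulrC.
by apply: eq_mass_sum => x; rewrite mulrC.
Qed.

Lemma killed_formDr f h h' : killed_form f (fun x => h x + h' x) = killed_form f h + killed_form f h'.
Proof.
have e1 : edge_sum (fun x y => (f x - f y) * (h x + h' x - (h y + h' y))) =
    edge_sum (fun x y => (f x - f y) * (h x - h y)) +
    edge_sum (fun x y => (f x - f y) * (h' x - h' y)).
  by rewrite -edge_sumD; apply: eq_edge_sum => x y; ring.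
have e2 : mass_sum (fun x => f x * (h x + h' x)) =
    mass_sum (fun x => f x * h x) + mass_sum (fun x => f x * h' x).
  by rewrite -mass_sumD; apply: eq_mass_sum => x; ring.
by rewrite /killed_form e1 e2; ring.
Qed.

Lemma killed_formZr f c h : killed_form f (fun x => c * h x) = c * killed_form f h.
Proof.
have e1 : edge_sum (fun x y => (f x - f y) * (c * h x - c * h y)) =
    c * edge_sum (fun x y => (f x - f y) * (h x - h y)).
  by rewrite -edge_sumZ; apply: eq_edge_sum => x y; ring.
have e2 : mass_sum (fun x => f x * (c * h x)) = c * mass_sum (fun x => f x * h x).
  by rewrite -mass_sumZ; apply: eq_mass_sum => x; ring.
by rewrite /killed_form e1 e2; ring.
Qed.

Lemma eq_killed_formr f h h' : (forall x, h x = h' x) -> killed_form f h = killed_form f h'.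
Proof. by move=> e; congr killed_form; apply/funext. Qed.

Lemma killed_form_ge0 f : 0 <= killed_form f f.
Proof.
rewrite addr_ge0 ?mulr_ge0 ?invr_ge0//.
  by apply: edge_sum_ge0 => x y; rewrite -expr2 sqr_ge0.
by apply: mass_sum_ge0 => x; rewrite -expr2 sqr_ge0.
Qed.

Lemma killed_form_sqrD f t h : killed_form (fun x => f x + t * h x) (fun x => f x + t * h x) =
  killed_form f f + 2 * t * killed_form f h + t ^+ 2 * killed_form h h.
Proof.
rewrite killed_formDr killed_formZr ![killed_form (fun x => _ + _) _]killed_formC !killed_formDr !killed_formZr (killed_formC h f).
by ring.
Qed.

Lemma killed_form_young f h t : 0 < t ->
  killed_form f h <= 2^-1 * (t * killed_form f f + t^-1 * killed_form h h).
Proof.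
move=> t0; have := killed_form_ge0 (fun x => f x + (- t^-1) * h x).
rewrite killed_form_sqrD => /(ler_wpM2l (ltW t0)); rewrite mulr0 => H.
have E : t * (killed_form f f + 2 * - t^-1 * killed_form f h + (- t^-1) ^+ 2 * killed_form h h) =
  t * killed_form f f - 2 * killed_form f h + t^-1 * killed_form h h by field; lra.
rewrite E in H; lra.
Qed.

(** Setting of the scale estimate: g is the Green function of a finite set D
    with pole o, f a nearly minimal competitor for the capacity of B, and phi a
    cutoff living inside B. *)
Variables (q : R) (D B : pred V) (o : V) (g f phi : V -> R).
Hypothesis q_gt1 : 1 < q.
Hypothesis g_ge0 : forall x, 0 <= g x.
Hypothesis g_off : forall x, ~~ D x -> g x = 0.
Hypothesis green : forall h, (forall x, ~~ D x -> h x = 0) -> killed_form g h = h o.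
Hypothesis f_ge0 : forall x, 0 <= f x.
Hypothesis f_le1 : forall x, f x <= 1.
Hypothesis f_off : forall x, ~~ D x -> f x = 0.
Hypothesis f_B : forall x, B x -> f x = 1.
Hypothesis f_pos : 0 < killed_form f f.
Hypothesis f_min : - 2^-1 <= killed_form f (fun x => g x * (1 - f x)).
Hypothesis phi_ge0 : forall x, 0 <= phi x.
Hypothesis phi_le1 : forall x, phi x <= 1.
Hypothesis phi_o : phi o = 1.
Hypothesis phi_B : forall x, 0 < phi x -> B x.

Let kap := killed_form f f.
Let k := (16 * kap)^-1.
Let G x := Num.max (g x) k.
Let H x := ln (G x / k).
Let psi x : R := 1 - phi x.
Let m x y := Num.max (G x) (G y).
Let L x y := ln (m x y / k).
Let Q := edge_sum (fun x y =>
  (2 * m x y * L x y ^+ 2 + m x y * L x y) * (phi x - phi y) ^+ 2).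

Let k0 : 0 < k.
Proof. by rewrite invr_gt0 mulr_gt0. Qed.

Let kkap : k * kap = 16^-1.
Proof. by rewrite /k; field; rewrite gt_eqF. Qed.

Let fo : f o = 1.
Proof. by apply/f_B/phi_B; rewrite phi_o. Qed.

Let Do : D o.
Proof.
by apply/negPn/negP => /f_off; rewrite fo => /eqP; rewrite oner_eq0.
Qed.

(** The equation of g tested against f and f ^ 2 gives twice the value 1, and
    near minimality bounds the form of f against g * f; the difference of these
    forms is the energy of f weighted by g. *)
Lemma green_weighted_energy :
  edge_sum (fun x y => (g x + g y) * (f x - f y) ^+ 2) <= 4.
Proof.
have e1 : killed_form g f = 1 by rewrite green.
have e2 : killed_form g (fun x => f x ^+ 2) = 1.
  by rewrite green ?fo ?expr1n// => x /f_off ->; rewrite expr0n.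
have e3 : killed_form f (fun x => g x * f x) <= 3 / 2.
  have := f_min; rewrite (@eq_killed_formr _ _ (fun x => g x + (-1) * (g x * f x))).
    by rewrite killed_formDr killed_formZr killed_formC e1; lra.
  by move=> x; ring.
have e4 : 4^-1 * edge_sum (fun x y => (g x + g y) * (f x - f y) ^+ 2) =
  2^-1 * edge_sum (fun x y => (f x - f y) * (g x * f x - g y * f y)) -
  2^-1 * (2^-1 * edge_sum (fun x y => (g x - g y) * (f x ^+ 2 - f y ^+ 2))).
  rewrite -!edge_sumZ -(mulN1r (edge_sum _)) -edge_sumZ -edge_sumD.
  by apply: eq_edge_sum => x y; field.
move: e3 e2; rewrite /killed_form => e3 e2.
have e5 : mass_sum (fun x => f x * (g x * f x)) =
          mass_sum (fun x => g x * f x ^+ 2).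
  by apply: eq_mass_sum => x; ring.
have e6 : 0 <= lam * mass_sum (fun x => g x * f x ^+ 2).
  by rewrite mulr_ge0// mass_sum_ge0// => x; rewrite mulr_ge0// sqr_ge0.
rewrite e5 in e3; lra.
Qed.

Let Gk x : k <= G x. Proof. by rewrite /G le_max lexx orbT. Qed.
Let G0 x : 0 < G x. Proof. exact: lt_le_trans (Gk x). Qed.
Let mk x y : k <= m x y. Proof. by rewrite /m le_max Gk. Qed.
Let m0 x y : 0 < m x y. Proof. exact: lt_le_trans (mk x y). Qed.
Let H0 x : 0 <= H x.
Proof. by rewrite /H ln_ge0// ler_pdivlMr// mul1r. Qed.
Let L0 x y : 0 <= L x y.
Proof. by rewrite /L ln_ge0// ler_pdivlMr// mul1r. Qed.
Let psi0 x : 0 <= psi x. Proof. by rewrite /psi subr_ge0. Qed.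

Let mL0 x y : 0 <= m x y * L x y.
Proof. by rewrite mulr_ge0// ltW. Qed.
Let mLL0 x y : 0 <= 2 * m x y * L x y ^+ 2.
Proof. by rewrite mulr_ge0 ?sqr_ge0// mulr_ge0// ltW. Qed.
Let c0 x y : 0 <= 2 * m x y * L x y ^+ 2 + m x y * L x y.
Proof. by rewrite addr_ge0. Qed.

(** The truncation of g at height k has form at most k, by testing the equation
    of g against it; Young's inequality concludes since k * kap = 1 / 16. *)
Lemma competitor_truncated_green : killed_form f (fun x => Num.min (g x) k) <= 4^-1.
Proof.
have tr : killed_form (fun x => Num.min (g x) k) (fun x => Num.min (g x) k) <= k.
  apply: (@le_trans _ _ (killed_form g (fun x => Num.min (g x) k))).
    rewrite lerD// ler_wpM2l ?invr_ge0//.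
      apply: edge_sum_le => x y; rewrite /Num.min.
      case: ifPn => gx; case: ifPn => gy; rewrite -?leNgt in gx gy *; nra.
    apply: mass_sum_le => x; apply: ler_wpM2r; last by rewrite ge_min lexx.
    by rewrite le_min g_ge0 ltW.
  rewrite green ?ge_min ?lexx ?orbT// => x /g_off ->.
  by rewrite min_l// ltW.
have := @killed_form_young f (fun x => Num.min (g x) k) (4 * kap)^-1.
rewrite invr_gt0 mulr_gt0// => /(_ isT); rewrite invrK.
have -> : (4 * kap)^-1 * killed_form f f = 4^-1 by rewrite -/kap; field; rewrite gt_eqF.
move=> H1; apply: (le_trans H1).
have : 4 * kap * killed_form (fun x => Num.min (g x) k) (fun x => Num.min (g x) k) <= 4 * kap * k.
  by rewrite ler_wpM2l// mulr_ge0// ltW.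
move: kkap; lra.
Qed.

(** The form of f against g is f o = 1, and by the previous bound the part of g
    above height k keeps three quarters of it. *)
Lemma flux_lower_bound :
  3 / 4 <= 2^-1 * edge_sum (fun x y => (f x - f y) * (G x - G y)) +
           lam * mass_sum (fun x => f x * (G x - k)).
Proof.
have e1 : killed_form f g = 1 by rewrite killed_formC green.
have := competitor_truncated_green.
have -> : killed_form f (fun x => Num.min (g x) k) =
  killed_form f g - killed_form f (fun x => G x - k).
  rewrite -(mulN1r (killed_form f (fun x => _ - _))) -killed_formZr -killed_formDr; apply: eq_killed_formr => x.
  by rewrite /G; have := addr_max_min (g x) k; lra.
rewrite e1 {1}/killed_form.
have -> : edge_sum (fun x y => (f x - f y) * (G x - k - (G y - k))) =
  edge_sum (fun x y => (f x - f y) * (G x - G y)).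
  by apply: eq_edge_sum => x y; ring.
lra.
Qed.

Let h x := H x * psi x ^+ 2.

(** The equation of g tested against h = ln (G / k) * psi ^ 2, a function that
    vanishes at the pole because psi does. *)
Lemma green_caccioppoli :
  4^-1 * edge_sum (fun x y => (G x - G y) ^+ 2 / m x y * Num.min (psi x) (psi y) ^+ 2)
  + lam * mass_sum (fun x => g x * h x) <= 2^-1 * Q.
Proof.
have Hk x : g x <= k -> H x = 0.
  by move=> gk; rewrite /H /G max_r// divff ?ln1// gt_eqF.
have h_off x : ~~ D x -> h x = 0.
  by move=> /g_off gx; rewrite /h Hk ?mul0r// gx ltW.
have h0 x : 0 <= h x by rewrite mulr_ge0 ?sqr_ge0.
have := @green h h_off; rewrite /h /psi phi_o subrr expr0n mulr0 -/psi -/h /killed_form => gr.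
have le1 : edge_sum (fun x y => (G x - G y) * (h x - h y)) <=
  edge_sum (fun x y => (g x - g y) * (h x - h y)).
  apply: edge_sum_le => x y.
  have hx : g x <= k -> h x = 0 by move=> /Hk; rewrite /h => ->; rewrite mul0r.
  have hy : g y <= k -> h y = 0 by move=> /Hk; rewrite /h => ->; rewrite mul0r.
  have := h0 x; have := h0 y; rewrite /G.
  have [gx|gx] := leP (g x) k; have [gy|gy] := leP (g y) k.
  - by rewrite hx// hy// !subrr !mulr0.
  - by rewrite hx//; nra.
  - by rewrite hy//; nra.
  - by [].
have le2 : edge_sum (fun x y =>
    2^-1 * ((G x - G y) ^+ 2 / m x y) * Num.min (psi x) (psi y) ^+ 2
    - (2 * m x y * L x y ^+ 2 + m x y * L x y) * (phi x - phi y) ^+ 2) <=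
  edge_sum (fun x y => (G x - G y) * (h x - h y)).
  apply: edge_sum_le => x y.
  have := @caccioppoli_edge R k (G x) (G y) (psi x) (psi y) k0 (Gk x) (Gk y) (psi0 x) (psi0 y).
  rewrite /= -/(m x y) -/(L x y).
  have -> : (psi x - psi y) ^+ 2 = (phi x - phi y) ^+ 2 by rewrite /psi; ring.
  by [].
have e : edge_sum (fun x y =>
    2^-1 * ((G x - G y) ^+ 2 / m x y) * Num.min (psi x) (psi y) ^+ 2
    - (2 * m x y * L x y ^+ 2 + m x y * L x y) * (phi x - phi y) ^+ 2) =
  2^-1 * edge_sum (fun x y => (G x - G y) ^+ 2 / m x y * Num.min (psi x) (psi y) ^+ 2) - Q.
  rewrite /Q -edge_sumZ -(mulN1r (edge_sum _)) -edge_sumZ -edge_sumD.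
  by apply: eq_edge_sum => x y; ring.
rewrite e in le2; lra.
Qed.

(** The flux above height k is carried either by the killing or by edges. The
    killing where psi >= 1/2, in particular outside B, is controlled by
    [green_caccioppoli] because g - k <= g ln (g / k). On an edge along which f varies, Young's inequality
    leaves the energy of g, which [green_caccioppoli] controls when psi >= 1/2 at
    both ends. Otherwise phi > 1/2 at one end, where f = 1; then f < 1 at the
    other end, where phi must vanish, so that phi jumps and [jump_edge] applies. *)
Lemma capacity_alternative :
  3 / 4 <= lam * mass_sum (fun x => (B x)%:R * g x) + 8^-1 + 32 * Q.
Proof.
have c := green_caccioppoli.
set P := edge_sum (fun x y =>
  (G x - G y) ^+ 2 / m x y * Num.min (psi x) (psi y) ^+ 2) in c.
set K := mass_sum (fun x => g x * h x) in c.
have P0 : 0 <= P.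
  apply: edge_sum_ge0 => x y; rewrite mulr_ge0 ?sqr_ge0// mulr_ge0 ?sqr_ge0//.
  by rewrite invr_ge0 ltW.
have K0 : 0 <= lam * K.
  by rewrite mulr_ge0// mass_sum_ge0// => x; rewrite !mulr_ge0 ?sqr_ge0.
have fl := flux_lower_bound.
have split_phi x : phi x = 0 \/ f x = 1.
  have [p0|/phi_B/f_B] := leP (phi x) 0; last by right.
  by left; apply/eqP; rewrite eq_le p0 phi_ge0.
have s1 : lam * mass_sum (fun x => f x * (G x - k)) <=
    lam * mass_sum (fun x => (B x)%:R * g x) + 4 * (lam * K).
  have -> : lam * mass_sum (fun x => (B x)%:R * g x) + 4 * (lam * K) =
      lam * mass_sum (fun x => (B x)%:R * g x + 4 * (g x * h x)).
    by rewrite mass_sumD mass_sumZ /K; ring.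
  rewrite ler_wpM2l//; apply: mass_sum_le => x /=.
  have [gk|gk] := leP (g x) k.
    have t0 : 0 <= (B x)%:R * g x by rewrite mulr_ge0.
    by rewrite /G max_r// subrr mulr0 addr_ge0// !mulr_ge0// sqr_ge0.
  have -> : G x = g x by rewrite /G max_l// ltW.
  have HH : g x - k <= g x * H x.
    have gx0 : 0 < g x by exact: lt_trans gk.
    have := @ln_sub_ge R (g x) k k0 (ltW gk).
    rewrite ler_pdivrMr// mulrC -ln_div ?posrE//.
    by rewrite /H /G max_l// ltW.
  have f01 := f_ge0 x; have f11 := f_le1 x.
  have [p2|p2] := leP (phi x) 2^-1; last first.
    have Bx : B x by apply: phi_B; lra.
    rewrite (f_B Bx) Bx/= !mul1r -[X in X <= _]addr0 lerD//; first by have k0' := k0; lra.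
    by rewrite !mulr_ge0 ?sqr_ge0.
  have e1 : f x * (g x - k) <= g x - k by rewrite ger_pMl//; lra.
  have e2 : 1 <= 4 * psi x ^+ 2 by rewrite /psi; nra.
  have e3 : 0 <= (B x)%:R * g x by rewrite mulr_ge0.
  have e4 : g x * H x <= 4 * (g x * h x).
    rewrite /h (_ : 4 * _ = (g x * H x) * (4 * psi x ^+ 2)); last by ring.
    by rewrite ler_peMr// mulr_ge0.
  lra.
have s2 : 2^-1 * edge_sum (fun x y => (f x - f y) * (G x - G y)) <=
    8^-1 + 10 * P + 10 * Q.
  have young x y : (f x - f y) * (G x - G y) <=
     20^-1 * ((g x + g y) * (f x - f y) ^+ 2) +
     20^-1 * k * ((f x - f y) * (f x - f y)) +
     20 * ((G x - G y) ^+ 2 / m x y * Num.min (psi x) (psi y) ^+ 2) +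
     20 * ((2 * m x y * L x y ^+ 2 + m x y * L x y) * (phi x - phi y) ^+ 2).
    have q0 : 0 <= (2 * m x y * L x y ^+ 2 + m x y * L x y) * (phi x - phi y) ^+ 2.
      by rewrite mulr_ge0 ?sqr_ge0.
    have r0 : 0 <= (G x - G y) ^+ 2 / m x y.
      by rewrite mulr_ge0 ?sqr_ge0// invr_ge0 ltW.
    have [fxy|fxy] := eqVneq (f x) (f y).
      rewrite fxy subrr mul0r expr0n !mulr0 !add0r.
      rewrite addr_ge0//; apply: mulr_ge0 => //; apply: mulr_ge0 => //.
      by rewrite sqr_ge0.
    (* the weight 1/20 leaves (4 + 1/8) / 40 <= 1/8 once the energies of f are
       summed, by green_weighted_energy and k * kap = 1/16 *)
    have ym : (f x - f y) * (G x - G y) <=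
       20^-1 * (m x y * (f x - f y) ^+ 2) + 5 * ((G x - G y) ^+ 2 / m x y).
      rewrite -subr_ge0 (_ : _ - _ = (20 * m x y)^-1 *
         (m x y * (f x - f y) - 10 * (G x - G y)) ^+ 2); last first.
        by field; rewrite gt_eqF.
      by apply: mulr_ge0; rewrite ?sqr_ge0// invr_ge0 mulr_ge0// ltW.
    have mle : m x y <= g x + g y + k.
      have := g_ge0 x; have := g_ge0 y; have := k0.
      by rewrite /m /G !ge_max => ? ? ?; do !(apply/andP; split); lra.
    have m1 : m x y * (f x - f y) ^+ 2 <= (g x + g y + k) * (f x - f y) ^+ 2.
      by rewrite ler_wpM2r ?sqr_ge0.
    have tail : (G x - G y) ^+ 2 / m x y <=
      4 * ((G x - G y) ^+ 2 / m x y * Num.min (psi x) (psi y) ^+ 2) +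
      4 * ((2 * m x y * L x y ^+ 2 + m x y * L x y) * (phi x - phi y) ^+ 2).
      have je := @jump_edge R k (G x) (G y) k0 (Gk x) (Gk y).
      rewrite /= -/(m x y) -/(L x y) in je.
      set r := (G x - G y) ^+ 2 / m x y in r0 je *.
      have mLL := mLL0 x y; have mL := mL0 x y.
      have px := phi_le1 x; have py := phi_le1 y; have px' := phi_ge0 x; have py' := phi_ge0 y.
      set M := Num.min (psi x) (psi y).
      have [M2|M2] := leP 2^-1 M.
        have M4 : 4^-1 <= M ^+ 2.
          have M2' : 0 <= (M - 2^-1) * (M + 2^-1) by apply: mulr_ge0; lra.
          move: M2'; rewrite expr2; lra.
        have : r * 4^-1 <= r * M ^+ 2 by rewrite ler_wpM2l.
        lra.
      have jump : 4^-1 <= (phi x - phi y) ^+ 2.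
        move: M2; rewrite /M gt_min /psi.
        case: (split_phi x) => [->|fx]; case: (split_phi y) => [->|fy].
        - by case/orP => ?; exfalso; lra.
        - by case/orP => ?; nra.
        - by case/orP => ?; nra.
        - by move: fxy; rewrite fx fy eqxx.
      have M0 : 0 <= 4 * (r * M ^+ 2).
        by apply: mulr_ge0 => //; apply: mulr_ge0 => //; exact: sqr_ge0.
      have : m x y * L x y <= 4 * ((2 * m x y * L x y ^+ 2 + m x y * L x y) * (phi x - phi y) ^+ 2).
        rewrite [X in _ <= X](_ : _ = (2 * m x y * L x y ^+ 2 + m x y * L x y) * (4 * (phi x - phi y) ^+ 2)); last by ring.
        rewrite -[X in X <= _]mulr1 ler_pM//; lra.
      lra.
    have e : (f x - f y) * (f x - f y) = (f x - f y) ^+ 2 by rewrite expr2.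
    rewrite e; lra.
  have := @edge_sum_le _ _ young; rewrite !edge_sumD !edge_sumZ -/P -/Q.
  have w := green_weighted_energy.
  have e : k * edge_sum (fun x y => (f x - f y) * (f x - f y)) <= 8^-1.
    have : 2^-1 * edge_sum (fun x y => (f x - f y) * (f x - f y)) <= kap.
      rewrite /kap /killed_form lerDl mulr_ge0// mass_sum_ge0// => x.
      by rewrite -expr2 sqr_ge0.
    move=> /(ler_wpM2l (ltW k0)); rewrite kkap; lra.
  lra.
lra.
Qed.

(** When at most half of the mass of g is killed inside B, the alternative leaves
    a fixed lower bound on Q, whose logarithmic weights are turned into powers
    by [log_weight_le]. *)
Lemma scale_estimate :
  lam * mass_sum (fun x => (B x)%:R * g x) <= 2^-1 ->
  (512 * log_const q)^-1 * (16 * kap) `^ (1 - q) <=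
  \sum_(x <- W) g x `^ q * \sum_(y <- W) mu x y * (phi x - phi y) ^+ 2.
Proof.
move=> half; have alt := capacity_alternative.
have Q1 : 256^-1 <= Q by lra.
set T := (X in _ <= X).
have C0 : 0 < log_const q by exact: log_const_gt0.
have QT : Q <= log_const q * k `^ (1 - q) * (2 * T).
  have -> : 2 * T = edge_sum (fun x y => (g x `^ q + g y `^ q) * (phi x - phi y) ^+ 2).
    have -> : 2 * T = T + T by ring.
    have TE : T = edge_sum (fun x y => g x `^ q * (phi x - phi y) ^+ 2).
      rewrite /T /edge_sum; apply: eq_bigr => x _; rewrite mulr_sumr.
      by apply: eq_bigr => y _; rewrite mulrCA.
    rewrite {2}TE -edge_sumC {1}TE -edge_sumD; apply: eq_edge_sum => x y.
    by ring.
  rewrite -edge_sumZ; apply: edge_sum_le => x y.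
  rewrite mulrA ler_wpM2r ?sqr_ge0//.
  have gp z : 0 <= g z `^ q by exact: powR_ge0.
  have kp : 0 <= log_const q * k `^ (1 - q) by rewrite mulr_ge0 ?powR_ge0// ltW.
  have [mk'|mk'] := leP (m x y) k.
    have -> : L x y = 0.
      by rewrite /L (_ : m x y = k) ?divff ?ln1 ?gt_eqF//; apply/eqP; rewrite eq_le mk' mk.
    by rewrite expr0n !mulr0 addr0 mulr_ge0// addr_ge0.
  apply: (le_trans (@log_weight_le R q k (m x y) q_gt1 k0 (mk x y))).
  rewrite ler_wpM2l//.
  have [->|->] : m x y = g x \/ m x y = g y; last 2 first.
  - by rewrite lerDl.
  - by rewrite lerDr.
  move: mk'; rewrite /m /G; have [gx|gx] := leP (g x) k; have [gy|gy] := leP (g y) k.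
  - by rewrite maxxx ltxx.
  - by move=> _; rewrite max_r ?ltW//; right.
  - by move=> _; rewrite max_l ?ltW//; left.
  - by move=> _; rewrite /Num.max; case: ifP; [right|left].
have kE : k `^ (1 - q) * (16 * kap) `^ (1 - q) = 1.
  rewrite -powRM ?ltW// ?mulr_gt0//.
  by rewrite /k mulVf ?powR1// gt_eqF// mulr_gt0.
have kp : 0 < (16 * kap) `^ (1 - q) by rewrite powR_gt0// mulr_gt0.
rewrite ler_pdivrMl; last by apply: mulr_gt0; [rewrite ltr0n|].
have : 256^-1 * (16 * kap) `^ (1 - q) <= log_const q * k `^ (1 - q) * (2 * T) * (16 * kap) `^ (1 - q).
  by apply: ler_wpM2r; [exact: ltW|exact: le_trans Q1 QT].
rewrite (_ : _ * (2 * T) * _ = log_const q * 2 * T * (k `^ (1 - q) * (16 * kap) `^ (1 - q))); last by ring.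
rewrite kE mulr1; lra.
Qed.

End Network.

(** * Finite domains of a weighted graph *)

Section Graph.
Context {R : realType} {V : choiceType} (G : weighted_graph R V).
Variable sigma : V -> R.
Hypothesis sigma_gt0 : forall x, 0 < sigma x.

Lemma mu_ge0 x y : 0 <= mu G x y.
Proof.
by have [/mu_adj_gt0/ltW//|/mu_nadj_eq0 ->] := boolP (adj G x y).
Qed.

Lemma exists_neighbor x : exists y, adj G x y.
Proof.
have [y yx] : exists y, y != x.
  apply: contrapT => H; apply: (vertices_infinite G).
  apply: (@sub_finite_set _ _ [set x]); last exact: finite_set1.
  by move=> y _ /=; apply: contrapT => /eqP yx; apply: H; exists y.
have [//|//|[|z s] [/= ps ls _]] := graph_connected G (x := x) (y := y).
  by move: yx; rewrite -ls eqxx.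
by exists z; case/andP: ps.
Qed.

Lemma muV_gt0 x : 0 < muV G x.
Proof.
have [y xy] := exists_neighbor x.
rewrite /muV fsbig_finite//=; last exact: locally_finite.
have yF : y \in fset_set [set y | adj G x y].
  by rewrite in_fset_set; [exact/mem_set|exact: locally_finite].
rewrite (big_rem y)//= ltr_wpDr ?mu_adj_gt0//.
by apply: sumr_ge0 => z _; exact: mu_ge0.
Qed.

Lemma nu_gt0 x : 0 < nu G sigma x.
Proof. by rewrite mulr_gt0// muV_gt0. Qed.

(** Closed neighbourhood of a finite set, as a list: the support of every edge
    sum involving a function vanishing off D. *)
Definition nbhd (D : set V) : seq V :=
  fset_set (D `|` \bigcup_(x in D) [set y | adj G x y]).

Section FiniteDomain.
Variable D : set V.
Hypothesis finD : finite_set D.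

Lemma finite_nbhd : finite_set (D `|` \bigcup_(x in D) [set y | adj G x y]).
Proof.
by rewrite finite_setU; split=> //; apply: bigcup_finite => // x _; exact: locally_finite.
Qed.

Lemma nbhd_uniq : uniq (nbhd D). Proof. exact: fset_uniq. Qed.

Lemma sub_nbhd x : D x -> x \in nbhd D.
Proof. by move=> Dx; rewrite in_fset_set ?mem_set//; [left|exact: finite_nbhd]. Qed.

Lemma adj_nbhd x y : D x -> adj G x y -> y \in nbhd D.
Proof.
move=> Dx xy; rewrite in_fset_set; last exact: finite_nbhd.
by apply/mem_set; right; exists x.
Qed.

(** Since mu vanishes off the edges, sums over neighbours can all be written over
    one list, which makes them exchangeable. *)
Lemma sum_adj (W : seq V) x (F : V -> R) : uniq W ->
  (forall y, adj G x y -> y \notin W -> F y = 0) ->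
  \sum_(y \in [set y | adj G x y]) (mu G x y * F y) = \sum_(y <- W) mu G x y * F y.
Proof.
move=> uW FW; rewrite [RHS]fsbig_seq//.
transitivity (\sum_(y \in [set: V]) mu G x y * F y).
  apply: fsbig_widen => // y [_ /= /negP nxy].
  by rewrite mu_nadj_eq0 ?mul0r.
apply/esym; apply: fsbig_widen => // y [_ /= /negP yW].
have [xy|nxy] := boolP (adj G x y); first by rewrite FW ?mulr0.
by rewrite mu_nadj_eq0 ?mul0r.
Qed.

Lemma nu_laplacian (W : seq V) x (f : V -> R) : uniq W ->
  (forall y, adj G x y -> y \in W) ->
  nu G sigma x * laplacian G sigma f x = \sum_(y <- W) mu G x y * (f y - f x).
Proof.
move=> uW xW; rewrite /laplacian mulVKf ?gt_eqF ?nu_gt0//.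
by apply: sum_adj => // y /xW ->.
Qed.

Lemma sum_nbhd_domain (F : V -> R) : (forall x, ~ D x -> F x = 0) ->
  \sum_(x <- nbhd D) F x = \sum_(x <- fset_set D) F x.
Proof.
move=> F0; rewrite [LHS]fsbig_seq ?nbhd_uniq// [RHS]fsbig_seq ?fset_uniq//.
apply/esym/fsbig_widen.
  by move=> x /=; rewrite in_fset_set// => /set_mem; exact: sub_nbhd.
by move=> x [_ /=]; rewrite in_fset_set// => /negP; rewrite notin_setE => /F0.
Qed.

End FiniteDomain.
End Graph.

(** * Green's formula and the comparison principle *)

Lemma is_derive_quadratic (R : realType) (F : R -> R) (y d : R) :
  (forall h, `|F (y + h) - F y - d * h| <= h ^+ 2) -> is_derive y 1 F d.
Proof.
move=> H.
have cv : h^-1 *: ((F \o shift y) (h *: (1 : R)) - F y) @[h --> (0 : R)^'] --> d.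
  apply/cvgrPdist_le => e e0; near=> h.
  have h0 : h != 0 by near: h; exact: nbhs_dnbhs_neq.
  have he : `|h| <= e.
    by near: h; apply: dnbhs0_le.
  apply: le_trans he.
  rewrite /shift/= /GRing.scale/= mulr1 (addrC h y).
  have hp : 0 < `|h| by rewrite normr_gt0.
  rewrite -(ler_pM2l hp) -normrM -expr2 real_normK ?num_real//.
  apply: le_trans (H h); rewrite -normrN.
  by rewrite (_ : - (h * _) = F (y + h) - F y - d * h)//; field.
split; first by apply/cvg_ex; exists d; exact: cv.
exact/cvg_lim.
Unshelve. all: by end_near. Qed.

(** The square of the negative part is differentiable at 0 as well, where the
    negative part is not. *)
Lemma is_derive_sqr_neg_part (R : realType) (y : R) :
  is_derive y 1 (fun z => Num.min z 0 ^+ 2) (2 * Num.min y 0).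
Proof.
apply: is_derive_quadratic => h; rewrite ler_norml; apply/andP.
by rewrite /Num.min; case: ifPn => a; case: ifPn => b; rewrite -?leNgt in a b *; split; nra.
Qed.

Lemma is_derive_bigsum (R : realType) (I : eqType) (s : seq I)
    (F : I -> R -> R) (d : I -> R) (t : R) :
  (forall i, i \in s -> is_derive t 1 (F i) (d i)) ->
  is_derive t 1 (fun t => \sum_(i <- s) F i t) (\sum_(i <- s) d i).
Proof.
elim: s => [|i s IH] Fd.
  rewrite big_nil (_ : (fun _ => _) = cst 0); first exact: is_derive_cst.
  by apply/funext => u; rewrite big_nil.
rewrite big_cons (_ : (fun _ => _) = F i + (fun t => \sum_(i <- s) F i t)).
  apply: is_deriveD; first by apply: Fd; rewrite inE eqxx.
  by apply: IH => j js; apply: Fd; rewrite inE js orbT.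
by apply/funext => u; rewrite big_cons.
Qed.

Lemma neg_part_monotone (R : realType) (a b : R) :
  0 <= (Num.min a 0 - Num.min b 0) * (a - b).
Proof.
have [a0|a0] := leP a 0; have [b0|b0] := leP b 0.
- by rewrite -expr2 sqr_ge0.
- by rewrite subr0; nra.
- by rewrite sub0r; nra.
- by rewrite subrr mul0r.
Qed.

Section Domain.
Context {R : realType} {V : choiceType} (G : weighted_graph R V).
Variable sigma : V -> R.
Hypothesis sigma_gt0 : forall x, 0 < sigma x.
Variable D : set V.
Hypothesis finD : finite_set D.
Let W := nbhd G D.

Lemma sum_domain (F : V -> R) : (forall x, ~ D x -> F x = 0) ->
  \sum_(x \in [set: V]) F x = \sum_(x <- W) F x.
Proof.
move=> F0; rewrite [RHS]fsbig_seq ?nbhd_uniq//.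
apply/esym/fsbig_widen => // x [_ /= /negP xW]; apply: F0.
by move/(@sub_nbhd _ _ G _ finD); rewrite (negbTE xW).
Qed.

Lemma energy_edge_sum (f : V -> R) : (forall x, ~ D x -> f x = 0) ->
  energy G f = 2^-1 * edge_sum W (mu G) (fun x y => (f x - f y) * (f x - f y)).
Proof.
move=> f0; congr (_ * _).
have inner x : \sum_(y \in [set y | adj G x y]) (mu G x y * (f x - f y) ^+ 2) =
    \sum_(y <- W) mu G x y * ((f x - f y) * (f x - f y)).
  rewrite (@sum_adj _ _ G W x (fun y => (f x - f y) ^+ 2)); first by apply: eq_bigr => y _; rewrite expr2.
  - exact: nbhd_uniq.
  - move=> y xy yW; rewrite !f0 ?subrr ?expr0n//.
      by move/(@sub_nbhd _ _ G _ finD); rewrite -/W (negbTE yW).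
    by move/(@adj_nbhd _ _ G _ finD) => /(_ _ xy); rewrite -/W (negbTE yW).
transitivity (\sum_(x \in [set: V]) \sum_(y <- W) mu G x y * ((f x - f y) * (f x - f y))).
  by apply: eq_fsbigr => x _; exact: inner.
rewrite /edge_sum [RHS]fsbig_seq ?nbhd_uniq//.
apply/esym/fsbig_widen => // x [_ /= /negP xW].
have Dx : ~ D x by move/(@sub_nbhd _ _ G _ finD); rewrite -/W (negbTE xW).
apply: big1 => y _; have [xy|nxy] := boolP (adj G x y); last first.
  by rewrite mu_nadj_eq0 ?mul0r.
rewrite !f0 ?subrr ?mulr0// => Dy.
rewrite adj_sym in xy.
by have := adj_nbhd finD Dy xy; rewrite -/W (negbTE xW).
Qed.

(** Summation by parts: symmetrize the double sum in its two vertices. *)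
Lemma green_formula (h w : V -> R) : (forall x, ~ D x -> h x = 0) ->
  \sum_(x <- fset_set D) h x * (nu G sigma x * laplacian G sigma w x) =
  - (2^-1 * edge_sum W (mu G) (fun x y => (h x - h y) * (w x - w y))).
Proof.
move=> h0.
have -> : \sum_(x <- fset_set D) h x * (nu G sigma x * laplacian G sigma w x) =
    edge_sum W (mu G) (fun x y => h x * (w y - w x)).
  rewrite -(@sum_nbhd_domain _ _ G _ finD (fun x => h x * _)); last first.
    by move=> x /h0 ->; rewrite mul0r.
  apply: eq_bigr => x _; have [Dx|/h0 hx] := pselect (D x); last first.
    by rewrite hx mul0r big1// => y _; rewrite mul0r mulr0.
  rewrite (@nu_laplacian _ _ G _ sigma_gt0 W) ?nbhd_uniq//; last first.
    by move=> y; exact: adj_nbhd.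
  by rewrite mulr_sumr; apply: eq_bigr => y _; rewrite mulrCA.
have e : edge_sum W (mu G) (fun x y => (h x - h y) * (w x - w y)) =
   - 2 * edge_sum W (mu G) (fun x y => h x * (w y - w x)).
  have e2 : edge_sum W (mu G) (fun x y => (h x - h y) * (w x - w y)) =
     -1 * edge_sum W (mu G) (fun x y => h x * (w y - w x)) +
     -1 * edge_sum W (mu G) (fun x y => h y * (w x - w y)).
    rewrite -!edge_sumZ -edge_sumD; apply: eq_edge_sum => x y; ring.
  rewrite e2 (@edge_sumC _ _ W _ (mu_sym G) (fun x y => h x * (w y - w x))).
  ring.
rewrite e; lra.
Qed.

(** Comparison principle for the heat equation: the negative part of w has
    nonincreasing weighted norm, since it is controlled by the Dirichlet form. *)
Lemma heat_comparison (w : R -> V -> R) :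
  (forall (t : R) x, D x -> is_derive t 1 (fun s : R => w s x) (laplacian G sigma (w t) x)) ->
  (forall (t : R) x, 0 <= t -> ~ D x -> 0 <= w t x) ->
  (forall x, 0 <= w 0 x) ->
  forall (t : R) x, 0 <= t -> 0 <= w t x.
Proof.
move=> wd woff w0 t x t0.
have [Dx|Dx] := pselect (D x); last exact: woff.
pose N s := \sum_(x <- fset_set D) nu G sigma x * Num.min (w s x) 0 ^+ 2.
pose dN s := \sum_(x <- fset_set D)
  nu G sigma x * (2 * Num.min (w s x) 0 * laplacian G sigma (w s) x).
have Nd (s : R) : is_derive s 1 N (dN s).
  apply: is_derive_bigsum => y; rewrite in_fset_set// => /set_mem Dy.
  apply: (@is_deriveZ _ _ _ (fun z => Num.min (w z y) 0 ^+ 2)).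
  rewrite -[X in is_derive _ _ _ X]/(_ * _).
  apply: (@is_derive1_comp _ (fun z => Num.min z 0 ^+ 2) (fun z => w z y)).
    exact: is_derive_sqr_neg_part.
  exact: wd.
have dN0 (s : R) : 0 <= s -> dN s <= 0.
  move=> s0; pose h y := Num.min (w s y) 0.
  have h0 y : ~ D y -> h y = 0 by move=> /(woff _ _ s0) ?; rewrite /h min_r.
  have -> : dN s = 2 * \sum_(y <- fset_set D) h y * (nu G sigma y * laplacian G sigma (w s) y).
    by rewrite mulr_sumr; apply: eq_bigr => y _; rewrite /h; ring.
  rewrite (green_formula _ h0).
  rewrite mulrN oppr_le0 !mulr_ge0// ?invr_ge0//.
  apply: edge_sum_ge0 => [|y z]; first exact: mu_ge0.
  exact: neg_part_monotone.
have Nt : N t <= N 0.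
  apply: (@ler0_derive1_le_cc _ N 0 t); rewrite ?in_itv/= ?lexx ?t0//.
  - by move=> s; rewrite in_itv/= => /andP[/ltW/dN0 ? _]; have [_ Ns] := Nd s; rewrite derive1E Ns.
  - apply: derivable_within_continuous => s _; exact: (@ex_derive _ _ _ _ _ _ _ (Nd s)).
have N0 : N 0 = 0.
  by rewrite /N big1// => y _; rewrite min_r// expr0n mulr0.
have xD : x \in fset_set D by rewrite in_fset_set ?mem_set.
rewrite leNgt; apply/negP => wneg.
suff : 0 < N t by rewrite ltNge; move: Nt; rewrite N0 => ->.
rewrite /N (big_rem x)//= min_l ?ltW// ltr_wpDr//.
  by apply: sumr_ge0 => y _; rewrite mulr_ge0 ?sqr_ge0// ltW// nu_gt0.
by rewrite mulr_gt0 ?nu_gt0// exprn_even_gt0//= lt_eqF.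
Qed.

End Domain.

(** * The Dirichlet heat flow *)

Lemma restrE (R : realType) (V : Type) (f : V -> R) (D : set V) x :
  (f \_ D) x = if x \in D then f x else 0.
Proof. by []. Qed.

Lemma is_derive_sub (R : realType) (f g : R -> R) (t a b : R) :
  is_derive t 1 f a -> is_derive t 1 g b ->
  is_derive t 1 (fun s => f s - g s) (a - b).
Proof. by move=> fa gb; exact: is_deriveB. Qed.

Section HeatFlow.
Context {R : realType} {V : choiceType} (G : weighted_graph R V).
Variable sigma : V -> R.
Hypothesis sigma_gt0 : forall x, 0 < sigma x.
Implicit Types D : set V.

Let L D := dirichlet_laplacian G sigma D.

(** A column of the semigroup; by symmetry it is nu o times the kernel with pole
    o, see [dirichlet_kernelE]. *)
Definition heat D o (t : R) x : R := dirichlet_semigroup G sigma D t \1_[set o] x.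

Lemma iter_dirichlet_off D o n x : D o -> ~ D x ->
  iter n (L D) \1_[set o] x = 0.
Proof.
move=> Do Dx; case: n => [|n].
  by rewrite /= indicE memNset// => /= xo; apply: Dx; rewrite xo.
by rewrite iterS /L /dirichlet_laplacian restrE memNset.
Qed.

Section FixedDomain.
Variables (D : set V) (o : V).
Hypothesis finD : finite_set D.
Hypothesis Do : D o.
Let a n := iter n (L D) \1_[set o].
Let W := nbhd G D.

Let a_off n x : ~ D x -> a n x = 0.
Proof. exact: iter_dirichlet_off. Qed.

Let aS n x : D x -> a n.+1 x = laplacian G sigma (a n) x.
Proof.
move=> Dx; rewrite /a iterS {1}/L /dirichlet_laplacian restrE mem_set//.
congr laplacian; apply/funext => y; rewrite restrE; case: ifPn => //.
by rewrite notin_setE => /a_off; rewrite /a => ->.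
Qed.

Let partial t x n := series (fun k => exp_coeff t k * a k x) n.

Let partial_cvg t x : partial t x @ \oo --> heat D o t x.
Proof.
have [Dx|Dx] := pselect (D x).
  by apply: (@is_cvg_dirichlet_semigroup _ _ G sigma D t) => //; exact: mem_set.
rewrite (_ : partial t x = fun=> 0).
  rewrite (_ : heat D o t x = 0); first exact: cvg_cst.
  rewrite /heat /dirichlet_semigroup (_ : series _ = fun=> 0) ?lim_cst//.
  apply/funext => n; rewrite /series/= big1// => k _.
  by rewrite iter_dirichlet_off ?mulr0.
apply/funext => n; rewrite /partial /series/= big1// => k _.
by rewrite a_off ?mulr0.
Qed.

Lemma heat_off t x : ~ D x -> heat D o t x = 0.
Proof.
move=> Dx; rewrite -(cvg_lim _ (@partial_cvg t x))//.
rewrite (_ : partial t x = fun=> 0) ?lim_cst//.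
apply/funext => n; rewrite /partial /series/= big1// => k _.
by rewrite a_off ?mulr0.
Qed.

Lemma heat0 x : heat D o 0 x = \1_[set o] x.
Proof.
rewrite -(cvg_lim _ (@partial_cvg 0 x))//; apply/cvg_lim => //.
apply: cvg_near_cst; near=> n.
have n0 : (0 < n)%N by near: n; exact: nbhs_infty_gt.
rewrite /partial /series/= -(prednK n0) big_nat_recl//= big1 ?addr0.
  by rewrite /exp_coeff/= expr0 divr1 mul1r.
by move=> k _; rewrite /exp_coeff/= expr0n/= mul0r mul0r.
Unshelve. all: by end_near. Qed.

(** On partial sums the differentiated series is the Laplacian of the series, by
    an exchange of finite sums. *)
Lemma partial_laplacian t x n : D x ->
  series (fun k => exp_coeff t k * a k.+1 x) n =
  (nu G sigma x)^-1 * \sum_(y <- W) mu G x y * (partial t y n - partial t x n).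
Proof.
move=> Dx.
transitivity (\sum_(0 <= k < n) (nu G sigma x)^-1 *
    \sum_(y <- W) mu G x y * (exp_coeff t k * a k y - exp_coeff t k * a k x)).
  apply: eq_bigr => k _; rewrite aS//.
  have nu0 := nu_gt0 G sigma_gt0 x.
  have -> : laplacian G sigma (a k) x =
      (nu G sigma x)^-1 * \sum_(y <- W) mu G x y * (a k y - a k x).
    rewrite -(@nu_laplacian _ _ G _ sigma_gt0 W) ?nbhd_uniq ?mulKf ?gt_eqF//.
    by move=> y; exact: adj_nbhd.
  rewrite mulrCA; congr (_ * _); rewrite mulr_sumr; apply: eq_bigr => y _.
  by rewrite mulrCA -mulrBr.
rewrite /partial /series/= -mulr_sumr exchange_big/=; congr (_ * _); apply: eq_bigr => y _.
by rewrite -mulr_sumr sumrB.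
Qed.

(** Term-by-term differentiation of the exponential series at x. The
    differentiated series converge because they are exponential series started
    from iterates of the Laplacian. *)
Lemma heat_derive t x : D x ->
  is_derive t (1 : R) (fun s : R => heat D o s x) (laplacian G sigma (heat D o t) x).
Proof.
move=> Dx.
pose c n := a n x / n`!%:R.
have cE s : series (fun k => exp_coeff s k * a k x) = pseries c s.
  apply/funext => n; apply: eq_bigr => k _.
  rewrite -[LHS]/(s ^+ k / k`!%:R * a k x) -[RHS]/(a k x / k`!%:R * s ^+ k); ring.
have cv k s : cvgn (series (fun n => exp_coeff s n * iter n (L D) (a k) x)).
  by apply: is_cvg_dirichlet_semigroup => //; exact: mem_set.
have shift k n : iter n (L D) (a k) x = a (n + k)%N x by rewrite /a iterD.
have fS n : n.+1%:R != 0 :> R by rewrite pnatr_eq0.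
have fF n : n`!%:R != 0 :> R by rewrite pnatr_eq0 -lt0n fact_gt0.
have dc n : pseries_diffs c n = a n.+1 x / n`!%:R.
  rewrite /pseries_diffs /c factS natrM; field; rewrite fF/=.
  by have := fS n; rewrite -natr1.
have ddc n : pseries_diffs (pseries_diffs c) n = a n.+2 x / n`!%:R.
  rewrite {1}/pseries_diffs dc factS natrM; field; rewrite fF/=.
  by have := fS n; rewrite -natr1.
have c0 s : cvgn (pseries c s) by rewrite -cE; exact: (cv 0%N).
have dE s : series (fun k => exp_coeff s k * a k.+1 x) = pseries (pseries_diffs c) s.
  apply/funext => n; apply: eq_bigr => k _.
  rewrite -[LHS]/(s ^+ k / k`!%:R * a k.+1 x) -[RHS]/(pseries_diffs c k * s ^+ k) dc; ring.
have c1 s : cvgn (pseries (pseries_diffs c) s).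
  rewrite -dE; have := cv 1%N s; under eq_fun do rewrite shift addn1.
  exact.
have c2 s : cvgn (pseries (pseries_diffs (pseries_diffs c)) s).
  have := cv 2%N s; under eq_fun do rewrite shift addn2.
  rewrite (_ : series _ = pseries (pseries_diffs (pseries_diffs c)) s)//.
  apply/funext => n; apply: eq_bigr => k _.
  rewrite -[LHS]/(s ^+ k / k`!%:R * a k.+2 x) -[RHS]/(pseries_diffs (pseries_diffs c) k * s ^+ k) ddc; ring.
have hE : (fun s => heat D o s x) = fun s => limn (pseries c s).
  by apply/funext => s; rewrite -cE; apply/esym/cvg_lim => //; exact: partial_cvg.
have lapE : laplacian G sigma (heat D o t) x = limn (pseries (pseries_diffs c) t).
  rewrite -dE; apply/esym/cvg_lim => //.
  rewrite (_ : series _ = fun n => (nu G sigma x)^-1 *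
      \sum_(y <- W) mu G x y * (partial t y n - partial t x n)); last first.
    by apply/funext => n; rewrite partial_laplacian.
  have nu0 := nu_gt0 G sigma_gt0 x.
  have -> : laplacian G sigma (heat D o t) x = (nu G sigma x)^-1 *
      \sum_(y <- W) mu G x y * (heat D o t y - heat D o t x).
    rewrite -(@nu_laplacian _ _ G _ sigma_gt0 W) ?nbhd_uniq ?mulKf ?gt_eqF//.
    by move=> y; exact: adj_nbhd.
  apply: cvgMl_tmp; apply: cvg_big => [|y _]; first exact: add_continuous.
  by apply: cvgMl_tmp; apply: cvgB; exact: partial_cvg.
rewrite hE lapE.
apply: (@pseries_snd_diffs _ c (`|t| + 1)) => //.
by rewrite [ltRHS]ger0_norm ?ltrDl// addr_ge0.
Qed.

Lemma heat_ge0 t x : 0 <= t -> 0 <= heat D o t x.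
Proof.
apply: (@heat_comparison _ _ G sigma sigma_gt0 D finD) => [s y Dy|s y s0 Dy|y].
- exact: heat_derive.
- by rewrite heat_off.
- by rewrite heat0 indicE.
Qed.

Lemma laplacian_one_minus (f : V -> R) x :
  laplacian G sigma (fun y => 1 - f y) x = - laplacian G sigma f x.
Proof.
rewrite /laplacian -mulrN; congr (_ * _).
rewrite !fsbig_finite//=; try exact: (locally_finite G x).
by rewrite -sumrN; apply: eq_bigr => y _; ring.
Qed.

Lemma heat_le1 t x : 0 <= t -> heat D o t x <= 1.
Proof.
move=> t0; rewrite -subr_ge0.
apply: (@heat_comparison _ _ G sigma sigma_gt0 D finD (fun t x => 1 - heat D o t x)) => // [s y Dy|s y s0 Dy|y].
- rewrite laplacian_one_minus -[X in is_derive _ _ _ X]sub0r.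
  exact: (is_derive_sub (is_derive_cst (1 : R) s 1) (heat_derive s Dy)).
- by rewrite heat_off// subr0.
- by rewrite heat0 indicE; case: (_ \in _); rewrite /= ?subrr ?subr0.
Qed.

End FixedDomain.

(** On D the difference of the two flows solves the heat equation; off D it is
    the larger flow, which is nonnegative. *)
Lemma heat_mono D D' o t x : finite_set D -> finite_set D' -> D `<=` D' -> D o ->
  0 <= t -> heat D o t x <= heat D' o t x.
Proof.
move=> finD finD' DD' Do t0; rewrite -subr_ge0.
apply: (@heat_comparison _ _ G sigma sigma_gt0 D finD (fun t x => heat D' o t x - heat D o t x)) => // [s y Dy|s y s0 Dy|y].
- rewrite (_ : laplacian _ _ _ _ = laplacian G sigma (heat D' o s) y - laplacian G sigma (heat D o s) y).
    exact: (is_derive_sub (heat_derive finD' (DD' _ Do) s (DD' _ Dy))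
      (heat_derive finD Do s Dy)).
  rewrite /laplacian -mulrBr !fsbig_finite//=; try exact: (locally_finite G y).
  by rewrite -sumrB; congr (_ * _); apply: eq_bigr => z _; ring.
- by rewrite (heat_off finD)// subr0; apply: heat_ge0 => //; exact: DD'.
- by rewrite !heat0 ?subrr//; exact: DD'.
Qed.

Section Kernel.
Variable D : set V.
Hypothesis finD : finite_set D.

Lemma dirichlet_selfadjoint (f h : V -> R) :
  (forall x, ~ D x -> f x = 0) -> (forall x, ~ D x -> h x = 0) ->
  \sum_(x <- fset_set D) h x * (nu G sigma x * L D f x) =
  \sum_(x <- fset_set D) f x * (nu G sigma x * L D h x).
Proof.
move=> f0 h0.
have LE (k : V -> R) : (forall x, ~ D x -> k x = 0) -> forall x, x \in fset_set D ->
    L D k x = laplacian G sigma k x.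
  move=> k0 x; rewrite in_fset_set// => xD; rewrite /L /dirichlet_laplacian restrE xD.
  congr laplacian; apply/funext => y; rewrite restrE; case: ifPn => //.
  by rewrite notin_setE => /k0 ->.
transitivity (\sum_(x <- fset_set D) h x * (nu G sigma x * laplacian G sigma f x)).
  by rewrite big_seq [RHS]big_seq; apply: eq_bigr => x xD; rewrite LE.
rewrite (green_formula G sigma_gt0 finD _ h0).
transitivity (\sum_(x <- fset_set D) f x * (nu G sigma x * laplacian G sigma h x)).
  rewrite (green_formula G sigma_gt0 finD _ f0); congr (- (_ * _)).
  by apply: eq_edge_sum => x y; rewrite mulrC.
by rewrite big_seq [RHS]big_seq; apply: eq_bigr => x xD; rewrite LE.
Qed.

Lemma sum_indic (x : V) (F : V -> R) : D x ->
  \sum_(y <- fset_set D) \1_[set x] y * F y = F x.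
Proof.
move=> Dx; rewrite (big_rem x)/=; last by rewrite in_fset_set ?mem_set.
rewrite indicE mem_set// mul1r big_seq big1 ?addr0// => y.
rewrite (mem_rem_uniq x (fset_uniq _)) inE => /andP[yx _].
by rewrite indicE in_set1 (negbTE yx) mul0r.
Qed.

Lemma iter_dirichlet_sym o x n : D o -> D x ->
  nu G sigma o * iter n (L D) \1_[set x] o = nu G sigma x * iter n (L D) \1_[set o] x.
Proof.
move=> Do Dx.
have gen m f h : (forall x, ~ D x -> f x = 0) -> (forall x, ~ D x -> h x = 0) ->
    \sum_(y <- fset_set D) h y * (nu G sigma y * iter m (L D) f y) =
    \sum_(y <- fset_set D) f y * (nu G sigma y * iter m (L D) h y).
  elim: m f h => [|m IH] f h f0 h0; first by apply: eq_bigr => y _ /=; ring.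
  have Loff (k : V -> R) y : ~ D y -> L D k y = 0.
    by move=> Dy; rewrite /L /dirichlet_laplacian restrE memNset.
  transitivity (\sum_(y <- fset_set D) iter m (L D) h y * (nu G sigma y * L D f y)).
    rewrite iterSr IH//; last by move=> y; exact: Loff.
    by apply: eq_bigr => y _; ring.
  rewrite dirichlet_selfadjoint//.
  by move=> y Dy; case: m {IH} => [|m] /=; [exact: h0|exact: Loff].
have off z y : D z -> ~ D y -> \1_[set z] y = 0 :> R.
  by move=> Dz Dy; exact: (@iter_dirichlet_off D z 0%N y Dz Dy).
have := gen n _ _ (off x ^~ Dx) (off o ^~ Do).
by rewrite !sum_indic.
Qed.

(** The kernel is defined through the flow started at x and evaluated at o; the
    iterates of the self-adjoint Laplacian allow to exchange the two vertices. *)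
Lemma dirichlet_kernelE t o x : D o -> D x ->
  dirichlet_kernel G sigma D t o x = heat D o t x / nu G sigma o.
Proof.
move=> Do Dx; rewrite /dirichlet_kernel !mem_set//=.
have nuo := nu_gt0 G sigma_gt0 o.
have nux := nu_gt0 G sigma_gt0 x.
suff -> : dirichlet_semigroup G sigma D t \1_[set x] o =
    nu G sigma x / nu G sigma o * heat D o t x.
  by field; rewrite !gt_eqF.
apply/cvg_lim => //.
rewrite (_ : series _ = fun n => nu G sigma x / nu G sigma o *
   series (fun k => exp_coeff t k * iter k (L D) \1_[set o] x) n).
  apply: cvgMl_tmp; apply: (@is_cvg_dirichlet_semigroup _ _ G sigma D t) => //.
  exact: mem_set.
apply/funext => n; rewrite /series/= mulr_sumr; apply: eq_bigr => k _.
rewrite mulrCA; congr (_ * _); apply: (@mulfI _ (nu G sigma o)); first by rewrite gt_eqF.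
by rewrite iter_dirichlet_sym//; field; rewrite gt_eqF.
Qed.

End Kernel.
End HeatFlow.

(** * The Laplace transform and the resolvent *)

Section HalfLine.
Context {R : realType}.
Notation mu := (@lebesgue_measure R).

Lemma is_derive_continuous (F f : R -> R) :
  (forall t, is_derive t (1 : R) F (f t)) -> continuous F.
Proof.
move=> dF t; apply: differentiable_continuous; apply/derivable1_diffP.
exact: (@ex_derive _ _ _ _ _ _ _ (dF t)).
Qed.

Lemma continuous_measurable_EFin (f : R -> R) (A : set R) : continuous f ->
  measurable_fun A (fun t => (f t)%:E).
Proof.
move=> cf; apply: measurable_funTS; apply/measurable_EFinP.
exact: continuous_measurable_fun.
Qed.

Lemma integral_derivative_halfline (f F : R -> R) (l : R) :
  (forall t, is_derive t (1 : R) F (f t)) -> continuous f ->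
  (forall t, 0 <= t -> 0 <= f t) -> F t @[t --> +oo] --> l ->
  (\int[mu]_(t in `]0%R, +oo[) (f t)%:E = (l - F 0)%:E)%E.
Proof.
move=> dF cf f0 Fl.
rewrite integral_itv_obnd_cbnd; last first.
  exact: continuous_measurable_EFin.
rewrite EFinB; apply: ge0_continuous_FTC2y => //.
- exact: continuous_subspaceT.
- by apply: cvg_at_right_filter; exact: (is_derive_continuous dF).
- by move=> t _; rewrite derive1E; have [_ ->] := dF t.
Qed.

Variable lam : R.
Hypothesis lam0 : 0 < lam.

Lemma is_derive_expRM t : is_derive t (1 : R) (fun s => expR (- lam * s)) (- lam * expR (- lam * t)).
Proof.
rewrite mulrC; apply: (@is_derive1_comp _ expR (fun s => - lam * s)).
have := @is_deriveZ _ _ _ (@id R) (- lam) t 1 1 (is_derive_id _ _).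
by rewrite -[X in is_derive _ _ _ X]/(_ * _) mulr1.
Qed.

Lemma cvg_expRM : expR (- lam * t) @[t --> +oo] --> (0 : R).
Proof.
rewrite (_ : (fun x => expR (- lam * x)) = (fun z => expR (- z)) \o (fun z => lam * z)).
  apply: (@cvg_comp _ _ _ _ _ _ (pinfty_nbhs R)); last exact: cvgr_expR.
  exact: gt0_cvgMry.
by apply: eq_fun => x; rewrite mulNr.
Qed.

Lemma continuous_expRM : continuous (fun s => expR (- lam * s)).
Proof. exact: (is_derive_continuous is_derive_expRM). Qed.

Lemma integral_expRM : (\int[mu]_(t in `]0%R, +oo[) (expR (- lam * t))%:E = (lam^-1)%:E)%E.
Proof.
rewrite [LHS](@integral_derivative_halfline (fun s => expR (- lam * s))
  (fun s => - lam^-1 * expR (- lam * s)) 0).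
- by rewrite mulr0 expR0 mulr1 sub0r opprK.
- move=> t; have := @is_deriveZ _ _ _ (fun s => expR (- lam * s)) (- lam^-1) t 1 _ (is_derive_expRM t).
  rewrite -[X in is_derive _ _ _ X]/(_ * _) mulrA mulrNN mulVf ?mul1r//.
  by rewrite gt_eqF.
- exact: continuous_expRM.
- by move=> t _; exact: expR_ge0.
- by rewrite -[X in _ --> X](mulr0 (- lam^-1)); apply: cvgMl_tmp; exact: cvg_expRM.
Qed.

Definition laplace (v : R -> R) : \bar R :=
  \int[mu]_(t in `]0, +oo[) (expR (- lam * t) * v t)%:E.

Lemma measurable_laplace (v : R -> R) (A : set R) : continuous v ->
  measurable_fun A (fun t => (expR (- lam * t) * v t)%:E).
Proof.
move=> cv; apply: continuous_measurable_EFin => t.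
by apply: cvgM; [exact: continuous_expRM|exact: cv].
Qed.

Lemma laplace_ge0 (v : R -> R) : (forall t, 0 <= t -> 0 <= v t) -> (0 <= laplace v)%E.
Proof.
move=> v0; apply: integral_ge0 => t /=; rewrite in_itv/= andbT => /ltW t0.
by rewrite lee_fin mulr_ge0 ?expR_ge0 ?v0.
Qed.

Lemma laplace_le (v : R -> R) : continuous v -> (forall t, 0 <= t -> 0 <= v t) ->
  (forall t, 0 <= t -> v t <= 1) -> (laplace v <= (lam^-1)%:E)%E.
Proof.
move=> cv v0 v1; rewrite -integral_expRM; apply: ge0_le_integral => //.
- move=> t /=; rewrite in_itv/= andbT => /ltW t0.
  by rewrite lee_fin mulr_ge0 ?expR_ge0 ?v0.
- exact: measurable_laplace.
- by apply: continuous_measurable_EFin; exact: continuous_expRM.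
- move=> t /=; rewrite in_itv/= andbT => /ltW t0.
  by rewrite lee_fin -[leRHS]mulr1 ler_wpM2l ?expR_ge0 ?v1.
Qed.

Lemma laplace_fin (v : R -> R) : continuous v -> (forall t, 0 <= t -> 0 <= v t) ->
  (forall t, 0 <= t -> v t <= 1) -> laplace v \is a fin_num.
Proof.
move=> cv v0 v1; rewrite ge0_fin_numE ?laplace_ge0//.
by rewrite (le_lt_trans (laplace_le cv v0 v1))// ltry.
Qed.

End HalfLine.

Section Resolvent.
Context {R : realType} {V : choiceType} (G : weighted_graph R V).
Variable sigma : V -> R.
Hypothesis sigma_gt0 : forall x, 0 < sigma x.
Notation leb := (@lebesgue_measure R).

Lemma heat_continuous D o x : finite_set D -> D o ->
  continuous (fun t => heat G sigma D o t x).
Proof.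
move=> finD Do; have [Dx|Dx] := pselect (D x).
  exact: (is_derive_continuous (fun t => heat_derive G sigma_gt0 finD Do t Dx)).
rewrite (_ : (fun t => _) = cst 0); first by move=> t; exact: cvg_cst.
by apply/funext => t; rewrite heat_off.
Qed.

(** The inverse of lam - Laplacian on D, applied to the indicator of o and given
    by the Laplace transform of the flow. *)
Definition resolvent D o lam x : R :=
  fine (laplace lam (fun t => heat G sigma D o t x)).

Section FixedDomain.
Variables (D : set V) (o : V) (lam : R).
Hypothesis finD : finite_set D.
Hypothesis Do : D o.
Hypothesis lam0 : 0 < lam.
Let u t x := heat G sigma D o t x.
Let U x := resolvent D o lam x.
Let W := nbhd G D.
Let nupos := nu_gt0 G sigma_gt0.

Lemma resolventE x : laplace lam (fun t => u t x) = (U x)%:E.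
Proof.
rewrite /U /resolvent fineK// laplace_fin//.
- exact: heat_continuous.
- by move=> t t0; exact: heat_ge0.
- by move=> t t0; exact: heat_le1.
Qed.

Lemma resolvent_ge0 x : 0 <= U x.
Proof.
by rewrite -lee_fin -resolventE; apply: laplace_ge0 => t t0; exact: heat_ge0.
Qed.

Lemma resolvent_off x : ~ D x -> U x = 0.
Proof.
move=> Dx; rewrite /U /resolvent /laplace integral0_eq// => t _.
by rewrite heat_off// mulr0.
Qed.

Lemma resolvent_mono D' x : finite_set D' -> D `<=` D' -> U x <= resolvent D' o lam x.
Proof.
move=> finD' DD'; have D'o := DD' _ Do.
rewrite -lee_fin -[leLHS]resolventE /resolvent fineK; last first.
  apply: laplace_fin => //.
  - exact: heat_continuous.
  - by move=> t t0; exact: heat_ge0.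
  - by move=> t t0; exact: heat_le1.
apply: ge0_le_integral => //.
- move=> t /=; rewrite in_itv/= andbT => /ltW t0.
  by rewrite lee_fin mulr_ge0 ?expR_ge0// heat_ge0.
- by apply: measurable_laplace => //; exact: heat_continuous.
- by apply: measurable_laplace => //; exact: heat_continuous.
- move=> t /=; rewrite in_itv/= andbT => /ltW t0.
  by rewrite lee_fin ler_wpM2l ?expR_ge0// heat_mono.
Qed.

(** The resolvent equation, obtained by integrating the heat equation against
    exp(-lam t); the constant d/lam makes the integrand nonnegative. *)
Lemma resolvent_equation x : D x ->
  lam * U x - laplacian G sigma U x = \1_[set o] x.
Proof.
move=> Dx.
pose c y := (nu G sigma x)^-1 * mu G x y.
have c0 y : 0 <= c y by rewrite mulr_ge0 ?mu_ge0// invr_ge0 ltW.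
pose d := \sum_(y <- W) c y.
have d0 : 0 <= d by apply: sumr_ge0.
have lapE (f : V -> R) : laplacian G sigma f x = \sum_(y <- W) c y * f y - d * f x.
  apply: (@mulfI _ (nu G sigma x)); first by rewrite gt_eqF.
  rewrite (@nu_laplacian _ _ G _ sigma_gt0 W) ?nbhd_uniq//; last first.
    by move=> y; exact: adj_nbhd.
  rewrite /d mulr_suml -sumrB mulr_sumr; apply: eq_bigr => y _.
  by rewrite /c; field; rewrite gt_eqF.
pose e (t : R) : R := expR (- lam * t).
have e0 (t : R) : 0 <= e t by exact: expR_ge0.
have u0 (t : R) y : 0 <= t -> 0 <= u t y by move=> t0; exact: heat_ge0.
have u1 (t : R) y : 0 <= t -> u t y <= 1 by move=> t0; exact: heat_le1.
have cu y : continuous (fun t => u t y) by exact: heat_continuous.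
have ce : continuous e by exact: continuous_expRM.
pose F (t : R) : R := - (e t * (u t x + d / lam)).
pose f (t : R) : R := (lam + d) * (e t * u t x) + d * e t - \sum_(y <- W) c y * (e t * u t y).
have dF (t : R) : is_derive t (1 : R) F (f t).
  have du := heat_derive G sigma_gt0 finD Do t Dx.
  have de := is_derive_expRM lam t.
  have dud : is_derive t (1 : R) (fun s => u s x + d / lam) (laplacian G sigma (u t) x + 0).
    exact: (is_deriveD du (is_derive_cst (d / lam : R) t 1)).
  have := is_deriveN (is_deriveM de dud).
  rewrite [X in is_derive _ _ _ X](_ : _ = f t)//.
  rewrite addr0 /f lapE -/(e t) /GRing.scale/=.
  rewrite (_ : \sum_(y <- W) c y * (e t * u t y) = e t * \sum_(y <- W) c y * u t y); last first.
    by rewrite mulr_sumr; apply: eq_bigr => y _; ring.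
  by field; rewrite gt_eqF.
have cf : continuous f.
  move=> t; apply: cvgB.
    apply: cvgD; first by apply: cvgMl_tmp; apply: cvgM; [exact: ce|exact: cu].
    by apply: cvgMl_tmp; exact: ce.
  apply: cvg_big => [|y _]; first exact: add_continuous.
  by apply: cvgMl_tmp; apply: cvgM; [exact: ce|exact: cu].
have f0 (t : R) : 0 <= t -> 0 <= f t.
  move=> t0; have h1 : \sum_(y <- W) c y * (e t * u t y) <= d * e t.
    rewrite /d mulr_suml; apply: ler_sum => y _; rewrite ler_wpM2l//.
    by rewrite -[leRHS]mulr1 ler_wpM2l// u1.
  have h2 : 0 <= (lam + d) * (e t * u t x).
    by apply: mulr_ge0; [rewrite addr_ge0// ltW|rewrite mulr_ge0// u0].
  by rewrite /f; lra.
have Fl : F t @[t --> +oo] --> (0 : R).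
  rewrite -oppr0; apply: cvgN.
  apply: (@squeeze_cvgr _ _ _ _ (cst 0) (fun t => e t * (1 + d / lam))).
  - near=> t.
    have t0 : 0 <= t by near: t; exact: nbhs_pinfty_ge.
    have K0 : 0 <= d / lam by rewrite divr_ge0// ltW.
    by rewrite mulr_ge0 ?addr_ge0 ?u0//= ler_wpM2l// lerD2r u1.
  - exact: cvg_cst.
  - by rewrite -(mul0r (1 + d / lam)); apply: cvgMr_tmp; exact: cvg_expRM.
have IF := integral_derivative_halfline dF cf f0 Fl.
have mE (y : V) : measurable_fun (`]0%R, +oo[%classic : set R) (fun t => (e t * u t y)%:E).
  exact: measurable_laplace.
have me : measurable_fun (`]0%R, +oo[%classic : set R) (fun t => (e t)%:E).
  exact: continuous_measurable_EFin.
have eu0 y (t : R) : `]0, +oo[%classic t -> (0 <= (e t * u t y)%:E)%E.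
  by rewrite /= in_itv/= andbT => /ltW t0; rewrite lee_fin mulr_ge0 ?u0.
have key : (\int[leb]_(t in `]0%R, +oo[) ((f t)%:E + \sum_(y <- W) (c y)%:E * (e t * u t y)%:E) =
    \int[leb]_(t in `]0%R, +oo[) ((lam + d)%:E * (e t * u t x)%:E + d%:E * (e t)%:E))%E.
  apply: eq_integral => t _.
  under eq_bigr do rewrite -EFinM.
  by rewrite sumEFin -!EFinM -!EFinD /f subrK.
rewrite ge0_integralD// in key; last 4 first.
- by move=> t /=; rewrite in_itv/= andbT => /ltW t0; rewrite lee_fin f0.
- exact: continuous_measurable_EFin.
- by move=> t t0; apply: sume_ge0 => y _; rewrite mule_ge0 ?lee_fin//; exact: (eu0 _ _ t0).
- apply: emeasurable_sum => y. by apply: measurable_funeM; exact: mE.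
rewrite ge0_integralD// in key; last 4 first.
- by move=> t t0; rewrite mule_ge0 ?lee_fin ?addr_ge0 ?(ltW lam0)//; exact: (eu0 _ _ t0).
- by apply: measurable_funeM; exact: mE.
- by move=> t _; rewrite mule_ge0 ?lee_fin.
- by apply: measurable_funeM; exact: me.
rewrite ge0_integral_sum// in key; last 2 first.
- by move=> y; apply: measurable_funeM; exact: mE.
- by move=> y t t0; rewrite mule_ge0 ?lee_fin//; exact: (eu0 _ _ t0).
have key2 : (heat G sigma D o 0 x + d / lam) + \sum_(y <- W) c y * U y =
   (lam + d) * U x + d * lam^-1.
  apply: EFin_inj; rewrite !EFinD -sumEFin.
  move: key; rewrite IF /F sub0r opprK /e mulr0 expR0 mul1r -EFinD => key.
  transitivity ((heat G sigma D o 0 x + d / lam)%:E +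
    \sum_(i <- W) \int[leb]_(x in `]0%R, +oo[) ((c i)%:E * (expR (- lam * x) * u x i)%:E))%E.
    congr (_ + _)%E; apply: eq_bigr => y _.
    rewrite ge0_integralZl//; [by rewrite EFinM -resolventE|exact: mE|
      by move=> t t0; exact: (eu0 _ _ t0)|by rewrite lee_fin].
  rewrite key; congr (_ + _)%E.
    rewrite ge0_integralZl//; [by rewrite EFinM -resolventE|exact: mE|
      by move=> t t0; exact: (eu0 _ _ t0)|by rewrite lee_fin addr_ge0// ltW].
  by rewrite ge0_integralZl// integral_expRM.
rewrite lapE -(@heat0 _ _ G sigma D o finD Do x); lra.
Unshelve. all: by end_near. Qed.

End FixedDomain.
End Resolvent.

(** * Integrals of nonnegative functions *)

Section LowerIntegral.
Import HBNNSimple.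
Context d (T : measurableType d) (R : realType).
Variable mu : {measure set T -> \bar R}.
Local Open Scope ereal_scope.

(** The integral of a nonnegative function is a supremum over the simple
    functions below it, hence monotone on all nonnegative functions. This gives
    access to integrands built from limits and infinite sums. *)
Lemma le_lower_integral (D : set T) (f g : T -> \bar R) :
  (forall x, D x -> 0 <= f x) -> (forall x, D x -> f x <= g x) ->
  \int[mu]_(x in D) f x <= \int[mu]_(x in D) g x.
Proof.
move=> f0 fg; have g0 x : D x -> 0 <= g x by move=> Dx; exact: le_trans (f0 _ Dx) (fg _ Dx).
rewrite !ge0_integralE//; apply: le_ereal_sup => _ [h /= hf <-].
exists h => // x; apply: (le_trans (hf x)).
by rewrite /patch; case: ifPn => // /set_mem; exact: fg.
Qed.

Lemma lower_integral_subset (D E : set T) (f : T -> \bar R) :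
  D `<=` E -> (forall x, E x -> 0 <= f x) ->
  \int[mu]_(x in D) f x <= \int[mu]_(x in E) f x.
Proof.
move=> DE f0; rewrite (integral_mkcond D) (integral_mkcond E).
apply: le_lower_integral => x _; rewrite /patch.
  by case: ifPn => // /set_mem/DE/f0.
case: ifPn => [/set_mem/DE/mem_set -> //|_].
by case: ifPn => // /set_mem/f0.
Qed.

(** Multiply by c the simple functions below f. *)
Lemma lower_integralZl (D : set T) (f : T -> \bar R) (c : R) : (0 <= c)%R ->
  (forall x, D x -> 0 <= f x) ->
  c%:E * \int[mu]_(x in D) f x <= \int[mu]_(x in D) (c%:E * f x).
Proof.
rewrite le_eqVlt => /predU1P[<- f0|c0 f0].
  by rewrite mul0e integral_ge0// => x Dx; rewrite mul0e.
rewrite -lee_pdivlMl// !ge0_integralE//; last first.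
  by move=> x Dx; rewrite mule_ge0 ?f0// lee_fin ltW.
apply: ge_ereal_sup => _ [h /= hf <-].
rewrite lee_pdivlMl//; apply: ereal_sup_ubound.
exists (scale_nnsfun h (ltW c0)) => [x /=|]; last exact: (sintegralrM mu c h).
have := hf x; rewrite /patch; case: ifPn => xD hx.
  by rewrite EFinM lee_pmul2l.
rewrite lee_fin; apply: mulr_ge0_le0; first exact: ltW.
by rewrite lee_fin in hx.
Qed.

End LowerIntegral.

Section TonelliOn.
Context {R : realType}.
Notation mu := (@lebesgue_measure R).
Local Open Scope ereal_scope.

(** Tonelli's theorem on a rectangle, by extending the integrand by zero. *)
Lemma tonelli_on (A B : set R) (f : R -> R -> \bar R) :
  measurable A -> measurable B ->
  measurable_fun (A `*` B) (fun z : R * R => f z.1 z.2) ->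
  (forall x y, A x -> B y -> 0 <= f x y) ->
  \int[mu]_(x in A) \int[mu]_(y in B) f x y =
  \int[mu]_(y in B) \int[mu]_(x in A) f x y.
Proof.
move=> mA mB mf f0.
pose F := (fun z : R * R => f z.1 z.2) \_ (A `*` B).
have mF : measurable_fun setT F.
  exact: (measurable_restrictT _ (measurableX mA mB)).1.
have F0 z : 0 <= F z.
  by rewrite /F /patch; case: ifPn => // /set_mem[/= Az Bz]; exact: f0.
have := @fubini_tonelli _ _ _ _ _ mu mu F mF F0.
have E1 x : \int[mu]_y F (x, y) = ((fun x => \int[mu]_(y in B) f x y) \_ A) x.
  rewrite /patch; case: ifPn => xA.
    rewrite [RHS]integral_mkcond; apply: eq_integral => y _.
    rewrite /F /patch; case: (boolP (y \in B)) => yB.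
      by rewrite mem_set//; split; exact: set_mem.
    by rewrite memNset// => -[_ /= /mem_set]; exact/negP.
  apply: integral0_eq => y _; rewrite /F /patch memNset// => -[/= /mem_set + _].
  exact/negP.
have E2 y : \int[mu]_x F (x, y) = ((fun y => \int[mu]_(x in A) f x y) \_ B) y.
  rewrite /patch; case: ifPn => yB.
    rewrite [RHS]integral_mkcond; apply: eq_integral => x _.
    rewrite /F /patch; case: (boolP (x \in A)) => xA.
      by rewrite mem_set//; split; exact: set_mem.
    by rewrite memNset// => -[/= /mem_set + _]; exact/negP.
  apply: integral0_eq => x _; rewrite /F /patch memNset// => -[_ /= /mem_set].
  exact/negP.
under eq_integral do rewrite E1.
under [in RHS]eq_integral do rewrite E2.
by rewrite -!integral_mkcond.
Qed.

(** Monotone convergence along the half lines starting at 1 / (n + 1). *)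
Lemma integral_halfline_le (f : R -> \bar R) (M : \bar R) :
  measurable_fun (`]0%R, +oo[%classic : set R) f ->
  (forall t, (0 < t)%R -> 0 <= f t) ->
  (forall e, (0 < e)%R -> \int[mu]_(t in `[e, +oo[) f t <= M) ->
  \int[mu]_(t in `]0%R, +oo[) f t <= M.
Proof.
move=> mf f0 H.
pose F n : set R := `[(n.+1%:R^-1)%R, +oo[%classic.
have F0 n t : F n t -> (0 < t)%R.
  by rewrite /F/= in_itv/= andbT; apply: lt_le_trans; rewrite invr_gt0.
have UF : (`]0%R, +oo[%classic : set R) = \bigcup_n F n.
  apply/seteqP; split => [t /=|t [n _ /F0 t0]]; last by rewrite /= in_itv/= t0.
  rewrite in_itv/= andbT => t0; exists (Num.truncn (t^-1)) => //.
  rewrite /F/= in_itv/= andbT -[leRHS]invrK lef_pV2 ?posrE ?invr_gt0//.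
  by apply/ltW; rewrite real_truncnS_gt ?num_real.
rewrite UF.
have cv : \int[mu]_(x in F i) f x @[i --> \oo] --> \int[mu]_(x in \bigcup_i F i) f x.
  apply: ge0_nondecreasing_set_cvg_integral.
  - apply/nondecreasing_seqP => n; apply/subsetPset => t.
    rewrite /F/= !in_itv/= !andbT; apply: le_trans.
    by rewrite lef_pV2 ?posrE// ler_nat.
  - by move=> n; exact: measurable_itv.
  - move=> n; apply: measurable_funS mf => //.
    by move=> t /F0; rewrite /= in_itv/= andbT.
  - by move=> n t /F0; exact: f0.
apply: (cvge_le _ cv); apply: nearW => n.
by apply: H; rewrite invr_gt0.
Qed.

End TonelliOn.

(** * Bounds on the Gamma integral *)

Lemma powR_le_expR (R : realType) (b x : R) : 0 < b -> 0 < x ->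
  x `^ b <= b `^ b * expR x.
Proof.
move=> b0 x0; rewrite /powR !gt_eqF// -expRD ler_expR.
have := @le_ln1Dx R (x / b - 1); rewrite addrCA subrr addr0 ltrBrDl addrN divr_gt0//.
move=> /(_ isT); rewrite ln_div ?posrE// => /(ler_wpM2l (ltW b0)).
rewrite mulrBr mulrBr mulrCA divff ?mulr1 ?gt_eqF//; lra.
Qed.

Section GammaBound.
Context {R : realType}.
Notation mu := (@lebesgue_measure R).

(** Replaces the exponential by a function of x ^ a, which has an explicit
    primitive against the weight x ^ (a - 1). *)
Lemma expRN_le (a x : R) : 0 < a -> 0 < x ->
  expR (- x) <= (2 + 2 * (2 * a) `^ (2 * a)) * (1 + x `^ a) ^- 2.
Proof.
move=> a0 x0; set z := x `^ a; have z0 : 0 <= z by exact: powR_ge0.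
have a20 : 0 < 2 * a by rewrite mulr_gt0.
have z2 : z ^+ 2 <= (2 * a) `^ (2 * a) * expR x.
  have <- : x `^ (2 * a) = z ^+ 2.
    by rewrite (_ : 2 * a = a + a) ?powRD_gt0// ?expr2//; ring.
  exact: powR_le_expR.
have hx : 1 <= expR x by rewrite -expR0 ler_expR ltW.
have d0 : 0 < (1 + z) ^+ 2 by rewrite exprn_gt0// ltr_pwDl.
rewrite expRN ler_pdivlMr// mulrC ler_pdivrMr ?expR_gt0//.
have := sqr_ge0 (z - 1); rewrite !expr2 in z2 *; lra.
Qed.

Section Primitive.
Variables (a T : R).
Hypotheses (a0 : 0 < a) (T0 : 0 < T).
Let h (s : R) : R := 1 + T * s `^ a.
Let F (s : R) : R := - (a * T)^-1 * (h s)^-1.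
Let f (s : R) : R := s `^ (a - 1) * (h s) ^- 2.

Let h1 (s : R) : 1 <= h s.
Proof. by rewrite lerDl mulr_ge0 ?powR_ge0// ltW. Qed.
Let h0 (s : R) : 0 < h s. Proof. exact: lt_le_trans (h1 s). Qed.

Let dh (s : R) : 0 < s -> is_derive s (1 : R) h (T * (a * s `^ (a - 1))).
Proof.
move=> s0.
have d1 : is_derive s (1 : R) (fun s => T * s `^ a) (T * (a * s `^ (a - 1))).
  have dp := is_derive1_powR a s0.
  have := @is_deriveZ _ _ _ (fun s : R => s `^ a) T s 1 _ dp.
  rewrite -[X in is_derive _ _ _ X]/(_ * _).
  exact.
have := is_deriveD (is_derive_cst (1 : R) s 1) d1.
by rewrite add0r.
Qed.

Let dF (s : R) : 0 < s -> is_derive s (1 : R) F (f s).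
Proof.
move=> s0; have hs : h s != 0 by rewrite gt_eqF.
have := @is_deriveZ _ _ _ (fun s => (h s)^-1) (- (a * T)^-1) s 1 _ (is_deriveV hs (dh s0)).
rewrite [X in is_derive _ _ _ X](_ : _ = f s)//.
rewrite /GRing.scale/= /f; field.
by rewrite hs !gt_eqF.
Qed.

Let cont_powR (b s : R) : 0 < s -> {for s, continuous (fun x : R => x `^ b)}.
Proof.
move=> s0; apply: differentiable_continuous; apply/derivable1_diffP.
exact: (@ex_derive _ _ _ _ _ _ _ (is_derive1_powR b s0)).
Qed.

Let cont_h (s : R) : 0 < s -> {for s, continuous h}.
Proof.
move=> s0; apply: differentiable_continuous; apply/derivable1_diffP.
exact: (@ex_derive _ _ _ _ _ _ _ (dh s0)).
Qed.

Let cont_f (s : R) : 0 < s -> {for s, continuous f}.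
Proof.
move=> s0; apply: cvgM; first exact: cont_powR.
apply: cvgV; first by rewrite expf_neq0// gt_eqF.
by rewrite !expr2; apply: cvgM; exact: cont_h.
Qed.

Let cvg_h : h s @[s --> +oo] --> +oo.
Proof.
apply/cvgryPge => M; near=> s.
have s0 : 0 <= s by near: s; exact: nbhs_pinfty_ge.
have sM : (`|M| / T) `^ a^-1 <= s.
  by near: s; apply: nbhs_pinfty_ge; rewrite num_real.
have : (`|M| / T) <= s `^ a.
  have M0 : 0 <= `|M| / T by rewrite divr_ge0// ltW.
  rewrite -[leLHS]powRr1// -(mulVf (lt0r_neq0 a0)) powRrM.
  by apply: ge0_ler_powR; rewrite ?nnegrE ?powR_ge0// ltW.
rewrite ler_pdivrMr// => H; rewrite /h.
by have := ler_norm M; lra.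
Unshelve. all: by end_near. Qed.

Let cvg_F : F s @[s --> +oo] --> (0 : R).
Proof.
rewrite -[X in _ --> X](mulr0 (- (a * T)^-1)); apply: cvgMl_tmp.
by apply/gtr0_cvgV0; [exact: nearW|exact: cvg_h].
Qed.

Lemma integral_powR_rational e : 0 < e ->
  (\int[mu]_(s in `[e, +oo[) (f s)%:E <= ((a * T)^-1)%:E)%E.
Proof.
move=> e0; rewrite (@ge0_continuous_FTC2y _ f F e 0)//.
- rewrite sub0e -EFinN lee_fin /F mulNr opprK ler_piMr//.
    by rewrite invr_ge0 mulr_ge0// ltW.
  by rewrite invf_le1.
- by move=> s es; rewrite /f mulr_ge0 ?powR_ge0// invr_ge0 exprn_ge0// ltW.
- apply: continuous_in_subspaceT => s; rewrite inE/= in_itv/= andbT => es.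
  by apply: cont_f; exact: lt_le_trans es.
- move=> s es; have s0 : 0 < s by exact: lt_trans es.
  exact: (@ex_derive _ _ _ _ _ _ _ (dF s0)).
- apply: cvg_at_right_filter; apply: differentiable_continuous; apply/derivable1_diffP.
  exact: (@ex_derive _ _ _ _ _ _ _ (dF e0)).
- move=> s; rewrite in_itv/= andbT => es; have s0 : 0 < s by exact: lt_trans es.
  by rewrite derive1E; have [_ ->] := dF s0.
Qed.

End Primitive.

(** The exact value is Gamma(a) / t ^ a; dominating the exponential by a rational
    function of (t * s) ^ a gives the same dependence on t. *)
Lemma gamma_bound (a : R) : 0 < a -> exists2 K : R, 0 < K & forall t, 0 < t ->
  (\int[mu]_(s in `]0%R, +oo[) (s `^ (a - 1) * expR (- t * s))%:E
   <= (K * t `^ (- a))%:E)%E.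
Proof.
move=> a0; pose K0 := 2 + 2 * (2 * a) `^ (2 * a).
have K00 : 0 < K0 by rewrite ltr_wpDr// mulr_ge0// powR_ge0.
exists (K0 / a) => [|t t0]; first by rewrite divr_gt0.
have mE (b : R) : measurable_fun setT (fun s : R => s `^ b) by exact: measurable_powR.
have mh : measurable_fun setT (fun s : R => 1 + t `^ a * s `^ a).
  by apply: measurable_funD => //; apply: measurable_funM.
apply: integral_halfline_le.
- apply: measurable_funTS; apply/measurable_EFinP; apply: measurable_funM => //.
  by apply: continuous_measurable_fun; exact: continuous_expRM.
- by move=> s _; rewrite lee_fin mulr_ge0 ?powR_ge0 ?expR_ge0.
move=> e e0.
have T0 : 0 < t `^ a by rewrite powR_gt0.
apply: (@le_trans _ _ (\int[mu]_(s in `[e, +oo[) (K0%:E * (s `^ (a - 1) * (1 + t `^ a * s `^ a) ^- 2)%:E))%E).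
  apply: le_lower_integral => s.
    by rewrite lee_fin mulr_ge0 ?powR_ge0 ?expR_ge0.
  rewrite /= in_itv/= andbT => es; have s0 : 0 < s by exact: lt_le_trans es.
  rewrite -EFinM lee_fin mulrCA ler_wpM2l ?powR_ge0//.
  rewrite mulNr -powRM; [|exact: ltW|exact: ltW].
  by apply: expRN_le => //; exact: mulr_gt0.
rewrite ge0_integralZl//=; last 3 first.
- apply: measurable_funTS; apply/measurable_EFinP; apply: measurable_funM => //.
  rewrite (_ : (fun _ => _) = (fun s : R => (1 + t `^ a * s `^ a) `^ (- 2%:R))).
    exact: (measurableT_comp (measurable_powR (- 2%:R)) mh).
  by apply/funext => s; rewrite powR_invn// addr_ge0// mulr_ge0 ?powR_ge0.
- move=> s _; rewrite lee_fin mulr_ge0 ?powR_ge0// invr_ge0 exprn_ge0//.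
  by rewrite addr_ge0// mulr_ge0 ?powR_ge0.
- by rewrite lee_fin ltW.
rewrite powRN -mulrA -invfM EFinM lee_pmul2l//.
exact: integral_powR_rational.
Qed.

End GammaBound.

(** * The Laplace transform between weighted Lebesgue spaces *)

Section LaplaceLq.
Context {R : realType}.
Notation mu := (@lebesgue_measure R).

Lemma young_powR (q y f : R) : 1 < q -> 0 < y -> 0 <= f ->
  f <= y + y `^ (1 - q) * f `^ q.
Proof.
move=> q1 y0 f0; have p0 : 0 <= y `^ (1 - q) * f `^ q by rewrite mulr_ge0 ?powR_ge0.
have [fy|yf] := leP f y; first by lra.
have fpos : 0 < f by exact: lt_trans yf.
suff : f <= y `^ (1 - q) * f `^ q by lra.
have -> : f `^ q = f * f `^ (q - 1).
  by rewrite mulr_powRB1//; lra.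
rewrite mulrCA ler_pMr//.
rewrite -(opprB q 1) powRN.
rewrite ler_pdivlMl ?powR_gt0// mulr1.
by apply: ge0_ler_powR; rewrite ?nnegrE ?subr_ge0 ltW.
Qed.

(** Young's inequality relative to the weight t ^ (-1/2), which is integrable at
    0 and turns into the weight t ^ ((q - 1) / 2) on the q-th power. *)
Lemma young_sqrt_weight (q y t w e : R) : 1 < q -> 0 < y -> 0 < t -> 0 <= w ->
  0 <= e ->
  e * w <= y * (t `^ (2^-1 - 1) * e) + y `^ (1 - q) * (e * (t `^ ((q - 1) / 2) * w `^ q)).
Proof.
move=> q1 y0 t0 w0 e0; set f := w * t `^ 2^-1.
have f0 : 0 <= f by rewrite mulr_ge0 ?powR_ge0.
have wt : w = f * t `^ (2^-1 - 1).
  rewrite /f -mulrA -powRD_gt0// (_ : _ + _ = 0) ?powRr0 ?mulr1//; lra.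
have fq : f `^ q * t `^ (2^-1 - 1) = t `^ ((q - 1) / 2) * w `^ q.
  rewrite /f powRM ?powR_ge0// -powRrM -mulrA -powRD_gt0// mulrC.
  by congr (_ `^ _ * _); field.
rewrite {1}wt -fq.
have := young_powR q1 y0 f0.
move=> /(ler_wpM2r (powR_ge0 t (2^-1 - 1)))/(ler_wpM2l e0); lra.
Qed.

(** The choice y = I / (2 * A) makes the first term half of I. *)
Lemma balance_powR (q I A B : R) : 1 < q -> 0 <= I -> 0 < A -> 0 <= B ->
  (forall y, 0 < y -> I <= y * A + y `^ (1 - q) * B) ->
  I `^ q <= 2 `^ q * A `^ (q - 1) * B.
Proof.
move=> q1 I0 A0 B0 H.
have rhs0 : 0 <= 2 `^ q * A `^ (q - 1) * B by rewrite !mulr_ge0 ?powR_ge0.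
have [I_0|Ipos] : I = 0 \/ 0 < I.
  by move: I0; rewrite le_eqVlt => /predU1P[<-|]; [left|right].
  by rewrite I_0 powR0// gt_eqF// (lt_trans _ q1).
have y0 : 0 < I / (2 * A) by rewrite divr_gt0// mulr_gt0.
have := H _ y0.
have -> : I / (2 * A) * A = I / 2 by field; rewrite gt_eqF.
move=> H1; have H2 : I / 2 <= (I / (2 * A)) `^ (1 - q) * B by lra.
have e : (I / (2 * A)) `^ (1 - q) * I `^ (q - 1) = (2 * A) `^ (q - 1).
  rewrite -(opprB q 1) powRN.
  have -> : I `^ (q - 1) = (I / (2 * A)) `^ (q - 1) * (2 * A) `^ (q - 1).
    rewrite -powRM; [|exact: ltW|by rewrite ltW// mulr_gt0].
    by rewrite divfK// gt_eqF// mulr_gt0.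
  by rewrite mulKf// gt_eqF// powR_gt0.
have := ler_wpM2r (powR_ge0 I (q - 1)) H2.
rewrite (_ : _ * B * _ = (I / (2 * A)) `^ (1 - q) * I `^ (q - 1) * B); last by ring.
rewrite e; have -> : (2 * A) `^ (q - 1) = 2 `^ (q - 1) * A `^ (q - 1) by rewrite powRM// ltW.
rewrite (_ : I / 2 * I `^ (q - 1) = I `^ q / 2); last first.
  by rewrite -[in RHS](@mulr_powRB1 _ I q)//; [ring|lra].
rewrite -(@mulr_powRB1 _ 2 q)//; last lra.
by lra.
Qed.

(** Boundedness of the Laplace transform from L^q(dt) to
    L^q(lam^(q-2) dlam): pointwise by Young's inequality with the weight
    t^(-1/2), then by Tonelli. *)
Lemma laplace_Lq (q : R) : 1 < q -> exists2 C : R, 0 < C &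
  forall v : R -> R, continuous v -> (forall t, 0 <= t -> 0 <= v t) ->
  (forall t, 0 <= t -> v t <= 1) ->
  (\int[mu]_(lam in `]0%R, +oo[) (lam `^ (q - 2) * fine (laplace lam v) `^ q)%:E
   <= C%:E * \int[mu]_(t in `]0%R, +oo[) (v t `^ q)%:E)%E.
Proof.
move=> q1; pose a := (q - 1) / 2; have a0 : 0 < a by rewrite divr_gt0// subr_gt0.
have [K1 K10 HK1] := @gamma_bound R (2^-1) ltac:(by rewrite invr_gt0).
have [Ka Ka0 HKa] := @gamma_bound R a a0.
pose c := 2 `^ q * K1 `^ (q - 1).
have c0 : 0 < c by rewrite mulr_gt0// powR_gt0.
exists (c * Ka) => [|v cv v0 v1]; first by rewrite mulr_gt0.
pose k (lam t : R) : R := expR (- lam * t) * (t `^ a * v t `^ q).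
pose B lam := (\int[mu]_(t in `]0%R, +oo[) (k lam t)%:E)%E.
have mv : measurable_fun setT v by exact: continuous_measurable_fun.
have mvp : measurable_fun setT (fun t : R => v t `^ q).
  exact: (measurableT_comp (measurable_powR q) mv).
have mvq : measurable_fun setT (fun t : R => t `^ a * v t `^ q).
  by apply: measurable_funM => //; exact: measurable_powR.
have me lam : measurable_fun setT (fun t : R => expR (- lam * t)).
  by apply: continuous_measurable_fun; exact: continuous_expRM.
have mw lam : measurable_fun (`]0%R, +oo[%classic : set R)
    (fun t : R => (t `^ (2^-1 - 1) * expR (- lam * t))%:E).
  apply: measurable_funTS; apply/measurable_EFinP.
  by apply: measurable_funM => //; exact: measurable_powR.
have k0 lam t : 0 <= k lam t by rewrite !mulr_ge0 ?expR_ge0 ?powR_ge0.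
have B0 lam : (0 <= B lam)%E by apply: integral_ge0 => t _; rewrite lee_fin.
have mk lam : measurable_fun (`]0%R, +oo[%classic : set R) (fun t : R => (k lam t)%:E).
  by apply: measurable_funTS; apply/measurable_EFinP; exact: measurable_funM.
have step1 lam : 0 < lam ->
    ((lam `^ (q - 2) * fine (laplace lam v) `^ q)%:E <=
     c%:E * ((lam `^ (a - 1))%:E * B lam))%E.
  move=> lam0; pose A := K1 * lam `^ (- 2^-1).
  have A0 : 0 < A by rewrite mulr_gt0// powR_gt0.
  set I := fine (laplace lam v).
  have IE : laplace lam v = I%:E by rewrite /I fineK// laplace_fin.
  have I0 : 0 <= I by rewrite -lee_fin -IE laplace_ge0.
  have bound y : 0 < y -> (I%:E <= (y * A)%:E + (y `^ (1 - q))%:E * B lam)%E.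
    move=> y0; rewrite -IE.
    apply: (@le_trans _ _ (\int[mu]_(t in `]0%R, +oo[)
      (y%:E * (t `^ (2^-1 - 1) * expR (- lam * t))%:E + (y `^ (1 - q))%:E * (k lam t)%:E))%E).
      apply: le_lower_integral => t; rewrite /= in_itv/= andbT => t0.
        by rewrite lee_fin mulr_ge0 ?expR_ge0 ?v0// ltW.
      rewrite -!EFinM -EFinD lee_fin /k.
      by apply: young_sqrt_weight => //; apply: v0; exact: ltW.
    rewrite ge0_integralD//=; last 4 first.
    - by move=> t _; rewrite mule_ge0// lee_fin ?mulr_ge0 ?powR_ge0 ?expR_ge0// ltW.
    - by apply: measurable_funeM; exact: mw.
    - by move=> t _; rewrite mule_ge0// lee_fin ?powR_ge0.
    - by apply: measurable_funeM; exact: mk.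
    apply: leeD.
      rewrite ge0_integralZl//=; last 3 first.
      - exact: mw.
      - by move=> t _; rewrite lee_fin mulr_ge0 ?powR_ge0 ?expR_ge0.
      - by rewrite lee_fin ltW.
      by rewrite EFinM lee_pmul2l//; exact: HK1.
    rewrite ge0_integralZl//=; first exact: mk.
      by move=> t _; rewrite lee_fin.
    by rewrite lee_fin powR_ge0.
  have [Bfin|Binf] := boolP (B lam \is a fin_num); last first.
    have -> : B lam = +oo%E.
      by move: Binf (B0 lam); case: (B lam) => // r; rewrite fin_numE.
    by rewrite !gt0_muley ?leey ?lte_fin ?powR_gt0.
  have bE := fineK Bfin; set b := fine (B lam) in bE.
  have b0 : 0 <= b by rewrite -lee_fin bE.
  have := balance_powR q1 I0 A0 b0.
  rewrite -bE -!EFinM lee_fin => H.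
  have {}H : I `^ q <= 2 `^ q * A `^ (q - 1) * b.
    apply: H => y y0; rewrite -lee_fin EFinD EFinM.
    by have := bound y y0; rewrite -bE EFinM.
  apply: (le_trans (ler_wpM2l (powR_ge0 lam (q - 2)) H)).
  rewrite /A powRM; [|exact: ltW|exact: powR_ge0].
  rewrite -powRrM.
  have -> : lam `^ (a - 1) = lam `^ (q - 2) * lam `^ (- 2^-1 * (q - 1)).
    by rewrite -powRD_gt0//; congr (_ `^ _); rewrite /a; field.
  by rewrite /c; lra.
pose K (lam t : R) := (lam `^ (a - 1) * k lam t)%:E.
have mK : measurable_fun ((`]0%R, +oo[%classic : set R) `*` (`]0%R, +oo[%classic : set R))
    (fun z : R * R => K z.1 z.2).
  apply: measurable_funTS; apply/measurable_EFinP.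
  have m1 : measurable_fun setT (fst : R * R -> R) by exact: measurable_fst.
  have m2 : measurable_fun setT (snd : R * R -> R) by exact: measurable_snd.
  apply: measurable_funM; first exact: (measurableT_comp (measurable_powR (a - 1)) m1).
  apply: measurable_funM; last exact: (measurableT_comp mvq m2).
  apply: (measurableT_comp (@measurable_expR R)).
  by apply: measurable_funM => //; exact: measurableT_comp.
have K0 lam t : (0 <= K lam t)%E by rewrite lee_fin mulr_ge0 ?powR_ge0.
apply: (@le_trans _ _ (\int[mu]_(lam in `]0%R, +oo[)
    \int[mu]_(t in `]0%R, +oo[) (c%:E * K lam t))%E).
  apply: le_lower_integral => lam.
    by rewrite lee_fin mulr_ge0 ?powR_ge0.
  rewrite /= in_itv/= andbT => lam0; apply: (le_trans (step1 _ lam0)).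
  apply: (@le_trans _ _ (c%:E * \int[mu]_(t in `]0%R, +oo[) K lam t)%E).
    rewrite lee_pmul2l//; apply: lower_integralZl; first exact: powR_ge0.
    by move=> t _; rewrite lee_fin.
  by apply: lower_integralZl => //; exact: ltW.
apply: (@le_trans _ _ (\int[mu]_(t in `]0%R, +oo[)
    \int[mu]_(lam in `]0%R, +oo[) (c%:E * K lam t))%E).
  rewrite [leLHS]tonelli_on; [exact: lexx|exact: measurable_itv|exact: measurable_itv| |].
    exact: measurable_funeM.
  by move=> x y _ _; apply: mule_ge0; [rewrite lee_fin ltW|exact: K0].
apply: (@le_trans _ _ (\int[mu]_(t in `]0%R, +oo[) ((c * Ka)%:E * (v t `^ q)%:E))%E); last first.
  rewrite ge0_integralZl//=.
  - apply: measurable_funTS; apply/measurable_EFinP.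
    exact: mvp.
  - by move=> t _; rewrite lee_fin powR_ge0.
  - by rewrite lee_fin mulr_ge0// ltW.
apply: le_lower_integral => t.
  by move=> _; apply: integral_ge0 => lam _; rewrite mule_ge0// lee_fin ltW.
rewrite /= in_itv/= andbT => t0.
have ce : measurable_fun (`]0%R, +oo[%classic : set R)
    (fun lam : R => (lam `^ (a - 1) * expR (- t * lam))%:E).
  apply: measurable_funTS; apply/measurable_EFinP.
  by apply: measurable_funM => //; exact: measurable_powR.
have -> : (\int[mu]_(lam in `]0%R, +oo[) (c%:E * K lam t) =
    (c * (t `^ a * v t `^ q))%:E *
    \int[mu]_(lam in `]0%R, +oo[) (lam `^ (a - 1) * expR (- t * lam))%:E)%E.
  rewrite -ge0_integralZl//=; last 2 first.
  - by move=> lam _; rewrite lee_fin mulr_ge0 ?powR_ge0 ?expR_ge0.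
  - by rewrite lee_fin !mulr_ge0 ?powR_ge0// ltW.
  apply: eq_integral => lam _; rewrite -!EFinM; congr EFin; rewrite /k.
  by rewrite (_ : - lam * t = - t * lam); ring.
have [->|vt] := eqVneq (v t) 0.
  by rewrite powR0 ?mulr0 ?mul0e ?mule0//; lra.
apply: (@le_trans _ _ ((c * (t `^ a * v t `^ q))%:E * (Ka * t `^ (- a))%:E)%E).
  rewrite lee_wpmul2l ?HKa// lee_fin !mulr_ge0 ?powR_ge0// ltW.
rewrite -!EFinM lee_fin.
rewrite (_ : _ * (Ka * _) = (t `^ a * t `^ (- a)) * (c * Ka * v t `^ q)); last by ring.
by rewrite -powRD_gt0// subrr powRr0 mul1r.
Qed.

End LaplaceLq.

(** * The path metric and radial cutoffs *)

Section Distance.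
Context {R : realType} {V : choiceType} (G : weighted_graph R V).
Variable rho : V -> V -> R.
Hypothesis rho_edge : edge_length G rho.
Variable o : V.
Let d x := path_dist G rho o x.

Lemma path_length_ge0 x s : path (adj G) x s -> 0 <= path_length rho x s.
Proof.
rewrite /path_length; elim: s x => [|y s IH] x; first by rewrite /= big_nil.
move=> /= /andP[xy ys]; rewrite big_cons addr_ge0 ?IH//.
by apply/ltW; case: rho_edge => H _; exact: H.
Qed.

Lemma path_length_rcons x s y :
  path_length rho x (rcons s y) = path_length rho x s + rho (last x s) y.
Proof.
rewrite /path_length; elim: s x => [|z s IH] x /=.
  by rewrite !big_cons !big_nil addr0 add0r.
by rewrite !big_cons IH addrA.
Qed.

Let paths x := [set path_length rho o s | s in
  [set s : seq V | path (adj G) o s /\ last o s = x]].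

Let paths_lb x : has_lbound (paths x).
Proof. by exists 0 => _ [s [ps _] <-]; exact: path_length_ge0. Qed.

Let paths_n0 x : paths x !=set0.
Proof.
have [//|//|s [ps ls _]] := graph_connected G (x := o) (y := x).
by exists (path_length rho o s), s.
Qed.

Lemma path_dist_ge0 x : 0 <= d x.
Proof.
by apply: lb_le_inf => [|_ [s [ps _] <-]]; [exact: paths_n0|exact: path_length_ge0].
Qed.

Lemma path_dist0 : d o = 0.
Proof.
apply/eqP; rewrite eq_le path_dist_ge0 andbT.
apply: (ge_inf (paths_lb o)); exists [::] => //.
by rewrite /path_length/= big_nil.
Qed.

Lemma path_dist_adj x y : adj G x y -> d y <= d x + rho x y.
Proof.
move=> xy; rewrite -lerBlDr; apply: lb_le_inf => [|_ [s [ps ls] <-]].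
  exact: paths_n0.
rewrite lerBlDr; apply: (ge_inf (paths_lb y)); exists (rcons s y).
  by rewrite /= rcons_path ps ls last_rcons.
by rewrite path_length_rcons ls.
Qed.

Lemma path_dist_lip x y : adj G x y -> (d x - d y) ^+ 2 <= rho x y ^+ 2.
Proof.
move=> xy; have := path_dist_adj xy.
have yx : adj G y x by rewrite adj_sym.
have := path_dist_adj yx; case: rho_edge => r0 rs; rewrite -(rs _ _ xy).
have := r0 _ _ xy; move: (d x) (d y) (rho x y) => a b c c0 h1 h2.
rewrite -ler_sqrt ?sqr_ge0// !sqrtr_sqr (gtr0_norm c0) ler_norml.
by apply/andP; split; lra.
Qed.

Lemma rho_ball_mono r s : r <= s -> rho_ball G rho o r `<=` rho_ball G rho o s.
Proof. by move=> rs x; rewrite /rho_ball/= => /le_trans; apply. Qed.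

Lemma rho_ball_center r : 0 <= r -> rho_ball G rho o r o.
Proof. by move=> r0; rewrite /rho_ball/= -/(d o) path_dist0. Qed.

(** Affine in the distance between the ball of radius r/2, where it is 1, and the
    complement of the ball of radius r, where it is 0. *)
Definition cutoff r x : R := Num.max 0 (Num.min 1 (2 - 2 * d x / r)).

Lemma cutoff_ge0 r x : 0 <= cutoff r x. Proof. by rewrite /cutoff le_max lexx. Qed.

Lemma cutoff_le1 r x : cutoff r x <= 1.
Proof. by rewrite /cutoff ge_max ler01 ge_min lexx. Qed.

Lemma cutoff_center r : cutoff r o = 1.
Proof.
rewrite /cutoff path_dist0 mulr0 mul0r subr0 min_l; last by rewrite ler1n.
by rewrite max_r.
Qed.

Lemma cutoff_gt0 r x : 0 < r -> 0 < cutoff r x -> rho_ball G rho o r x.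
Proof.
move=> r0; rewrite /cutoff lt_max ltxx/= lt_min ltr01/= subr_gt0.
rewrite ltr_pdivrMr// ltr_pM2l// => dr; exact: ltW.
Qed.

(** The cutoffs at dyadic radii slope on disjoint annuli, so that their
    rescaled gradients add up to at most the gradient of the distance. *)
Lemma sum_cutoff_le (L : R) (N : nat) x y : 0 < L ->
  \sum_(i < N) (L / 2 ^+ i.+1) ^+ 2 *
    (cutoff (L / 2 ^+ i.+1) x - cutoff (L / 2 ^+ i.+1) y) ^+ 2 <=
  4 * (d x - d y) ^+ 2.
Proof.
move=> L0.
pose c (n : nat) (t : R) := Num.min t (L / 2 ^+ n).
have step (i : nat) z : (L / 2 ^+ i.+1) * cutoff (L / 2 ^+ i.+1) z =
    2 * (L / 2 ^+ i.+1) - 2 * (c i.+1 (d z) - c i.+2 (d z)) - L / 2 ^+ i.+1.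
  set r := L / 2 ^+ i.+1; have r0 : 0 < r by rewrite divr_gt0// exprn_gt0.
  have r2 : L / 2 ^+ i.+2 = r / 2 by rewrite /r [2 ^+ i.+2]exprSr invfM mulrA.
  have dr : 2 * d z / r * r = 2 * d z by rewrite divfK// gt_eqF.
  rewrite /cutoff /c r2 -/r.
  have [h1|h1] := leP (d z) (r / 2).
    rewrite min_l; last first.
      by rewrite lerBrDr -lerBrDl ler_pdivrMr//; lra.
    rewrite max_r// min_l ?mulr1; [|lra].
    lra.
  have [h2|h2] := leP (d z) r.
    rewrite min_r; last first.
      by rewrite lerBlDr -lerBlDl ler_pdivlMr//; lra.
    rewrite max_r; last by rewrite subr_ge0 ler_pdivrMr//; lra.
    by rewrite mulrBr (mulrC r (2 * d z / r)) dr; lra.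
  rewrite min_r; last first.
    by rewrite lerBlDr -lerBlDl ler_pdivlMr//; lra.
  rewrite max_l; last by rewrite subr_le0 ler_pdivlMr//; lra.
  lra.
have halve n : 0 < L / 2 ^+ n.+1 /\ L / 2 ^+ n.+1 <= L / 2 ^+ n.
  have p0 : 0 < L / 2 ^+ n by rewrite divr_gt0// exprn_gt0.
  have -> : L / 2 ^+ n.+1 = (L / 2 ^+ n) / 2 by rewrite exprSr invfM mulrA.
  by split; lra.
have mono (n : nat) s t : s <= t -> c n.+1 s <= c n.+1 t.
  by move=> st; rewrite /c le_min !ge_min st lexx orbT.
have slope n s t : s <= t -> c n.+1 s - c n.+2 s <= c n.+1 t - c n.+2 t.
  move=> st; have [_] := halve n.+1; rewrite /c.
  move: (L / 2 ^+ n.+1) (L / 2 ^+ n.+2) => a b ba.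
  by have [?|?] := leP s a; have [?|?] := leP s b;
     have [?|?] := leP t a; have [?|?] := leP t b; lra.
have contr s t : s <= t -> c 1%N t - c 1%N s <= t - s.
  by move=> st; rewrite /c; have [?|?] := leP s (L / 2 ^+ 1);
     have [?|?] := leP t (L / 2 ^+ 1); lra.
wlog yx : x y / d y <= d x => [H|].
  have [/H//|/ltW/H] := leP (d y) (d x).
  rewrite -(opprB (d y)) sqrrN; apply: le_trans; apply: ler_sum => i _.
  by rewrite -(opprB (cutoff _ y)) sqrrN.
have main : \sum_(i < N) (L / 2 ^+ i.+1) ^+ 2 *
    (cutoff (L / 2 ^+ i.+1) x - cutoff (L / 2 ^+ i.+1) y) ^+ 2 <=
    4 * (c 1%N (d x) - c N.+1 (d x) - (c 1%N (d y) - c N.+1 (d y))) ^+ 2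
    /\ c 1%N (d y) - c N.+1 (d y) <= c 1%N (d x) - c N.+1 (d x).
  elim: N => [|N [IH1 IH2]].
    by rewrite big_ord0 !subrr mulr_ge0 ?sqr_ge0.
  have sN := slope N _ _ yx; split; last by lra.
  rewrite big_ord_recr/= -exprMn mulrBr !step.
  apply: (le_trans (lerD IH1 (lexx _))).
  move: IH2 sN; rewrite !expr2.
  move: (c 1%N (d x)) (c 1%N (d y)) (c N.+1 (d x)) (c N.+1 (d y)) (c N.+2 (d x)) (c N.+2 (d y)).
  move=> a1 b1 a2 b2 a3 b3 h1 h2.
  have := mulr_ge0 (_ : 0 <= a1 - a2 - (b1 - b2)) (_ : 0 <= a2 - a3 - (b2 - b3)).
  rewrite !subr_ge0 => /(_ h1 h2); lra.
case: main => main1 main2; apply: (le_trans main1); rewrite ler_pM2l// ler_pXn2r ?nnegrE ?subr_ge0//.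
have := contr _ _ yx; have := mono N _ _ yx; lra.
Qed.

End Distance.

(** * Nearly minimal competitors *)

Definition truncate01 (R : realType) (t : R) : R := Num.min (Num.max t 0) 1.

Lemma truncate01_ge0 (R : realType) (t : R) : 0 <= truncate01 t.
Proof. by rewrite le_min le_max lexx orbT ler01. Qed.

Lemma truncate01_le1 (R : realType) (t : R) : truncate01 t <= 1.
Proof. by rewrite ge_min lexx orbT. Qed.

Lemma truncate01_1 (R : realType) (t : R) : 1 <= t -> truncate01 t = 1.
Proof. by move=> t1; rewrite /truncate01 max_l ?min_r//; lra. Qed.

Lemma truncate01_0 (R : realType) : truncate01 (0 : R) = 0.
Proof. by rewrite /truncate01 maxxx min_l. Qed.

Lemma truncate01_lip (R : realType) (s t : R) :
  (truncate01 s - truncate01 t) * (truncate01 s - truncate01 t) <=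
  (s - t) * (s - t).
Proof.
wlog st : s t / s <= t => [H|].
  have [/H//|/ltW/H] := leP s t.
  by rewrite -[leLHS]mulrNN -[leRHS]mulrNN !opprB.
have h : 0 <= truncate01 t - truncate01 s <= t - s.
  rewrite /truncate01; apply/andP.
  by have [?|?] := leP s 0; have [?|?] := leP t 0; split;
    repeat match goal with |- context [Num.min ?a ?b] => have [?|?] := leP a b end; lra.
case/andP: h => h0 h1.
by rewrite -[leLHS]mulrNN -[leRHS]mulrNN !opprB ler_pM.
Qed.

Section NearMinimizer.
Context {R : realType} {V : choiceType}.
Variables (W : seq V) (mu : V -> V -> R) (nu : V -> R) (lam : R).
Hypothesis mu_ge0 : forall x y, 0 <= mu x y.
Hypothesis mu_sym : forall x y, mu x y = mu y x.
Hypothesis nu_ge0 : forall x, 0 <= nu x.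
Hypothesis lam_ge0 : 0 <= lam.
Local Notation form := (killed_form W mu nu lam).

Lemma killed_form_truncate f :
  form (fun x => truncate01 (f x)) (fun x => truncate01 (f x)) <= form f f.
Proof.
rewrite lerD// ler_wpM2l ?invr_ge0//.
  by apply: edge_sum_le => // x y; exact: truncate01_lip.
apply: mass_sum_le => // x.
by have := truncate01_lip (f x) 0; rewrite truncate01_0 !subr0.
Qed.

Variables (D B : pred V) (g h : V -> R).
Hypothesis g_ge0 : forall x, 0 <= g x.
Hypothesis g_off : forall x, ~~ D x -> g x = 0.
Hypothesis h_off : forall x, ~~ D x -> h x = 0.
Hypothesis h_B : forall x, B x -> 1 <= h x.

(** A competitor close enough to minimal is almost orthogonal to every
    admissible variation. Here the variation g * (1 - f) keeps the constraints,
    and its size enters only through a bound K on the forms of the functions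
    below g. *)
Lemma near_minimizer : exists f : V -> R,
  [/\ (forall x, 0 <= f x <= 1), (forall x, ~~ D x -> f x = 0),
      (forall x, B x -> f x = 1), form f f <= form h h &
      - 2^-1 <= form f (fun x => g x * (1 - f x))].
Proof.
pose S := [set form f f | f in [set f : V -> R |
  (forall x, ~~ D x -> f x = 0) /\ (forall x, B x -> f x = 1)]].
have truncS f : (forall x, ~~ D x -> f x = 0) -> (forall x, ~~ D x -> truncate01 (f x) = 0).
  by move=> f0 x /f0 ->; exact: truncate01_0.
have S0 : has_inf S.
  split; last by exists 0 => _ [f _ <-]; exact: killed_form_ge0.
  exists (form (fun x => truncate01 (h x)) (fun x => truncate01 (h x))).
  exists (fun x => truncate01 (h x)) => //; split; first exact: truncS.
  by move=> x /h_B; exact: truncate01_1.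
pose K := 2^-1 * edge_sum W mu (fun x y => g x ^+ 2 + g y ^+ 2) +
          lam * mass_sum W nu (fun x => g x ^+ 2).
have K0 : 0 <= K.
  rewrite addr_ge0// mulr_ge0// ?invr_ge0//.
    by apply: edge_sum_ge0 => // x y; rewrite addr_ge0 ?sqr_ge0.
  by apply: mass_sum_ge0 => // x; exact: sqr_ge0.
have bound z : (forall x, 0 <= z x <= g x) -> form z z <= K.
  move=> zg; rewrite lerD// ler_wpM2l ?invr_ge0//.
    apply: edge_sum_le => // x y.
    have /andP[x0 x1] := zg x; have /andP[y0 y1] := zg y.
    have hx : z x * z x <= g x * g x by rewrite ler_pM.
    have hy : z y * z y <= g y * g y by rewrite ler_pM.
    have hxy := mulr_ge0 x0 y0; rewrite !expr2; lra.
  apply: mass_sum_le => // x; have /andP[x0 x1] := zg x.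
  by rewrite expr2 ler_pM.
pose del := (K + 1)^-1.
have del0 : 0 < del by rewrite invr_gt0; lra.
have delK : del * K = 1 - del by rewrite /del; field; lra.
have [_ [f1 [f1off f1B] <-] f1m] := inf_adherent (exprn_gt0 2 del0) S0.
have [f2 [f2off f2B f2m f2h]] : exists f2 : V -> R,
  [/\ (forall x, ~~ D x -> f2 x = 0), (forall x, B x -> f2 x = 1),
      form f2 f2 < inf S + del ^+ 2 & form f2 f2 <= form h h].
  have [le|gt] := leP (form f1 f1) (form h h); first by exists f1.
  exists (fun x => truncate01 (h x)); split.
  - exact: truncS.
  - by move=> x /h_B; exact: truncate01_1.
  - by apply: le_lt_trans f1m; apply/ltW; apply: le_lt_trans gt; exact: killed_form_truncate.
  - exact: killed_form_truncate.
pose f x := truncate01 (f2 x).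
have foff : forall x, ~~ D x -> f x = 0 by exact: truncS.
have fB x : B x -> f x = 1 by move=> /f2B e; rewrite /f e truncate01_1.
have ff2 : form f f <= form f2 f2 by exact: killed_form_truncate.
have f01 x : 0 <= f x <= 1 by rewrite truncate01_ge0 truncate01_le1.
exists f; split => //; first exact: le_trans f2h.
pose z x := g x * (1 - f x).
have zK : form z z <= K.
  apply: bound => x; have /andP[a b] := f01 x; have gx := g_ge0 x.
  by rewrite /z mulr_ge0 ?subr_ge0//= ler_piMr// gerBl.
have infz : inf S <= form f f + 2 * del * form f z + del ^+ 2 * form z z.
  rewrite -killed_form_sqrD; apply: ge_inf; first by case: S0.
  exists (fun x => f x + del * z x) => //; split.
    by move=> x Dx; rewrite foff// /z g_off// mul0r mulr0 addr0.
  by move=> x Bx; rewrite /z fB// subrr mulr0 mulr0 addr0.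
have zK2 : del ^+ 2 * form z z <= del * (1 - del).
  by rewrite -delK mulrA -expr2 ler_wpM2l// sqr_ge0.
have : 0 < del * (2 * form f z + 1).
  by rewrite -/z; move: infz f2m ff2 zK2; rewrite !expr2; lra.
by rewrite pmulr_rgt0//; lra.
Qed.

Variables (q : R) (o : V) (phi : V -> R).
Hypothesis q_gt1 : 1 < q.
Hypothesis lam_gt0 : 0 < lam.
Hypothesis nu_o : 0 < nu o.
Hypothesis o_W : o \in W.
Hypothesis green : forall h, (forall x, ~~ D x -> h x = 0) -> form g h = h o.
Hypothesis phi_ge0 : forall x, 0 <= phi x.
Hypothesis phi_le1 : forall x, phi x <= 1.
Hypothesis phi_o : phi o = 1.
Hypothesis phi_B : forall x, 0 < phi x -> B x.

Lemma killed_form_gt0 f : f o != 0 -> 0 < form f f.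
Proof.
move=> fo; rewrite ltr_wpDl//.
  by rewrite mulr_ge0 ?invr_ge0//; apply: edge_sum_ge0 => // x y; rewrite -expr2 sqr_ge0.
rewrite mulr_gt0// /mass_sum (big_rem o)//= ltr_pwDl//.
  by rewrite mulr_gt0// -expr2 exprn_even_gt0.
by apply: sumr_ge0 => x _; rewrite mulr_ge0// -expr2 sqr_ge0.
Qed.

(** [scale_estimate] for any competitor h, by passing to a near minimizer. *)
Lemma scale_bound :
  lam * mass_sum W nu (fun x => (B x)%:R * g x) <= 2^-1 ->
  (512 * log_const q)^-1 * (16 * form h h) `^ (1 - q) <=
  \sum_(x <- W) g x `^ q * \sum_(y <- W) mu x y * (phi x - phi y) ^+ 2.
Proof.
have [f [f01 foff fB fh fmin]] := near_minimizer.
have Bo : B o by apply: phi_B; rewrite phi_o.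
have fpos : 0 < form f f by apply: killed_form_gt0; rewrite fB// oner_eq0.
move=> half.
apply: le_trans (@scale_estimate _ _ W mu mu_ge0 mu_sym nu lam nu_ge0 lam_ge0 q D B o g f phi
  q_gt1 g_ge0 g_off green _ _ foff fB fpos fmin phi_ge0 phi_le1 phi_o phi_B half).
- apply: ler_wpM2l.
    by apply/ltW; rewrite invr_gt0; apply: mulr_gt0; [rewrite ltr0n|exact: log_const_gt0].
  have hpos : 0 < form h h by exact: lt_le_trans fh.
  have p16 z : 0 < z -> 0 < 16 * z by move=> z0; rewrite mulr_gt0.
  rewrite -(opprB q 1) !powRN lef_pV2 ?posrE; last 2 first.
  - exact/powR_gt0/p16.
  - exact/powR_gt0/p16.
  apply: ge0_ler_powR.
  - by rewrite subr_ge0 ltW.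
  - by rewrite nnegrE; exact/ltW/p16.
  - by rewrite nnegrE; exact/ltW/p16.
  - by rewrite ler_pM2l.
- by move=> x; case/andP: (f01 x).
- by move=> x; case/andP: (f01 x).
Qed.

End NearMinimizer.

(** * Dyadic scales at a fixed level *)

(** The first term pays for the scales at which the mass of the Green function
    is killed inside the ball, the second one for the other scales. *)
Definition level_const (R : realType) (q : R) : R :=
  8 `^ (q - 1) + 4 * (512 * log_const q * 32 `^ (q - 1)).

(** Linear in t, this takes the place of Jensen's inequality. *)
Lemma tangent_powR (R : realType) (q a t : R) : 1 < q -> 0 < a -> 0 <= t ->
  a `^ (q - 1) * (t - a) <= t `^ q.
Proof.
move=> q1 a0 t0; have [ta|at_] := leP t a.
  apply: (@le_trans _ _ 0); last exact: powR_ge0.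
  by rewrite mulr_ge0_le0 ?powR_ge0// subr_le0.
rewrite -(@mulr_powRB1 _ t q)//; last by lra.
rewrite mulrC ler_pM ?powR_ge0//; [lra|lra|].
by apply: ge0_ler_powR; rewrite ?nnegrE; lra.
Qed.

Lemma sum_pow4 (R : realType) (N : nat) : \sum_(i < N) (4 ^+ i.+1)^-1 <= 1 :> R.
Proof.
suff : \sum_(i < N) (4 ^+ i.+1)^-1 <= 1 - (4 ^+ N)^-1 :> R.
  by move=> /le_trans; apply; rewrite gerBl invr_ge0 exprn_ge0.
elim: N => [|N IH]; first by rewrite big_ord0 expr0 invr1 subrr.
rewrite big_ord_recr/=; apply: (le_trans (lerD IH (lexx _))).
have p0 : 0 < (4 ^+ N)^-1 :> R by rewrite invr_gt0 exprn_gt0.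
by rewrite exprS invfM; lra.
Qed.

Section Level.
Context {R : realType} {V : choiceType} (G : weighted_graph R V).
Variables (sigma : V -> R) (rho : V -> V -> R).
Hypothesis sigma_gt0 : forall x, 0 < sigma x.
Hypothesis rho_edge : edge_length G rho.
Hypothesis adapted : nu_adapted G sigma rho.
Hypothesis proper : proper_dist G rho.
Variable o : V.
Notation nuG := (nu G sigma).
Let nupos := nu_gt0 G sigma_gt0.
Let nu0 x : 0 <= nuG x. Proof. exact/ltW/nupos. Qed.
Notation ball := (rho_ball G rho o).

Section FiniteDomain.
Variables (D : set V) (lam q : R).
Hypothesis finD : finite_set D.
Hypothesis Do : D o.
Hypothesis lam0 : 0 < lam.
Hypothesis q1 : 1 < q.
Let W := nbhd G D.
Let form := killed_form W (mu G) nuG lam.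

(** Green's function of lam - Laplacian on D with pole o. *)
Definition green_fn x : R := resolvent G sigma D o lam x / nuG o.

Lemma green_fn_ge0 x : 0 <= green_fn x.
Proof. by rewrite divr_ge0// resolvent_ge0. Qed.

Lemma green_fn_off x : ~ D x -> green_fn x = 0.
Proof. by move=> Dx; rewrite /green_fn resolvent_off// mul0r. Qed.

Lemma green_fnP h : (forall x, ~ D x -> h x = 0) -> form green_fn h = h o.
Proof.
move=> h0.
have U0 := resolvent_equation G sigma_gt0 finD Do lam0.
set U := resolvent G sigma D o lam in U0.
have e := green_formula G sigma_gt0 finD U h0.
have e2 : \sum_(x <- fset_set D) h x * (nuG x * laplacian G sigma U x) =
    lam * (\sum_(x <- W) U x * h x * nuG x) - h o * nuG o.
  rewrite (@sum_nbhd_domain _ _ G _ finD (fun x => U x * h x * nuG x)); last first.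
    by move=> x /h0 ->; rewrite mulr0 mul0r.
  rewrite -[h o * _](@sum_indic _ _ D finD o (fun x => h x * nuG x))//.
  rewrite mulr_sumr -sumrB big_seq [RHS]big_seq; apply: eq_bigr => x.
  rewrite in_fset_set// => /set_mem Dx; rewrite -(U0 x Dx); ring.
rewrite e2 in e.
have e3 : form green_fn h = (nuG o)^-1 * (2^-1 * edge_sum W (mu G) (fun x y => (h x - h y) * (U x - U y))
   + lam * (\sum_(x <- W) U x * h x * nuG x)).
  have f1 : edge_sum W (mu G) (fun x y => (green_fn x - green_fn y) * (h x - h y)) =
      (nuG o)^-1 * edge_sum W (mu G) (fun x y => (h x - h y) * (U x - U y)).
    by rewrite -edge_sumZ; apply: eq_edge_sum => x y; rewrite /green_fn -/U; ring.
  have f2 : mass_sum W nuG (fun x => green_fn x * h x) =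
      (nuG o)^-1 * \sum_(x <- W) U x * h x * nuG x.
    by rewrite mulr_sumr; apply: eq_bigr => x _; rewrite /green_fn -/U; ring.
  by rewrite /form /killed_form f1 f2; ring.
rewrite e3 (_ : _ + _ = h o * nuG o); last by lra.
by rewrite mulrCA mulVf ?mulr1// gt_eqF.
Qed.

Definition level_mass : R := \sum_(x <- W) green_fn x `^ q * nuG x.

Lemma level_mass_ge0 : 0 <= level_mass.
Proof. by apply: sumr_ge0 => x _; rewrite mulr_ge0 ?powR_ge0. Qed.

(** If less than half of the mass is killed inside the ball, [scale_bound]
    applies. Otherwise the mean of the Green function on the ball is at least
    1 / (2 * lam * nu(ball)), and lam * nu(ball) is at most 2 * c since h is a
    competitor, so that convexity of the q-th power bounds the level mass from
    below. *)
Lemma scale_cost (r c : R) (h : V -> R) : 0 < r -> 0 < c ->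
  (forall x, ~ D x -> h x = 0) -> (forall x, ball r x -> 1 <= h x) ->
  form h h <= 2 * c ->
  c `^ (1 - q) <= 8 `^ (q - 1) * (4 * lam * level_mass) \/
  c `^ (1 - q) <= 512 * log_const q * 32 `^ (q - 1) *
    \sum_(x <- W) green_fn x `^ q *
      \sum_(y <- W) mu G x y * (cutoff G rho o r x - cutoff G rho o r y) ^+ 2.
Proof.
move=> r0 c0 h_off h_B hc.
have oB : ball r o by apply: rho_ball_center => //; exact: ltW.
pose B x := x \in ball r.
have [small|large] := leP (lam * mass_sum W nuG (fun x => (B x)%:R * green_fn x)) 2^-1.
  right.
  have oW : o \in W by exact: sub_nbhd.
  have hpos : 0 < form h h.
    apply: (killed_form_gt0 (mu_ge0 G) nu0 lam0 (nupos o) oW).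
    by rewrite gt_eqF// (lt_le_trans _ (h_B o oB)).
  have sb : (512 * log_const q)^-1 * (16 * form h h) `^ (1 - q) <=
      \sum_(x <- W) green_fn x `^ q *
      \sum_(y <- W) mu G x y * (cutoff G rho o r x - cutoff G rho o r y) ^+ 2.
    apply: (@scale_bound _ _ W (mu G) nuG lam (mu_ge0 G) (mu_sym G) nu0 (ltW lam0)
      (fun x => x \in D) B green_fn h green_fn_ge0 _ _ _ q o (cutoff G rho o r) q1
      lam0 (nupos o) oW) => //.
    - by move=> x; rewrite notin_setE; exact: green_fn_off.
    - by move=> x; rewrite notin_setE; exact: h_off.
    - by move=> x /set_mem; exact: h_B.
    - by move=> k k0; apply: green_fnP => x Dx; apply: k0; rewrite memNset.
    - exact: cutoff_ge0.
    - exact: cutoff_le1.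
    - exact: cutoff_center.
    - by move=> x /(cutoff_gt0 r0)/mem_set.
  set T := \sum_(x <- W) _ in sb *.
  have C0 : 0 < 512 * log_const q by apply: mulr_gt0; [rewrite ltr0n|exact: log_const_gt0].
  rewrite ler_pdivrMl// in sb.
  have c32 : 32 `^ (1 - q) * c `^ (1 - q) <= (16 * form h h) `^ (1 - q).
    have c2 : 0 < 32 * c by rewrite mulr_gt0.
    have h2 : 0 < 16 * form h h by rewrite mulr_gt0.
    rewrite -powRM; [|by rewrite ler0n|exact: ltW].
    rewrite -(opprB q 1) !powRN lef_pV2 ?posrE ?powR_gt0//.
    apply: ge0_ler_powR.
    - by rewrite subr_ge0 ltW.
    - by rewrite nnegrE ltW.
    - by rewrite nnegrE ltW.
    - have := hc; lra.
  have c33 : 32 `^ (q - 1) * 32 `^ (1 - q) = 1 :> R.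
    by rewrite -powRD_gt0// (_ : _ + _ = 0) ?powRr0//; ring.
  have p32 : 0 <= 32 `^ (q - 1) :> R by exact: powR_ge0.
  have := ler_wpM2l p32 (le_trans c32 sb).
  rewrite mulrA c33 mul1r => /le_trans; apply.
  by rewrite mulrA (mulrC _ (512 * _)).
left.
have oW : o \in W by exact: sub_nbhd.
set mg := mass_sum _ _ _ in large.
pose Mb := mass_sum W nuG (fun x => (B x)%:R).
have Mb0 : 0 < Mb.
  rewrite /Mb /mass_sum (big_rem o)//= /B mem_set// mul1r ltr_wpDr//.
  by apply: sumr_ge0 => x _; rewrite mulr_ge0.
have Mbc : lam * Mb <= 2 * c.
  apply: le_trans hc; rewrite /form /killed_form -[leLHS]add0r lerD//.
    rewrite mulr_ge0 ?invr_ge0//; apply: edge_sum_ge0 => [|x y]; first exact: mu_ge0.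
    by rewrite -expr2 sqr_ge0.
  rewrite ler_wpM2l ?(ltW lam0)//; apply: mass_sum_le => // x /=.
  rewrite /B; case: (boolP (x \in ball r)) => [/set_mem/h_B hx|_] /=; last by rewrite -expr2 sqr_ge0.
  by rewrite -[leLHS]mulr1 ler_pM.
pose a := (4 * lam * Mb)^-1.
have a0 : 0 < a by rewrite invr_gt0 !mulr_gt0.
have aMb : a * Mb = (4 * lam)^-1.
  by rewrite /a; field; rewrite !gt_eqF.
have phi : a `^ (q - 1) * (mg - a * Mb) <= level_mass.
  rewrite /mg /Mb -mass_sumZ -(mulN1r (mass_sum _ _ (fun x => a * _))) -mass_sumZ -mass_sumD.
  rewrite -mass_sumZ; apply: ler_sum => x _; rewrite ler_wpM2r//.
  rewrite /B; case: (boolP (x \in ball r)) => _ /=.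
    rewrite mul1r mulr1 mulN1r; apply: tangent_powR => //; exact: green_fn_ge0.
  by rewrite mul0r !mulr0 addr0 mulr0 powR_ge0.
have mga : (4 * lam)^-1 <= mg - a * Mb.
  rewrite aMb.
  have -> : (4 * lam)^-1 = 4^-1 * lam^-1 by rewrite invfM.
  have : 2^-1 * lam^-1 <= mg by rewrite ler_pdivrMr// mulrC ltW.
  lra.
have p1 : a `^ (q - 1) * (4 * lam)^-1 <= level_mass.
  by apply: le_trans phi; rewrite ler_wpM2l ?powR_ge0.
have p2 : c `^ (1 - q) <= 8 `^ (q - 1) * a `^ (q - 1).
  rewrite -powRM; [|by rewrite ler0n|exact: ltW].
  rewrite -(opprB q 1) powRN -[leLHS]mul1r ler_pdivrMr ?powR_gt0//.
  rewrite -powRM; [|by rewrite mulr_ge0 ?ler0n// ltW|exact: ltW].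
  have one1 : 1 `^ (q - 1) = 1 :> R by rewrite powR1.
  rewrite -[leLHS]one1; apply: ge0_ler_powR; rewrite ?nnegrE.
  - by rewrite subr_ge0 ltW.
  - by rewrite ler01.
  - by rewrite !mulr_ge0 ?ler0n// ltW.
  - rewrite /a mulrAC ler_pdivlMr ?mul1r; [lra|by rewrite !mulr_gt0].
apply: (le_trans p2); rewrite ler_wpM2l ?powR_ge0//.
rewrite ler_pdivrMr in p1; first by rewrite mulrC.
by rewrite mulr_gt0.
Qed.

Lemma sum_adapted x : D x -> \sum_(y <- W) mu G x y * rho x y ^+ 2 <= nuG x.
Proof.
move=> Dx; apply: le_trans (adapted x).
rewrite (@sum_adj _ _ G W) ?nbhd_uniq// => y xy.
by rewrite (adj_nbhd finD Dx xy).
Qed.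

(** Summing over dyadic scales: the bad scales form a geometric series, the
    good ones share the Dirichlet form because the metric is adapted. *)
Lemma level_sum (N : nat) (c : nat -> R) (h : nat -> V -> R) :
  let L := 2^-1 * lam `^ (- 2^-1) in
  (forall i, 0 < c i) ->
  (forall i x, (i < N)%N -> ~ D x -> h i x = 0) ->
  (forall i x, (i < N)%N -> ball (L / 2 ^+ i.+1) x -> 1 <= h i x) ->
  (forall i, (i < N)%N -> form (h i) (h i) <= 2 * c i) ->
  \sum_(i < N) (L / 2 ^+ i.+1) ^+ 2 * c i `^ (1 - q) <= level_const q * level_mass.
Proof.
move=> L c0 h_off h_B hc.
have L0 : 0 < L by rewrite mulr_gt0 ?invr_gt0// powR_gt0.
have L2 : L ^+ 2 = 4^-1 * lam^-1.
  rewrite /L exprMn [X in _ * X]expr2 -powRD_gt0//.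
  rewrite (_ : - 2^-1 + - 2^-1 = -1); last by lra.
  by rewrite powR_inv1 ?(ltW lam0)//; congr (_ * _); field.
pose T i := \sum_(x <- W) green_fn x `^ q * \sum_(y <- W) mu G x y *
  (cutoff G rho o (L / 2 ^+ i.+1) x - cutoff G rho o (L / 2 ^+ i.+1) y) ^+ 2.
have T0 i : 0 <= T i.
  apply: sumr_ge0 => x _; rewrite mulr_ge0 ?powR_ge0//.
  by apply: sumr_ge0 => y _; rewrite mulr_ge0 ?mu_ge0// sqr_ge0.
have r0 i : 0 < L / 2 ^+ i.+1 by rewrite divr_gt0// exprn_gt0.
pose K := 512 * log_const q * 32 `^ (q - 1).
have K0 : 0 <= K.
  apply: mulr_ge0; last exact: powR_ge0.
  by apply/ltW/mulr_gt0; [rewrite ltr0n|exact: log_const_gt0].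
have one (i : 'I_N) : (L / 2 ^+ i.+1) ^+ 2 * c i `^ (1 - q) <=
    8 `^ (q - 1) * level_mass * (4 ^+ i.+1)^-1 +
    K * ((L / 2 ^+ i.+1) ^+ 2 * T i).
  have rr : (L / 2 ^+ i.+1) ^+ 2 = 4^-1 * lam^-1 * (4 ^+ i.+1)^-1.
    rewrite exprMn L2 exprVn; congr (_ * _^-1).
    by rewrite -exprM mulnC exprM; congr (_ ^+ _); rewrite expr2; lra.
  have rge : 0 <= (L / 2 ^+ i.+1) ^+ 2 by exact: sqr_ge0.
  have i4 : 0 <= (4 ^+ i.+1)^-1 :> R by rewrite invr_ge0 exprn_ge0.
  case: (scale_cost (r0 i) (c0 i) (h_off i ^~ (ltn_ord i)) (h_B i ^~ (ltn_ord i)) (hc i (ltn_ord i))) => H.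
    apply: (le_trans (ler_wpM2l rge H)); rewrite rr.
    rewrite [leLHS](_ : _ = 8 `^ (q - 1) * level_mass * (4 ^+ i.+1)^-1).
      by rewrite lerDl mulr_ge0// mulr_ge0// -rr.
    move: ((4 ^+ i.+1)^-1) => X; field; exact: lt0r_neq0.
  apply: (le_trans (ler_wpM2l rge H)).
  rewrite mulrCA -/(T i) -/K lerDr.
  by rewrite !mulr_ge0 ?powR_ge0 ?level_mass_ge0.
apply: (le_trans (ler_sum _ (fun i _ => one i))).
rewrite big_split/= -mulr_sumr -mulr_sumr /level_const -/K mulrDl lerD//.
  rewrite -[leRHS]mulr1; apply: ler_wpM2l; last exact: sum_pow4.
  by rewrite mulr_ge0 ?powR_ge0 ?level_mass_ge0.
rewrite [leRHS](_ : _ = K * (4 * level_mass)); last by ring.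
apply: ler_wpM2l => //.
have -> : \sum_(i < N) (L / 2 ^+ i.+1) ^+ 2 * T i =
    \sum_(x <- W) green_fn x `^ q * \sum_(y <- W) mu G x y *
     \sum_(i < N) (L / 2 ^+ i.+1) ^+ 2 *
       (cutoff G rho o (L / 2 ^+ i.+1) x - cutoff G rho o (L / 2 ^+ i.+1) y) ^+ 2.
  under eq_bigr do rewrite mulr_sumr.
  rewrite exchange_big/=; apply: eq_bigr => x _.
  under eq_bigr do rewrite mulrCA mulr_sumr.
  rewrite -mulr_sumr exchange_big/=; congr (_ * _); apply: eq_bigr => y _.
  by rewrite mulr_sumr; apply: eq_bigr => i _; rewrite mulrCA.
rewrite /level_mass mulr_sumr; apply: ler_sum => x _.
have [Dx|Dx] := pselect (D x); last first.
  by rewrite green_fn_off// powR0 ?mul0r ?mulr0// gt_eqF// (lt_trans _ q1).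
rewrite mulrCA ler_wpM2l ?powR_ge0//.
apply: (@le_trans _ _ (4 * \sum_(y <- W) mu G x y * rho x y ^+ 2)); last first.
  by rewrite ler_pM2l//; exact: sum_adapted.
rewrite mulr_sumr; apply: ler_sum => y _; rewrite mulrCA.
have [xy|nxy] := boolP (adj G x y); last by rewrite mu_nadj_eq0// !mul0r.
rewrite ler_wpM2l ?mu_ge0//.
apply: (le_trans (sum_cutoff_le G rho o N x y L0)).
by rewrite ler_pM2l//; exact: path_dist_lip.
Qed.

End FiniteDomain.
End Level.

(** * Capacities of balls at a fixed level *)

Section Capacity.
Context {R : realType} {V : choiceType} (G : weighted_graph R V).
Variable sigma : V -> R.
Hypothesis sigma_gt0 : forall x, 0 < sigma x.
Notation nuG := (nu G sigma).
Let nupos := nu_gt0 G sigma_gt0.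
Let nu0 x : 0 <= nuG x. Proof. exact/ltW/nupos. Qed.

Definition cap_functional (lam : R) (f : V -> R) : R :=
  energy G f + lam * \sum_(x \in [set: V]) (f x ^+ 2 * nuG x).

Lemma cap_functionalE (D : set V) lam f : finite_set D ->
  (forall x, ~ D x -> f x = 0) ->
  cap_functional lam f = killed_form (nbhd G D) (mu G) nuG lam f f.
Proof.
move=> finD f0; rewrite /cap_functional (energy_edge_sum G finD f0).
rewrite (sum_domain G finD (F := fun x => f x ^+ 2 * nuG x)); last first.
  by move=> x /f0 ->; rewrite expr0n mul0r.
by congr (_ + _ * _); apply: eq_bigr => x _; rewrite expr2.
Qed.

Lemma finitely_supported_off (f : V -> R) (D : set V) :
  [set x | f x != 0] `<=` D -> forall x, ~ D x -> f x = 0.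
Proof. by move=> fD x Dx; apply/eqP; apply: contrapT => /negP/fD. Qed.

Lemma finitely_supported_indic (A : set V) : finite_set A ->
  finitely_supported (\1_A : V -> R).
Proof.
move=> finA; apply: sub_finite_set finA => x /=.
by rewrite indicE; case: (boolP (x \in A)) => [/set_mem//|_]; rewrite eqxx.
Qed.

Let capset lam (A : set V) := [set cap_functional lam f | f in
  [set f | finitely_supported f /\ forall x, A x -> 1 <= f x]].

Lemma cap_functional_ge lam f o : 0 <= lam -> finitely_supported f ->
  lam * nuG o * f o ^+ 2 <= cap_functional lam f.
Proof.
move=> lam0 fs.
have finD : finite_set ([set x | f x != 0] `|` [set o]).
  by rewrite finite_setU; split => //; exact: finite_set1.
rewrite (cap_functionalE _ finD); last by apply: finitely_supported_off; left.
rewrite /killed_form -[leLHS]add0r lerD//.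
  rewrite mulr_ge0 ?invr_ge0//; apply: edge_sum_ge0 => [|x y]; first exact: mu_ge0.
  by rewrite -expr2 sqr_ge0.
rewrite -mulrA ler_wpM2l// /mass_sum (big_rem o)/=; last first.
  by apply: sub_nbhd => //; right.
rewrite mulrC expr2 lerDl; apply: sumr_ge0 => x _.
by rewrite mulr_ge0// -expr2 sqr_ge0.
Qed.

Let capset_lb lam A : 0 <= lam -> has_lbound (capset lam A).
Proof.
move=> lam0; have [z _] := infinite_setN0 (vertices_infinite G).
exists 0 => _ [f [fs _] <-]; apply: le_trans (cap_functional_ge z lam0 fs).
by rewrite mulr_ge0 ?sqr_ge0// mulr_ge0.
Qed.

Let capset_n0 lam A : finite_set A -> capset lam A !=set0.
Proof.
move=> finA; exists (cap_functional lam \1_A), \1_A => //; split.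
  exact: finitely_supported_indic.
by move=> x Ax; rewrite indicE mem_set.
Qed.

Lemma Cap_ge lam A o : 0 <= lam -> finite_set A -> A o ->
  lam * nuG o <= Cap G sigma lam A.
Proof.
move=> lam0 finA Ao; apply: lb_le_inf => [|_ [f [fs fA] <-]]; first exact: capset_n0.
apply: le_trans (cap_functional_ge o lam0 fs).
rewrite -[leLHS]mulr1; apply: ler_wpM2l; first exact: mulr_ge0.
by rewrite exprn_ege1// fA.
Qed.

Lemma Cap_le lam A f : 0 <= lam -> finitely_supported f ->
  (forall x, A x -> 1 <= f x) -> Cap G sigma lam A <= cap_functional lam f.
Proof. by move=> lam0 fs fA; apply: ge_inf; [exact: capset_lb|exists f]. Qed.

Lemma Cap_mono lam (A B : set V) : 0 <= lam -> finite_set B -> A `<=` B ->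
  Cap G sigma lam A <= Cap G sigma lam B.
Proof.
move=> lam0 finB AB; apply: lb_le_inf => [|_ [f [fs fA] <-]]; first exact: capset_n0.
by apply: Cap_le => // x /AB; exact: fA.
Qed.

Lemma Cap_adherent lam (A : set V) e : 0 <= lam -> finite_set A -> 0 < e ->
  exists f, [/\ finitely_supported f, forall x, A x -> 1 <= f x &
    cap_functional lam f < Cap G sigma lam A + e].
Proof.
move=> lam0 finA e0.
have hi : has_inf (capset lam A) by split; [exact: capset_n0|exact: capset_lb].
by have [_ [f [fs fA] <-] fe] := inf_adherent e0 hi; exists f.
Qed.

Lemma exhaustion_mono (D : nat -> set V) i j : exhaustion G D -> (i <= j)%N ->
  D i `<=` D j.
Proof.
move=> [_ Dmono _] ij; rewrite -(subnK ij); elim: (j - i)%N => [//|k IH].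
by rewrite addSn; exact: subset_trans IH (Dmono _).
Qed.

Lemma exhaustion_finite (D : nat -> set V) (K : set V) : exhaustion G D ->
  finite_set K -> exists j, forall i, (j <= i)%N -> K `<=` D i.
Proof.
move=> exD finK; have [_ _ DT] := exD.
have H x : exists j, D j x by have : [set: V] x by []; rewrite -DT => -[j _ ?]; exists j.
pose jx x := sval (cid (H x)).
exists (\max_(x <- fset_set K) jx x)%N => i ij x Kx.
apply: (exhaustion_mono (i := jx x) exD); last exact: (svalP (cid (H x))).
apply: leq_trans ij; rewrite (big_rem x)/= ?leq_maxl//.
by rewrite in_fset_set ?mem_set.
Qed.

End Capacity.

Section ConstantBound.
Context {R : realType}.
Notation leb := (@lebesgue_measure R).

Lemma integral_itv_le (b1 b2 : bool) (a b M : R) (f : R -> R) : a <= b ->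
  (forall r, r \in Interval (BSide b1 a) (BSide b2 b) -> 0 <= f r <= M) ->
  (\int[leb]_(r in [set` Interval (BSide b1 a) (BSide b2 b)]) (f r)%:E <= ((b - a) * M)%:E)%E.
Proof.
move=> ab fM.
apply: (@le_trans _ _ (\int[leb]_(r in [set` Interval (BSide b1 a) (BSide b2 b)]) (M%:E))%E).
  apply: le_lower_integral => r /= /fM /andP[f0 f1]; rewrite lee_fin//.
rewrite integral_cst//= lebesgue_measure_itv/= lte_fin.
case: ifPn => [_|]; first by rewrite -EFinD -EFinM mulrC.
by rewrite -leNgt mule0 => ba; rewrite (@le_anti _ _ a b) ?ab// subrr mul0r.
Qed.

End ConstantBound.

Section LevelIntegral.
Context {R : realType} {V : choiceType} (G : weighted_graph R V).
Variables (sigma : V -> R) (rho : V -> V -> R).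
Hypothesis sigma_gt0 : forall x, 0 < sigma x.
Hypothesis rho_edge : edge_length G rho.
Hypothesis adapted : nu_adapted G sigma rho.
Hypothesis proper : proper_dist G rho.
Variables (o : V) (q : R).
Hypothesis q1 : 1 < q.
Notation leb := (@lebesgue_measure R).
Notation nuG := (nu G sigma).
Let nupos := nu_gt0 G sigma_gt0.

Section FixedLevel.
Variable lam : R.
Hypothesis lam0 : 0 < lam.
Let C r := Cap G sigma lam (rho_ball G rho o r).
Let p r := C r `^ (1 - q).
Let P := (lam * nuG o) `^ (1 - q).

Let C_mono r s : r <= s -> C r <= C s.
Proof.
by move=> rs; apply: Cap_mono => //; [exact: ltW|exact: rho_ball_mono].
Qed.

Let C_ge r : 0 < r -> lam * nuG o <= C r.
Proof.
move=> r0; apply: Cap_ge => //; first exact: ltW.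
by apply: rho_ball_center => //; exact: ltW.
Qed.

Let C_gt0 r : 0 < r -> 0 < C r.
Proof. by move=> /C_ge; apply: lt_le_trans; rewrite mulr_gt0. Qed.

Let p_anti r s : 0 < r -> r <= s -> p s <= p r.
Proof.
move=> r0 rs; have s0 : 0 < s by exact: lt_le_trans rs.
rewrite /p -(opprB q 1) !powRN lef_pV2 ?posrE ?powR_gt0 ?C_gt0//.
apply: ge0_ler_powR; first by rewrite subr_ge0 ltW.
- by rewrite nnegrE ltW ?C_gt0.
- by rewrite nnegrE ltW ?C_gt0.
- exact: C_mono.
Qed.

Let p_le r : 0 < r -> p r <= P.
Proof.
move=> r0; rewrite /p /P -(opprB q 1) !powRN lef_pV2 ?posrE; last 2 first.
- by rewrite powR_gt0// C_gt0.
- by rewrite powR_gt0// mulr_gt0.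
apply: ge0_ler_powR; first by rewrite subr_ge0 ltW.
- by rewrite nnegrE ltW// mulr_gt0.
- by rewrite nnegrE ltW ?C_gt0.
- exact: C_ge.
Qed.

Lemma measurable_cap_integrand (A : set R) : measurable A ->
  measurable_fun A (fun r : R => (r * p r)%:E).
Proof.
move=> mA; apply: measurable_funTS; apply/measurable_EFinP.
apply: measurable_funM => //.
have mC : measurable_fun setT C by apply: nondecreasing_measurable.
exact: (measurableT_comp (measurable_powR (1 - q)) mC).
Qed.

Lemma halving_step s : 0 < s ->
  (\int[leb]_(r in `]0%R, s[) (r * p r)%:E <=
   (2 * (s / 2) ^+ 2 * p (s / 2))%:E + \int[leb]_(r in `]0%R, (s / 2)%R[) (r * p r)%:E)%E.
Proof.
move=> s0; have s20 : 0 < s / 2 by rewrite divr_gt0.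
have U : (`]0%R, s[%classic : set R) = `]0%R, (s / 2)%R[ `|` `[(s / 2)%R, s[.
  apply/seteqP; split => [x|x []] /=; rewrite !in_itv/=.
  - move=> /andP[x0 xs]; have [xh|xh] := ltP x (s / 2); [left|right].
      by rewrite x0.
    by rewrite xs.
  - by move=> /andP[-> h]; rewrite /=; lra.
  - by move=> /andP[h ->]; rewrite andbT; lra.
rewrite U ge0_integral_setU//=.
- rewrite addeC leeD2r//.
  apply: le_trans (@integral_itv_le _ true true (s / 2) s (s * p (s / 2)) _ _ _) _.
  + by lra.
  + move=> r; rewrite in_itv/= => /andP[h1 h2].
    have r0 : 0 < r by exact: lt_le_trans h1.
    rewrite mulr_ge0 ?powR_ge0 ?(ltW r0)//= ler_pM ?powR_ge0 ?(ltW r0) ?(ltW h2)//.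
    exact: p_anti.
  + by rewrite lee_fin expr2; lra.
- exact: measurable_cap_integrand (measurableU _ _ _ _).
- move=> r [] /=; rewrite in_itv/= => /andP[h1 _]; rewrite lee_fin mulr_ge0 ?powR_ge0//.
    exact: ltW.
  by apply: le_trans h1; exact: ltW.
- apply/disj_setPS => r [] /=; rewrite !in_itv/= => /andP[_ h1] /andP[h2 _].
  by move: (lt_le_trans h1 h2); rewrite ltxx.
Qed.

(** The innermost ball is left with the capacity of the pole alone, which does
    not depend on the radius. *)
Lemma dyadic_bound (L : R) (N : nat) : 0 < L ->
  (\int[leb]_(r in `]0%R, L[) (r * p r)%:E <=
   (2 * \sum_(i < N) (L / 2 ^+ i.+1) ^+ 2 * p (L / 2 ^+ i.+1) +
    (L / 2 ^+ N) ^+ 2 * P)%:E)%E.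
Proof.
move=> L0.
have r0 n : 0 < L / 2 ^+ n by rewrite divr_gt0// exprn_gt0.
have ind : (\int[leb]_(r in `]0%R, L[) (r * p r)%:E <=
   (2 * \sum_(i < N) (L / 2 ^+ i.+1) ^+ 2 * p (L / 2 ^+ i.+1))%:E +
   \int[leb]_(r in `]0%R, (L / 2 ^+ N)%R[) (r * p r)%:E)%E.
  elim: N => [|N IH]; first by rewrite big_ord0 mulr0 add0e expr0 divr1.
  apply: (le_trans IH); rewrite big_ord_recr/= mulrDr EFinD -addeA leeD2l//.
  have := halving_step (r0 N).
  have -> : L / 2 ^+ N / 2 = L / 2 ^+ N.+1 by rewrite exprSr invfM mulrA.
  by rewrite mulrA.
apply: (le_trans ind); rewrite EFinD leeD2l//.
apply: le_trans (@integral_itv_le _ false true 0 (L / 2 ^+ N) (L / 2 ^+ N * P) _ _ _) _.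
- exact: ltW.
- move=> r; rewrite in_itv/= => /andP[h1 h2].
  by rewrite mulr_ge0 ?powR_ge0 ?(ltW h1)//= ler_pM ?powR_ge0 ?(ltW h1) ?(ltW h2) ?p_le.
- by rewrite lee_fin subr0 expr2 mulrA.
Qed.

(** Finitely many dyadic scales carry the integral, so a domain containing the
    supports of nearly optimal competitors at these scales is large enough. *)
Lemma level_integral (D : nat -> set V) : exhaustion G D ->
  exists j, D j o /\
    (\int[leb]_(r in `]0%R, (2^-1 * lam `^ (- 2^-1))%R[) (r * p r)%:E <=
     (3 * level_const q * level_mass G sigma o (D j) lam q)%:E)%E.
Proof.
move=> exD; set L := 2^-1 * lam `^ (- 2^-1).
have L0 : 0 < L by rewrite mulr_gt0 ?invr_gt0// powR_gt0.
pose r (i : nat) := L / 2 ^+ i.+1.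
have r0 i : 0 < r i by rewrite divr_gt0// exprn_gt0.
have P0 : 0 < P by rewrite powR_gt0// mulr_gt0.
have p0 i : 0 < p (r i) by rewrite powR_gt0// C_gt0.
(* N makes the innermost remainder smaller than the first dyadic term *)
have [N [N0 HN]] : exists N, (0 < N)%N /\ (L / 2 ^+ N) ^+ 2 * P <= (r 0%N) ^+ 2 * p (r 0%N).
  set a := (r 0%N) ^+ 2 * p (r 0%N).
  have a0 : 0 < a by apply: mulr_gt0; [exact: exprn_gt0|exact: p0].
  have b0 : 0 < L ^+ 2 * P by apply: mulr_gt0; [exact: exprn_gt0|].
  pose M := Num.truncn (L ^+ 2 * P / a); exists M.+1; split => //.
  have M1 : L ^+ 2 * P / a <= (2 ^+ M.+1) ^+ 2.
    apply: (@le_trans _ _ M.+1%:R); first by apply/ltW/real_truncnS_gt/num_real.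
    apply: (@le_trans _ _ (2 ^+ M.+1)).
      by rewrite -natrX ler_nat ltnW// ltn_expl.
    by rewrite expr2 ler_peMr ?exprn_ge0// exprn_ege1// ler1n.
  have e0 : 0 < (2 ^+ M.+1) ^+ 2 :> R by rewrite !exprn_gt0.
  by rewrite exprMn exprVn mulrAC ler_pdivrMr// (mulrC a) -ler_pdivrMr.
have comp i : exists f, [/\ finitely_supported f,
    forall x, rho_ball G rho o (r i) x -> 1 <= f x &
    cap_functional G sigma lam f <= 2 * C (r i)].
  have [f [fs fB fC]] := Cap_adherent G sigma_gt0 (ltW lam0) (proper o (r i)) (C_gt0 (r0 i)).
  exists f; split => //; apply: (le_trans (ltW fC)).
  by rewrite -/(C (r i)) mulr_natl mulr2n.
pose h i := sval (cid (comp i)).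
have hP i := svalP (cid (comp i)).
pose K := [set o] `|` \bigcup_(i in `I_N) [set x | h i x != 0].
have finK : finite_set K.
  rewrite finite_setU; split; first exact: finite_set1.
  by apply: bigcup_finite => // i _; have [] := hP i.
have [j Kj] := exhaustion_finite exD finK.
have finD : finite_set (D j) by case: exD => H _ _; case: (H j).
have KD : K `<=` D j by exact: Kj.
have Do : D j o by apply: KD; left.
exists j; split => //.
apply: (le_trans (dyadic_bound N L0)); rewrite lee_fin.
have h_off i x : (i < N)%N -> ~ D j x -> h i x = 0.
  move=> iN; apply: finitely_supported_off => y hy; apply: KD; right.
  by exists i.
have main := @level_sum _ _ G sigma rho sigma_gt0 rho_edge adapted o (D j) lam q
  finD Do lam0 q1 N (fun i => C (r i)) h.
have {}main : \sum_(i < N) r i ^+ 2 * p (r i) <= level_const q * level_mass G sigma o (D j) lam q.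
  apply: main => //.
  - by move=> i; exact: C_gt0.
  - by move=> i x _; have [_ hB _] := hP i; exact: hB.
  - by move=> i iN; rewrite -cap_functionalE//; [have [] := hP i|move=> x; exact: h_off].
have first : r 0%N ^+ 2 * p (r 0%N) <= \sum_(i < N) r i ^+ 2 * p (r i).
  case: N N0 {HN K finK Kj KD h_off main} => // N _.
  rewrite big_ord_recl/= lerDl; apply: sumr_ge0 => i _.
  by rewrite mulr_ge0 ?sqr_ge0 ?powR_ge0.
rewrite -/(r) in first main *; lra.
Qed.

End FixedLevel.
End LevelIntegral.

(** * Volumes and capacities of annuli *)

Section RealAux.
Context {R : realType}.
Notation leb := (@lebesgue_measure R).

(** A function determined by two monotone integer-valued functions takes
    countably many values, each on an intersection of two intervals. *)
Lemma measurable_two_levels (F : R -> R) (n1 n2 : R -> nat) :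
  {homo n1 : r s / r <= s >-> (r <= s)%N} -> {homo n2 : r s / r <= s >-> (r <= s)%N} ->
  (forall r s, n1 r = n1 s -> n2 r = n2 s -> F r = F s) ->
  measurable_fun setT F.
Proof.
move=> h1 h2 FE _ B mB; rewrite setTI.
have level (n : R -> nat) k : {homo n : r s / r <= s >-> (r <= s)%N} ->
    measurable [set r | n r = k].
  move=> hn; apply: is_interval_measurable => r s /= nr ns t /andP[rt ts].
  by apply/eqP; rewrite eqn_leq -{1}ns -nr !hn.
pose L (k : nat * nat) := [set r : R | [/\ n1 r = k.1, n2 r = k.2 &
  exists s, [/\ n1 s = k.1, n2 s = k.2 & B (F s)]]].
have -> : F @^-1` B = \bigcup_k L k.
  apply/seteqP; split => [r Br|r [k _ [e1 e2 [s [f1 f2 Bs]]]]].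
    by exists (n1 r, n2 r) => //; split => //; exists r.
  by rewrite /= (FE r s) ?e1 ?e2.
apply: countable_bigcupT_measurable => [|k]; first exact: countableP.
have [ex|nex] := pselect (exists s, [/\ n1 s = k.1, n2 s = k.2 & B (F s)]).
  rewrite (_ : L k = [set r | n1 r = k.1] `&` [set r | n2 r = k.2]).
    by apply: measurableI; exact: level.
  by apply/seteqP; split => [r []|r []].
by rewrite (_ : L k = set0) //; apply/seteqP; split => // r [].
Qed.

Lemma integral_inv (a b : R) : 0 < a -> a < b ->
  (\int[leb]_(x in `[a, b[) (x^-1)%:E = (ln b - ln a)%:E)%E.
Proof.
move=> a0 ab.
have dln x : 0 < x -> derivable (@ln R) x 1.
  by move=> x0; exact: (@ex_derive _ _ _ _ _ _ _ (is_derive1_ln x0)).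
have cln x : 0 < x -> {for x, continuous (@ln R)}.
  by move=> /dln d; apply: differentiable_continuous; exact/derivable1_diffP.
have cinv : {within `[a, b], continuous (fun x : R => x^-1)}.
  apply: continuous_in_subspaceT => x; rewrite inE/= in_itv/= => /andP[ax _].
  by apply: cvgV; [rewrite gt_eqF// (lt_le_trans a0)|exact: cvg_id].
rewrite integral_itv_bndo_bndc; last first.
  apply/measurable_EFinP; apply: (@measurable_funS _ _ _ _ `[a, b]) => //.
    by move=> x /=; rewrite !in_itv/= => /andP[-> /ltW].
  by apply: subspace_continuous_measurable_fun.
rewrite (@continuous_FTC2 _ _ (@ln R) a b ab)//.
- split.
  + by move=> x; rewrite in_itv/= => /andP[ax _]; apply: dln; exact: lt_trans ax.
  + by apply: cvg_at_right_filter; exact: cln.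
  + by apply: cvg_at_left_filter; apply: cln; exact: lt_trans ab.
- move=> x; rewrite in_itv/= => /andP[ax _]; have x0 : 0 < x by exact: lt_trans ax.
  by rewrite derive1E; have [_ ->] := is_derive1_ln x0.
Qed.

Lemma le_lower_integral_support (D E : set R) (f g : R -> \bar R) :
  (forall x, D x -> (0 <= f x)%E) -> (forall x, E x -> (0 <= g x)%E) ->
  (forall x, D x -> f x = 0%E \/ E x /\ (f x <= g x)%E) ->
  (\int[leb]_(x in D) f x <= \int[leb]_(x in E) g x)%E.
Proof.
move=> f0 g0 fg; rewrite [leLHS]integral_mkcond [leRHS]integral_mkcond.
have gE x : (0 <= (g \_ E) x)%E.
  by rewrite /patch; case: ifPn => // /set_mem/g0.
apply: le_lower_integral => x _; rewrite {1}/patch; case: ifPn => // /set_mem Dx.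
  exact: f0.
by have [->//|[Ex fgx]] := fg x Dx; rewrite /patch mem_set.
Qed.

End RealAux.

Section Volume.
Context {R : realType} {V : choiceType} (G : weighted_graph R V).
Variables (sigma : V -> R) (rho : V -> V -> R).
Hypothesis sigma_gt0 : forall x, 0 < sigma x.
Hypothesis rho_edge : edge_length G rho.
Hypothesis adapted : nu_adapted G sigma rho.
Hypothesis proper : proper_dist G rho.
Variable o : V.
Notation nuG := (nu G sigma).
Let nupos := nu_gt0 G sigma_gt0.
Let nu0 x : 0 <= nuG x. Proof. exact/ltW/nupos. Qed.
Notation ball := (rho_ball G rho o).
Notation leb := (@lebesgue_measure R).
Let M r := vol G sigma rho o (2 * r).
Let A r := annulus_cap G rho o r (2 * r).

Let annset r := [set energy G f | f in [set f | [/\ finitely_supported f,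
    forall x, ball r x -> f x = 1 & forall x, ~ ball (2 * r) x -> f x = 0]]].

Lemma vol_gt0 r : 0 <= r -> 0 < M r.
Proof.
move=> r0; rewrite /M /vol fsbig_finite; last exact: proper.
rewrite (big_rem o)/=; last first.
  rewrite in_fset_set; last exact: proper.
  by apply/mem_set; apply: rho_ball_center => //; rewrite mulr_ge0.
by rewrite ltr_wpDr//; apply: sumr_ge0.
Qed.

Lemma energy_ge0 f : finitely_supported f -> 0 <= energy G f.
Proof.
move=> fs; rewrite (energy_edge_sum G fs) ?mulr_ge0 ?invr_ge0//.
  by apply: edge_sum_ge0 => [|x y]; [exact: mu_ge0|rewrite -expr2 sqr_ge0].
exact: finitely_supported_off.
Qed.

Let annset_lb r : has_lbound (annset r).
Proof. by exists 0 => _ [f [fs _ _] <-]; exact: energy_ge0. Qed.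

Lemma edge_sum_le_adj (W : seq V) (F F' : V -> V -> R) :
  (forall x y, adj G x y -> F x y <= F' x y) ->
  edge_sum W (mu G) F <= edge_sum W (mu G) F'.
Proof.
move=> FF'; apply: ler_sum => x _; apply: ler_sum => y _.
have [xy|nxy] := boolP (adj G x y); last by rewrite mu_nadj_eq0// !mul0r.
by rewrite ler_wpM2l ?mu_ge0// FF'.
Qed.

Let phi r x := cutoff G rho o (2 * r) x.

Let phi_in r : 0 < r ->
  [/\ finitely_supported (phi r), forall x, ball r x -> phi r x = 1
    & forall x, ~ ball (2 * r) x -> phi r x = 0].
Proof.
move=> r0; have r20 : 0 < 2 * r by rewrite mulr_gt0.
have off x : ~ ball (2 * r) x -> phi r x = 0.
  move=> nb; apply/eqP; rewrite eq_le cutoff_ge0 andbT leNgt.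
  by apply/negP => /(cutoff_gt0 r20).
split => //.
  apply: (@sub_finite_set _ _ (ball (2 * r))); last exact: proper.
  by move=> x /= /eqP; apply: contra_notP; exact: off.
move=> x; rewrite /rho_ball/= => dr; rewrite /phi /cutoff min_l; last first.
  by rewrite lerBrDr -lerBrDl ler_pdivrMr//; lra.
by rewrite max_r.
Qed.

Let phi_lip r x y : 0 < r -> adj G x y -> (phi r x - phi r y) ^+ 2 <= rho x y ^+ 2 / r ^+ 2.
Proof.
move=> r0 xy; have r20 : 0 < 2 * r by rewrite mulr_gt0.
rewrite ler_pdivlMr ?exprn_gt0// -exprMn.
apply: le_trans (path_dist_lip rho_edge o xy).
rewrite /phi /cutoff; set a := path_dist G rho o x; set b := path_dist G rho o y.
have cl (s t : R) : (Num.max 0 (Num.min 1 s) - Num.max 0 (Num.min 1 t)) ^+ 2 <= (s - t) ^+ 2.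
  have := truncate01_lip s t; rewrite -!expr2 /truncate01.
  have e z : Num.min (Num.max z 0) 1 = Num.max 0 (Num.min 1 z) :> R.
    have [?|?] := leP z 0; have [?|?] := leP 1 z;
    repeat match goal with
      | |- context [Num.min ?a ?b] => have [?|?] := leP a b
      | |- context [Num.max ?a ?b] => have [?|?] := leP a b end; lra.
  by rewrite !e.
have := cl (2 - 2 * a / (2 * r)) (2 - 2 * b / (2 * r)).
move=> /(ler_wpM2r (sqr_ge0 r)); rewrite -!exprMn => /le_trans; apply.
have -> : (2 - 2 * a / (2 * r) - (2 - 2 * b / (2 * r))) * r = - (a - b).
  by field; rewrite gt_eqF.
by rewrite sqrrN.
Qed.

(** The cutoff has slope 1 / r and the metric is adapted. *)
Lemma annulus_cap_le r : 0 < r -> A r <= M r / r ^+ 2.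
Proof.
move=> r0; have [fs f1 f0] := phi_in r0.
have finB : finite_set (ball (2 * r)) by exact: proper.
apply: (@le_trans _ _ (energy G (phi r))).
  by apply: ge_inf; [exact: annset_lb|exists (phi r)].
rewrite (energy_edge_sum G finB f0).
set W := nbhd _ _.
pose F x y := (x \in ball (2 * r))%:R * (rho x y ^+ 2 / r ^+ 2).
have F0 x y : 0 <= F x y by rewrite /F mulr_ge0// divr_ge0 ?sqr_ge0.
apply: (@le_trans _ _ (2^-1 * edge_sum W (mu G) (fun x y => F x y + F y x))).
  rewrite ler_pM2l ?invr_gt0//; apply: edge_sum_le_adj => x y xy.
  have yx : adj G y x by rewrite adj_sym.
  have lx := phi_lip r0 xy; have ly := phi_lip r0 yx.
  rewrite -expr2 /F; case: (boolP (x \in _)) => [_|/negP xB].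
    by apply: (le_trans lx); rewrite mul1r lerDl; exact: F0.
  have {xB}Bx : ~ ball (2 * r) x by move=> /mem_set.
  case: (boolP (y \in _)) => [_|/negP yB]; last first.
    have By : ~ ball (2 * r) y by move=> /mem_set.
    by rewrite !f0// subrr expr0n !mul0r addr0.
  by rewrite mul0r add0r mul1r -(opprB (phi r y)) sqrrN.
rewrite edge_sumD (edge_sumC W (mu_sym G) F) -mulr2n -[X in _ * X]mulr_natl mulrA mulVf// mul1r.
rewrite /M /vol fsbig_finite// mulr_suml /edge_sum.
rewrite (@sum_nbhd_domain _ _ G _ finB (fun x => \sum_(y <- W) mu G x y * F x y)); last first.
  by move=> x Bx; rewrite big1// => y _; rewrite /F memNset// mul0r mulr0.
rewrite big_seq [leRHS]big_seq; apply: ler_sum => x.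
rewrite in_fset_set// => Bx; rewrite /F Bx.
under eq_bigr do rewrite mul1r mulrA.
rewrite -mulr_suml ler_wpM2r ?invr_ge0 ?sqr_ge0//.
exact: (sum_adapted adapted finB (set_mem Bx)).
Qed.

(** Truncating a condenser potential at the levels 0 and 1 bounds its mass by
    the volume of the larger ball. *)
Lemma Cap_le_annulus lam r : 0 <= lam -> 0 < r ->
  Cap G sigma lam (ball r) <= A r + lam * M r.
Proof.
move=> lam0 r0; rewrite -lerBlDr; apply: lb_le_inf => [|_ [f [fs f1 f0] <-]].
  by exists (energy G (phi r)), (phi r) => //; exact: phi_in.
have finB : finite_set (ball (2 * r)) by exact: proper.
rewrite lerBlDr; pose g x := truncate01 (f x).
have g0 x : ~ ball (2 * r) x -> g x = 0 by move=> /f0 fx; rewrite /g fx truncate01_0.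
apply: (@le_trans _ _ (cap_functional G sigma lam g)).
  apply: Cap_le => //; last by move=> x /f1 fx; rewrite /g fx truncate01_1.
  apply: sub_finite_set finB => x /= /eqP; apply: contra_notP; exact: g0.
rewrite (@cap_functionalE _ _ G sigma _ lam g finB g0) (energy_edge_sum G finB f0) /killed_form.
rewrite lerD//.
  rewrite ler_wpM2l ?invr_ge0//; apply: edge_sum_le => [|x y]; first exact: mu_ge0.
  exact: truncate01_lip.
rewrite ler_wpM2l// /mass_sum (@sum_nbhd_domain _ _ G _ finB); last first.
  by move=> x /g0 ->; rewrite !mul0r.
rewrite /M /vol fsbig_finite//; apply: ler_sum => x _.
rewrite ler_piMl// mulr_ile1 ?truncate01_ge0 ?truncate01_le1//.
Qed.

Lemma annulus_cap_ge0 r : 0 < r -> 0 <= A r.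
Proof.
move=> r0; apply: lb_le_inf => [|_ [f [fs _ _] <-]]; last exact: energy_ge0.
by exists (energy G (phi r)), (phi r) => //; exact: phi_in.
Qed.

Let bcard r := #|` fset_set (ball r)|.

Let bcard_mono : {homo bcard : r s / r <= s >-> (r <= s)%N}.
Proof.
move=> r s rs; apply: fsubset_leq_card; rewrite -fset_set_sub; [|exact: proper|exact: proper].
exact: rho_ball_mono.
Qed.

Let bcard_inj r s : bcard r = bcard s -> ball r = ball s.
Proof.
wlog rs : r s / r <= s => [H|e].
  by have [/H//|/ltW/H h /esym/h] := leP r s.
apply: fset_set_inj; [exact: proper|exact: proper|].
apply/eqP; rewrite eqEfcard -/(bcard s) -/(bcard r) e leqnn andbT.
by rewrite -fset_set_sub; [exact: rho_ball_mono|exact: proper|exact: proper].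
Qed.

(** Balls are finite and nested, so that their cardinals determine them. *)
Let measurable_ball_fun (F : R -> R) :
  (forall r s, ball r = ball s -> ball (2 * r) = ball (2 * s) -> F r = F s) ->
  measurable_fun setT F.
Proof.
move=> FE; apply: (@measurable_two_levels _ F bcard (fun r => bcard (2 * r))) => //.
- by move=> r s rs; apply: bcard_mono; rewrite ler_pM2l.
- by move=> r s /bcard_inj e1 /bcard_inj e2; exact: FE.
Qed.

Lemma measurable_vol : measurable_fun setT M.
Proof. by apply: measurable_ball_fun => r s _ e; rewrite /M /vol e. Qed.

Lemma measurable_annulus_cap : measurable_fun setT A.
Proof. by apply: measurable_ball_fun => r s e1 e2; rewrite /A /annulus_cap e1 e2. Qed.

Variable q : R.
Hypothesis q1 : 1 < q.

(** The levels at which the mass term lam * M dominates the annular capacity and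
    at which r lies in the range of radii of the capacity integral. *)
Let live lam r := (A r <= lam * (8 * M r)) && (lam * (4 * r ^+ 2) < 1).

Let K lam r : R := if live lam r then r * lam `^ (-1) * (9 * M r) `^ (1 - q) else 0.

Let K_ge0 lam r : 0 < r -> 0 <= K lam r.
Proof. by move=> r0; rewrite /K; case: ifP => // _; rewrite !mulr_ge0 ?powR_ge0 ?(ltW r0). Qed.

Let measurable_K (E : set (R * R)) : measurable E ->
  measurable_fun E (fun z : R * R => (K z.2 z.1)%:E).
Proof.
move=> mE; apply: measurable_funTS; apply/measurable_EFinP.
have m1 : measurable_fun setT (fun z : R * R => z.1) by exact: measurable_fst.
have m2 : measurable_fun setT (fun z : R * R => z.2) by exact: measurable_snd.
have mM : measurable_fun setT (fun z : R * R => M z.1).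
  exact: (measurableT_comp measurable_vol m1).
have mA : measurable_fun setT (fun z : R * R => A z.1).
  exact: (measurableT_comp measurable_annulus_cap m1).
have mc c : measurable_fun setT (fun z : R * R => c * M z.1).
  by apply: measurable_funM => //; exact: measurable_cst.
apply: measurable_fun_ifT.
- apply: measurable_and.
    by apply: measurable_fun_ler => //; apply: measurable_funM => //; exact: mc.
  apply: measurable_fun_ltr; last exact: measurable_cst.
  apply: measurable_funM => //; apply: measurable_funM; first exact: measurable_cst.
  exact: measurable_funX.
- apply: measurable_funM; last exact: (measurableT_comp (measurable_powR (1 - q)) (mc 9)).
  apply: measurable_funM => //.
  exact: (measurableT_comp (measurable_powR (-1)) m2).
- exact: measurable_cst.
Qed.

(** On these levels the capacity of the ball is at most 9 * lam * M. *)
Let K_le lam r : 0 < lam -> 1 < r -> live lam r ->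
  0 < r < 2^-1 * lam `^ (- 2^-1) /\
  K lam r <= lam `^ (q - 2) * (r * Cap G sigma lam (ball r) `^ (1 - q)).
Proof.
move=> lam0 r1 lv; have r0 : 0 < r by exact: lt_trans r1.
have M0 : 0 < M r by apply: vol_gt0; exact: ltW.
rewrite /K lv; case/andP: lv => lv1 lv2; split.
  rewrite r0/= mulrC ltr_pdivlMr// -(@ltr_pXn2r _ 2)// ?nnegrE ?powR_ge0 ?mulr_ge0 ?(ltW r0)//.
  rewrite -[ltRHS]powR_mulrn ?powR_ge0// -powRrM.
  rewrite (_ : - 2^-1 * 2%:R = -1) ?powR_inv1 ?(ltW lam0)//; last by field.
  by rewrite -[ltRHS]mul1r ltr_pdivlMr// exprMn -natrX; move: lv2; lra.
have C0 : 0 < Cap G sigma lam (ball r).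
  apply: lt_le_trans (@Cap_ge _ _ G sigma sigma_gt0 lam (ball r) o (ltW lam0) _ _).
  - by rewrite mulr_gt0.
  - exact: proper.
  - by apply: rho_ball_center => //; exact: ltW.
have CM : Cap G sigma lam (ball r) <= lam * (9 * M r).
  by apply: (le_trans (Cap_le_annulus (ltW lam0) r0)); lra.
have M90 : 0 < 9 * M r by rewrite mulr_gt0.
rewrite -mulrA [leRHS]mulrCA ler_pM2l//.
apply: (@le_trans _ _ (lam `^ (q - 2) * (lam * (9 * M r)) `^ (1 - q))).
  rewrite [X in _ <= _ * X]powRM ?(ltW lam0) ?(ltW M90)// mulrA -powRD; last by rewrite (gt_eqF lam0) implybT.
  by rewrite (_ : q - 2 + (1 - q) = -1)//; ring.
rewrite ler_wpM2l ?powR_ge0// -(opprB q 1) !powRN lef_pV2 ?posrE ?powR_gt0//; last first.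
  by rewrite mulr_gt0.
by apply: ge0_ler_powR; rewrite ?nnegrE ?subr_ge0 ?(ltW q1) ?(ltW C0)// mulr_ge0 ?(ltW lam0) ?(ltW M90).
Qed.

(** For each radius the admissible levels fill the range from A/(8M) to
    1/(4r^2), and the logarithm is the dlam/lam-measure of that range. *)
Let volume_integrand_le r : 1 < r ->
  ((9 `^ (1 - q) * (r / vol G sigma rho o (2 * r) `^ (q - 1) *
     ln (1 + vol G sigma rho o (2 * r) /
             (r ^+ 2 * annulus_cap G rho o r (2 * r)))))%:E <=
   \int[leb]_(lam in `]0%R, ((2^-1) ^+ 2)%R[) (K lam r)%:E)%E.
Proof.
move=> r1; rewrite -/(M r) -/(A r); have r0 : 0 < r by exact: lt_trans r1.
have M0 : 0 < M r by apply: vol_gt0; exact: ltW.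
have A0 := annulus_cap_ge0 r0.
have r20 : 0 < r ^+ 2 by rewrite exprn_gt0.
have AM : A r * r ^+ 2 <= M r by rewrite -ler_pdivlMr// annulus_cap_le.
have K0 : (0 <= \int[leb]_(lam in `]0%R, ((2^-1) ^+ 2)%R[) (K lam r)%:E)%E.
  by apply: integral_ge0 => lam _; rewrite lee_fin K_ge0.
(* if A r = 0, the division by zero makes the logarithm vanish *)
move: A0; rewrite le_eqVlt => /predU1P[A0|A0].
  by rewrite -A0 mulr0 invr0 mulr0 addr0 ln1 !mulr0.
pose a := A r / (8 * M r); pose b := (4 * r ^+ 2)^-1.
have a0 : 0 < a by rewrite divr_gt0// mulr_gt0.
have b0 : 0 < b by rewrite invr_gt0 mulr_gt0.
have ab : a < b.
  rewrite /a /b ltr_pdivrMr ?mulr_gt0// mulrC ltr_pdivlMr ?mulr_gt0//.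
  lra.
have b4 : b < (2^-1) ^+ 2.
  rewrite /b (_ : (2^-1) ^+ 2 = 4^-1 :> R); last by field.
  have : 1 < r ^+ 2 by rewrite exprn_egt1.
  by rewrite ltf_pV2 ?posrE ?mulr_gt0//; lra.
pose k := r * (9 * M r) `^ (1 - q).
have k0 : 0 <= k by rewrite mulr_ge0 ?powR_ge0 ?(ltW r0).
have le1 : (k%:E * \int[leb]_(lam in `[a, b[) (lam^-1)%:E <=
    \int[leb]_(lam in `]0%R, ((2^-1) ^+ 2)%R[) (K lam r)%:E)%E.
  apply: le_trans (lower_integralZl _ k0 _) _.
    move=> lam /=; rewrite in_itv/= => /andP[h _].
    by rewrite lee_fin invr_ge0; apply: le_trans h; exact: ltW.
  apply: le_lower_integral_support.
  - move=> lam /=; rewrite in_itv/= => /andP[h _].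
    by rewrite lee_fin mulr_ge0// invr_ge0; apply: le_trans h; exact: ltW.
  - by move=> lam _; rewrite lee_fin K_ge0.
  - move=> lam /=; rewrite in_itv/= => /andP[h1 h2]; right.
    have lam0 : 0 < lam by exact: lt_le_trans h1.
    split; first by rewrite in_itv/= lam0/=; exact: lt_trans b4.
    rewrite lee_fin /K (_ : live lam r).
      by rewrite powR_inv1 ?(ltW lam0)// /k mulrAC.
    apply/andP; split; first by rewrite -ler_pdivrMr// mulr_gt0.
    by rewrite -ltr_pdivlMr ?mulr_gt0// div1r.
apply: le_trans le1; rewrite integral_inv// -EFinM lee_fin.
have -> : ln b - ln a = ln (2 * (M r / (r ^+ 2 * A r))).
  rewrite -ln_div ?posrE//; congr ln; rewrite /a /b; field.
  by rewrite !gt_eqF.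
have X1 : 1 <= M r / (r ^+ 2 * A r) by rewrite ler_pdivlMr ?mulr_gt0// mul1r mulrC.
rewrite /k powRM ?(ltW M0)// -(opprB q 1) (powRN (M r)).
rewrite [leRHS](_ : _ = 9 `^ (- (q - 1)) * (r / M r `^ (q - 1) * ln (2 * (M r / (r ^+ 2 * A r))))); last by ring.
rewrite ler_wpM2l ?powR_ge0// ler_wpM2l ?divr_ge0 ?powR_ge0 ?(ltW r0)//.
by rewrite ler_ln ?posrE; lra.
Qed.

Let volume_integrand_ge0 r : 1 < r ->
  0 <= r / vol G sigma rho o (2 * r) `^ (q - 1) *
     ln (1 + vol G sigma rho o (2 * r) /
             (r ^+ 2 * annulus_cap G rho o r (2 * r))).
Proof.
move=> r1; have r0 : 0 < r by exact: lt_trans r1.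
rewrite mulr_ge0 ?divr_ge0 ?powR_ge0 ?(ltW r0)// ln_ge0// lerDl.
by rewrite divr_ge0 ?mulr_ge0 ?sqr_ge0 ?annulus_cap_ge0// ltW// vol_gt0// ltW.
Qed.

Lemma volume_integral_ge0 : (0 <= volume_integral G sigma rho q o)%E.
Proof.
apply: integral_ge0 => r /=; rewrite in_itv/= andbT => r1.
by rewrite lee_fin volume_integrand_ge0.
Qed.

(** Tonelli's theorem exchanges the integrals over levels and over radii. *)
Lemma volume_le_cap_integral :
  ((9 `^ (1 - q))%:E * volume_integral G sigma rho q o <=
   cap_integral G sigma rho (2^-1) q o)%E.
Proof.
apply: le_trans (lower_integralZl _ (powR_ge0 _ _) _) _.
  by move=> r /=; rewrite in_itv/= andbT => r1; rewrite lee_fin volume_integrand_ge0.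
apply: (@le_trans _ _ (\int[leb]_(r in (`]1%R, +oo[%classic : set R))
    \int[leb]_(lam in (`]0%R, ((2^-1) ^+ 2)%R[%classic : set R)) (K lam r)%:E)%E).
  apply: le_lower_integral => r /=; rewrite in_itv/= andbT => r1.
    by rewrite -EFinM lee_fin mulr_ge0 ?powR_ge0 ?volume_integrand_ge0.
  by rewrite -EFinM; exact: volume_integrand_le.
rewrite (@tonelli_on _ `]1%R, +oo[ `]0%R, ((2^-1) ^+ 2)%R[ (fun r lam => (K lam r)%:E))//; last 2 first.
- by apply: measurable_K; exact: measurableX.
- move=> r lam /=; rewrite in_itv/= andbT => r1 _; rewrite lee_fin K_ge0//.
  exact: lt_trans r1.
apply: le_lower_integral => lam /=; rewrite in_itv/= => /andP[lam0 _].
  apply: integral_ge0 => r /=; rewrite in_itv/= andbT => r1; rewrite lee_fin K_ge0//.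
  exact: lt_trans r1.
rewrite -ge0_integralZl//; last 3 first.
- by apply: measurable_cap_integrand.
- move=> r /=; rewrite in_itv/= => /andP[r0 _].
  by rewrite lee_fin mulr_ge0 ?powR_ge0 ?(ltW r0).
- by rewrite lee_fin powR_ge0.
apply: le_lower_integral_support.
- move=> r /=; rewrite in_itv/= andbT => r1; rewrite lee_fin K_ge0//.
  exact: lt_trans r1.
- move=> r /=; rewrite in_itv/= => /andP[r0 _].
  by rewrite -EFinM lee_fin !mulr_ge0 ?powR_ge0 ?(ltW r0).
- move=> r /=; rewrite in_itv/= andbT => r1.
  have [lv|nlv] := boolP (live lam r); last by left; rewrite /K (negbTE nlv).
  have [r_in Kle] := K_le lam0 r1 lv.
  by right; rewrite in_itv/= -EFinM lee_fin.
Qed.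

End Volume.

(** * From the heat kernel to capacities *)

Section MeasurableLaplace.
Context {R : realType}.
Notation leb := (@lebesgue_measure R).

(** The transform is an inner integral of Tonelli's theorem. *)
Lemma measurable_laplace_transform (v : R -> R) : continuous v ->
  (forall t, 0 <= t -> 0 <= v t) ->
  measurable_fun setT (fun lam : R => fine (laplace lam v)).
Proof.
move=> cv v0.
pose f := (fun z : R * R => (expR (- z.1 * z.2) * v z.2)%:E) \_ (setT `*` `]0%R, +oo[%classic).
have mf : measurable_fun setT f.
  apply/(measurable_restrictT _ _).1; first exact: measurableX.
  apply: measurable_funTS; apply/measurable_EFinP; apply: measurable_funM.
    apply: (measurableT_comp (@measurable_expR R)).
    by apply: measurable_funM => //; exact: measurableT_comp.
  by apply: measurableT_comp => //; exact: continuous_measurable_fun.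
have f0 z : (0 <= f z)%E.
  rewrite /f /patch; case: ifPn => // /set_mem[_ /=]; rewrite in_itv/= andbT => z0.
  by rewrite lee_fin mulr_ge0 ?expR_ge0 ?v0 ?ltW.
apply: (measurableT_comp (fine_measurable measurableT)) => //.
rewrite (_ : (fun lam => _) = (fun x => \int[leb]_y f (x, y))%E).
  exact: (@measurable_fun_fubini_tonelli_F _ _ _ _ _ leb f).
apply/funext => lam; rewrite /laplace integral_mkcond; apply: eq_integral => t _.
rewrite /f /patch; case: (boolP (t \in _)) => [/set_mem t0|/negP nt].
  by rewrite mem_set//; split.
by rewrite memNset// => -[_ /= h]; apply: nt; exact/mem_set.
Qed.

End MeasurableLaplace.

Section HeatIntegral.
Context {R : realType} {V : choiceType} (G : weighted_graph R V).
Variable sigma : V -> R.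
Hypothesis sigma_gt0 : forall x, 0 < sigma x.
Variable D : nat -> set V.
Hypothesis exD : exhaustion G D.
Variables (o : V) (q : R).
Hypothesis q1 : 1 < q.
Notation nuG := (nu G sigma).
Notation leb := (@lebesgue_measure R).
Let nupos := nu_gt0 G sigma_gt0.
Let nu0 x : 0 <= nuG x. Proof. exact/ltW/nupos. Qed.
Let finD j : finite_set (D j). Proof. by case: exD => H _ _; case: (H j). Qed.

Let Dmono i j : (i <= j)%N -> D i `<=` D j.
Proof. exact: exhaustion_mono exD. Qed.

Section Kernel.
Variables (t : R) (x : V).
Hypothesis t0 : 0 <= t.

Let dirichlet_ge0 j : 0 <= dirichlet_kernel G sigma (D j) t o x.
Proof.
have [/andP[oD xD]|nD] := boolP ((o \in D j) && (x \in D j)).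
  rewrite (dirichlet_kernelE G sigma_gt0 (finD j) t (set_mem oD) (set_mem xD)).
  by rewrite divr_ge0 ?heat_ge0//; exact: set_mem.
by rewrite /dirichlet_kernel (negbTE nD).
Qed.

Let dirichlet_mono : nondecreasing_seq (fun j => dirichlet_kernel G sigma (D j) t o x).
Proof.
move=> i j ij.
have [/andP[oD xD]|nD] := boolP ((o \in D i) && (x \in D i)); last first.
  by rewrite {1}/dirichlet_kernel (negbTE nD).
move: oD xD => /set_mem oD /set_mem xD.
have Dij := Dmono ij.
rewrite !dirichlet_kernelE//; [|exact: Dij|exact: Dij].
by rewrite ler_pM2r ?invr_gt0// heat_mono.
Qed.

Let dirichlet_cvg : cvgn (fun j => dirichlet_kernel G sigma (D j) t o x).
Proof.
apply: nondecreasing_is_cvgn; first exact: dirichlet_mono.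
exists (nuG o)^-1 => _ [j _ <-].
have [/andP[oD xD]|nD] := boolP ((o \in D j) && (x \in D j)); last first.
  by rewrite /dirichlet_kernel (negbTE nD) invr_ge0.
move: oD xD => /set_mem oD /set_mem xD.
rewrite dirichlet_kernelE// ler_piMl ?invr_ge0//.
by rewrite heat_le1.
Qed.

Lemma dirichlet_kernel_le j :
  dirichlet_kernel G sigma (D j) t o x <= heat_kernel G sigma D t o x.
Proof. exact: (nondecreasing_cvgn_le dirichlet_mono dirichlet_cvg). Qed.

Lemma heat_kernel_ge0 : 0 <= heat_kernel G sigma D t o x.
Proof. exact: le_trans (dirichlet_ge0 0) (dirichlet_kernel_le 0). Qed.

End Kernel.

Section FixedDomain.
Variable j : nat.
Hypothesis Do : D j o.
Let a x := nuG x * (nuG o)^-1 `^ q.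
Let a0 x : 0 <= a x. Proof. by rewrite mulr_ge0 ?powR_ge0. Qed.

Lemma level_massE lam : 0 < lam -> level_mass G sigma o (D j) lam q =
  \sum_(x <- fset_set (D j)) a x * resolvent G sigma (D j) o lam x `^ q.
Proof.
move=> lam0; rewrite /level_mass (@sum_nbhd_domain _ _ G _ (finD j)); last first.
  move=> x Dx; rewrite green_fn_off// powR0 ?mul0r//.
  by rewrite gt_eqF//; exact: lt_trans q1.
apply: eq_bigr => x _; rewrite /green_fn powRM ?invr_ge0 ?resolvent_ge0//.
by rewrite /a mulrC mulrA mulrAC.
Qed.

Lemma measurable_level_mass : measurable_fun setT
  (fun lam => level_mass G sigma o (D j) lam q).
Proof.
apply: measurable_sum => x; apply: measurable_funM; last exact: measurable_cst.
apply: (measurableT_comp (measurable_powR q)).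
apply: measurable_funM; last exact: measurable_cst.
apply: measurable_laplace_transform; first exact: heat_continuous.
by move=> t t0; exact: heat_ge0.
Qed.

Lemma heat_integral_ge :
  (\int[leb]_(t in `]0%R, +oo[)
     (\sum_(x <- fset_set (D j)) (a x * heat G sigma (D j) o t x `^ q)%:E) <=
   heat_integral G sigma D q o)%E.
Proof.
apply: le_lower_integral => t /=; rewrite in_itv/= andbT => t0.
  by apply: sume_ge0 => x _; rewrite lee_fin mulr_ge0 ?powR_ge0.
apply: esum_ge; exists (D j); first by split.
rewrite fsbig_finite//= big_seq [leRHS]big_seq; apply: lee_sum => x.
rewrite in_fset_set// => /set_mem Dx; rewrite lee_fin /a -mulrA mulrC ler_wpM2r//.
rewrite -powRM ?invr_ge0 ?heat_ge0 ?(ltW t0)// mulrC.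
have q0 : 0 <= q by apply: ltW; exact: lt_trans q1.
apply: ge0_ler_powR => //; rewrite ?nnegrE ?divr_ge0 ?heat_ge0 ?heat_kernel_ge0 ?(ltW t0)//.
rewrite -(dirichlet_kernelE G sigma_gt0 (finD j) t Do Dx).
by apply: dirichlet_kernel_le; exact: ltW.
Qed.

(** The bound on Laplace transforms at each vertex of the domain, summed. *)
Lemma level_mass_integral_le C :
  (forall v : R -> R, continuous v -> (forall t, 0 <= t -> 0 <= v t) ->
    (forall t, 0 <= t -> v t <= 1) ->
    (\int[leb]_(lam in `]0%R, +oo[) (lam `^ (q - 2) * fine (laplace lam v) `^ q)%:E
     <= C%:E * \int[leb]_(t in `]0%R, +oo[) (v t `^ q)%:E)%E) ->
  0 < C ->
  (\int[leb]_(lam in `]0%R, +oo[)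
     (lam `^ (q - 2) * level_mass G sigma o (D j) lam q)%:E <=
   C%:E * heat_integral G sigma D q o)%E.
Proof.
move=> HC C0; have cv x : continuous (fun t => heat G sigma (D j) o t x).
  exact: heat_continuous.
have h0 x t : 0 <= t -> 0 <= heat G sigma (D j) o t x by exact: heat_ge0.
have h1 x t : 0 <= t -> heat G sigma (D j) o t x <= 1 by exact: heat_le1.
have mh x : measurable_fun (`]0%R, +oo[%classic : set R)
    (fun t : R => (heat G sigma (D j) o t x `^ q)%:E).
  apply: measurable_funTS; apply/measurable_EFinP.
  apply: (measurableT_comp (measurable_powR q)).
  exact: continuous_measurable_fun.
have ml x : measurable_fun (`]0%R, +oo[%classic : set R)
    (fun lam : R => (lam `^ (q - 2) * resolvent G sigma (D j) o lam x `^ q)%:E).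
  apply: measurable_funTS; apply/measurable_EFinP.
  apply: measurable_funM; first exact: measurable_powR.
  apply: (measurableT_comp (measurable_powR q)).
  by apply: measurable_laplace_transform => //; exact: h0.
apply: (@le_trans _ _ (C%:E * \int[leb]_(t in `]0%R, +oo[)
     (\sum_(x <- fset_set (D j)) (a x * heat G sigma (D j) o t x `^ q)%:E))%E); last first.
  by rewrite lee_pmul2l//; exact: heat_integral_ge.
rewrite [leLHS](_ : _ = (\sum_(x <- fset_set (D j)) ((a x)%:E *
    \int[leb]_(lam in `]0%R, +oo[) (lam `^ (q - 2) * resolvent G sigma (D j) o lam x `^ q)%:E))%E); last first.
  rewrite (eq_bigr (fun x => (\int[leb]_(lam in `]0%R, +oo[) ((a x)%:E *
    (lam `^ (q - 2) * resolvent G sigma (D j) o lam x `^ q)%:E))%E)); last first.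
    move=> x _; rewrite ge0_integralZl//; [exact: ml| |by rewrite lee_fin].
    by move=> lam _; rewrite lee_fin; apply: mulr_ge0; exact: powR_ge0.
  rewrite -ge0_integral_sum//; last 2 first.
  - by move=> x; apply: measurable_funeM; exact: ml.
  - move=> x lam _; rewrite -EFinM lee_fin; apply: mulr_ge0 => //.
    by apply: mulr_ge0; exact: powR_ge0.
  apply: eq_integral => lam; rewrite inE/= in_itv/= andbT => lam0.
  rewrite level_massE// mulr_sumr -sumEFin; apply: eq_bigr => x _.
  by rewrite -EFinM mulrCA.
rewrite ge0_integral_sum//; last 2 first.
- move=> x; apply/measurable_EFinP; apply: measurable_funM => //.
  by apply/measurable_EFinP; exact: mh.
- by move=> x t _; rewrite lee_fin mulr_ge0 ?powR_ge0.
rewrite ge0_sume_distrr; last first.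
  by move=> x _; apply: integral_ge0 => t _; rewrite lee_fin mulr_ge0 ?powR_ge0.
apply: lee_sum => x _.
under [in leRHS]eq_integral do rewrite EFinM.
rewrite ge0_integralZl//; last 3 first.
- exact: mh.
- by move=> t _; rewrite lee_fin powR_ge0.
- by rewrite lee_fin.
rewrite muleCA lee_wpmul2l ?lee_fin//.
by apply: (HC (fun t => heat G sigma (D j) o t x)) => //; [exact: h0|exact: h1].
Qed.

Lemma level_mass_mono k lam : 0 < lam -> (j <= k)%N ->
  level_mass G sigma o (D j) lam q <= level_mass G sigma o (D k) lam q.
Proof.
move=> lam0 jk.
have q0 : 0 <= q by apply: ltW; exact: lt_trans q1.
have Djk := Dmono jk; have Dko : D k o by exact: Djk.
pose F i x := green_fn G sigma o (D i) lam x `^ q * nuG x.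
have off i x : D i o -> ~ D i x -> F i x = 0.
  move=> Dio Dx; rewrite /F green_fn_off// powR0 ?mul0r//.
  by rewrite gt_eqF//; exact: lt_trans q1.
have E i : D i o -> D i `<=` D k -> level_mass G sigma o (D i) lam q =
    \sum_(x <- nbhd G (D k)) F i x.
  move=> Dio Dik; transitivity (\sum_(x \in [set: V]) F i x).
    by apply/esym; apply: (@sum_domain _ _ G _ (finD i) (F i)) => x; exact: off.
  by apply: (@sum_domain _ _ G _ (finD k) (F i)) => x Dkx; apply: off => // /Dik.
rewrite (E j Do Djk) (E k Dko (@subset_refl _ _)).
apply: ler_sum => x _; apply: (ler_wpM2r (nu0 x)).
apply: (ge0_ler_powR q0).
- by rewrite nnegrE; exact: green_fn_ge0.
- by rewrite nnegrE; exact: green_fn_ge0.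
- apply: ler_wpM2r; first by rewrite invr_ge0.
  exact: resolvent_mono.
Qed.

End FixedDomain.

Lemma level_const_gt0 : 0 < level_const q.
Proof.
apply: addr_gt0; first by rewrite powR_gt0.
apply: mulr_gt0; first by rewrite ltr0n.
apply: mulr_gt0; last by rewrite powR_gt0.
by apply: mulr_gt0; [rewrite ltr0n|exact: log_const_gt0].
Qed.

End HeatIntegral.

Section CapacityHeat.
Context {R : realType} {V : choiceType} (G : weighted_graph R V).
Variables (sigma : V -> R) (rho : V -> V -> R).
Hypothesis sigma_gt0 : forall x, 0 < sigma x.
Hypothesis rho_edge : edge_length G rho.
Hypothesis adapted : nu_adapted G sigma rho.
Hypothesis proper : proper_dist G rho.
Variable D : nat -> set V.
Hypothesis exD : exhaustion G D.
Variables (o : V) (q C : R).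
Hypothesis q1 : 1 < q.
Hypothesis C0 : 0 < C.
Notation leb := (@lebesgue_measure R).
Hypothesis laplace_C :
  forall v : R -> R, continuous v -> (forall t, 0 <= t -> 0 <= v t) ->
    (forall t, 0 <= t -> v t <= 1) ->
    (\int[leb]_(lam in `]0%R, +oo[) (lam `^ (q - 2) * fine (laplace lam v) `^ q)%:E
     <= C%:E * \int[leb]_(t in `]0%R, +oo[) (v t `^ q)%:E)%E.

(** The domain given by [level_integral] depends on the level; monotone
    convergence along the exhaustion accommodates all levels at once. *)
Lemma cap_integral_le_heat :
  ((3 * level_const q * C)^-1%:E * cap_integral G sigma rho 2^-1 q o <=
   heat_integral G sigma D q o)%E.
Proof.
set k := 3 * level_const q.
have k0 : 0 < k by apply: mulr_gt0; [rewrite ltr0n|exact: level_const_gt0].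
have [j0 Dj0] : exists j0, D j0 o.
  have [j jP] := exhaustion_finite exD (finite_set1 o); exists j.
  by apply: (jP j (leqnn j)).
pose E : set R := `]0%R, ((2^-1) ^+ 2)%R[%classic.
have E0 lam : E lam -> 0 < lam by rewrite /E/= in_itv/= => /andP[].
have Do n : D (n + j0)%N o by apply: (exhaustion_mono exD (leq_addl n j0)).
pose g n lam := (lam `^ (q - 2) * level_mass G sigma o (D (n + j0)%N) lam q)%:E.
have g0 n lam : (0 <= g n lam)%E.
  by rewrite lee_fin; apply: mulr_ge0; [exact: powR_ge0|exact: level_mass_ge0].
have mg n : measurable_fun E (g n).
  apply: measurable_funTS; apply/measurable_EFinP.
  apply: measurable_funM; first exact: measurable_powR.
  exact: (measurable_level_mass sigma_gt0 exD q (Do n)).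
have gmono lam : E lam -> {homo g^~ lam : n m / (n <= m)%N >-> (n <= m)%E}.
  move=> El n m nm; rewrite lee_fin; apply: (ler_wpM2l (powR_ge0 _ _)).
  apply: (level_mass_mono sigma_gt0 exD q1 (Do n) (E0 _ El)).
  by rewrite leq_add2r.
have gle n : (\int[leb]_(lam in E) g n lam <= C%:E * heat_integral G sigma D q o)%E.
  apply: le_trans (level_mass_integral_le sigma_gt0 exD q1 (Do n) laplace_C C0).
  apply: lower_integral_subset => [lam /E0 l0|lam _]; last exact: g0.
  by rewrite /= in_itv/= l0.
have mE : measurable E by exact: measurable_itv.
have lim_le : (\int[leb]_(lam in E) limn (g^~ lam) <= C%:E * heat_integral G sigma D q o)%E.
  have cv := @cvg_monotone_convergence _ _ _ leb E mE g mg (fun n x _ => g0 n x) gmono.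
  by apply: (cvge_le _ cv); exact: nearW.
rewrite invfM mulrC EFinM -muleA lee_pdivrMl//.
apply: le_trans lim_le.
have k_inv : 0 <= k^-1 by rewrite invr_ge0 ltW.
apply: le_trans (lower_integralZl _ k_inv _) _.
  move=> lam _; apply: mule_ge0; first by rewrite lee_fin powR_ge0.
  apply: integral_ge0 => r /=; rewrite in_itv/= => /andP[r0 _].
  by rewrite lee_fin mulr_ge0 ?powR_ge0 ?(ltW r0).
apply: le_lower_integral => lam El.
  apply: mule_ge0; first by rewrite lee_fin.
  apply: mule_ge0; first by rewrite lee_fin powR_ge0.
  apply: integral_ge0 => r /=; rewrite in_itv/= => /andP[r0 _].
  by rewrite lee_fin mulr_ge0 ?powR_ge0 ?(ltW r0).
have lam0 := E0 _ El.
have [j [Dj Hj]] := level_integral sigma_gt0 rho_edge adapted proper o q1 lam0 exD.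
rewrite lee_pdivrMl//.
apply: (@le_trans _ _ (k%:E * g j lam)%E); last first.
  rewrite lee_pmul2l//; apply: lime_ge.
    by apply: ereal_nondecreasing_is_cvgn; exact: gmono.
  by exists j; [|move=> n /= jn; exact: (gmono lam El j n jn)].
apply: (@le_trans _ _ ((lam `^ (q - 2))%:E * (k * level_mass G sigma o (D j) lam q)%:E)%E).
  by apply: lee_wpmul2l; [rewrite lee_fin powR_ge0|exact: Hj].
rewrite /g -!EFinM lee_fin mulrCA; apply: (ler_wpM2l (ltW k0)).
apply: (ler_wpM2l (powR_ge0 _ _)).
apply: (level_mass_mono sigma_gt0 exD q1 Dj lam0); exact: leq_addr.
Qed.

End CapacityHeat.

Theorem theorem1p1 (R : realType) :
  exists eta : R, 0 < eta < 1 /\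
  forall q : R, 1 < q ->
  exists c : R, 0 < c /\
  forall (V : choiceType) (G : weighted_graph R V) (sigma : V -> R)
         (rho : V -> V -> R) (D : nat -> set V) (o : V),
    (forall x, 0 < sigma x) ->
    edge_length G rho -> nu_adapted G sigma rho -> proper_dist G rho ->
    exhaustion G D ->
    [/\ (c%:E * cap_integral G sigma rho eta q o
           <= heat_integral G sigma D q o)%E,
        (c%:E * volume_integral G sigma rho q o
           <= cap_integral G sigma rho eta q o)%E
      & (c%:E * volume_integral G sigma rho q o
           <= heat_integral G sigma D q o)%E].
Proof.
exists 2^-1; split; first by apply/andP; split; lra.
move=> q q1; have [C C0 HC] := laplace_Lq q1.
pose c1 := (3 * level_const q * C)^-1; pose c2 : R := 9 `^ (1 - q).
have c10 : 0 < c1.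
  rewrite invr_gt0; apply: mulr_gt0 => //; apply: mulr_gt0; first by rewrite ltr0n.
  exact: level_const_gt0.
have c20 : 0 < c2 by rewrite powR_gt0.
exists (Num.min (Num.min c1 c2) (c1 * c2)); split.
  by rewrite !lt_min c10 c20 mulr_gt0.
move=> V G sigma rho D o sigma_gt0 rho_edge adapted proper exD.
set c := Num.min _ _.
have c_c1 : c <= c1 by rewrite !ge_min lexx.
have c_c2 : c <= c2 by rewrite !ge_min lexx orbT.
have c_c12 : c <= c1 * c2 by rewrite !ge_min lexx orbT.
have H1 := cap_integral_le_heat sigma_gt0 rho_edge adapted proper exD o q1 C0 HC.
have H2 := volume_le_cap_integral sigma_gt0 rho_edge adapted proper o q1.
have vol0 := volume_integral_ge0 sigma_gt0 rho_edge proper o q.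
have cap0 : (0 <= cap_integral G sigma rho 2^-1 q o)%E.
  apply: integral_ge0 => lam _; apply: mule_ge0; first by rewrite lee_fin powR_ge0.
  apply: integral_ge0 => r /=; rewrite in_itv/= => /andP[r0 _].
  by rewrite lee_fin mulr_ge0 ?powR_ge0 ?(ltW r0).
have weaken (a : R) (X : \bar R) : c <= a -> (0 <= X)%E -> (c%:E * X <= a%:E * X)%E.
  by move=> ca X0; apply: lee_wpmul2r => //; rewrite lee_fin.
split.
- by apply: le_trans H1; exact: weaken.
- by apply: le_trans H2; exact: weaken.
- apply: (le_trans (weaken _ _ c_c12 vol0)); rewrite EFinM -muleA.
  apply: le_trans H1; apply: lee_wpmul2l => //; rewrite lee_fin; exact: ltW.
Qed.
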